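(* Let $\{\boldsymbol r_t\}$ follow the BEKK-ARCH model of order $p$ described in the context, with column-wise sparsity level $s$ of $\boldsymbol\Theta^*$. Suppose that: (i) $\{\boldsymbol r_t\}$ is strictly stationary and, for some $\epsilon\in(0,1]$, $\mathbb E|r_{t,j}|^{4+4\epsilon}\le M_{4+4\epsilon}$ for all $1\le j\le N$; (ii) $\{\boldsymbol r_t\}$ is $\alpha$-mixing with coefficients $\alpha(\ell)=O(\zeta^\ell)$, where $\zeta$ possibly depends on $N$ but $0\le\zeta(N)\le\bar\zeta$ for some constant $\bar\zeta<1$. Let $T_{\rm eff}=T/(\log T)^2$, $M=\max\{M_{4+4\epsilon},1\}$, $\boldsymbol\Gamma_x=\mathbb E(\boldsymbol x_t\boldsymbol x_t^{\mathrm T})$. If $T\gtrsim N^{1+1/\epsilon}\log(pd+1)$, $$\tau\asymp\left(\frac{M\,T_{\rm eff}}{\log(pd+1)}\right)^{\frac1{4+4\epsilon}}\quad\text{and}\quad \lambda\asymp s\|\boldsymbol\Theta^*\|_{1,\infty}\left(\frac{M^{1/\epsilon}\log(pd+1)}{T_{\rm eff}}\right)^{\frac{\epsilon}{1+\epsilon}},$$ then, with probability at least $1-C\exp[-Cs\log(T)\log(pd+1)]$, $$\|\widehat{\boldsymbol\Theta}-\boldsymbol\Theta^*\|_{\mathrm F}\lesssim s^{3/2}N\|\boldsymbol\Theta^*\|_{1,\infty}\,\lambda_{\min}^{-1}(\boldsymbol\Gamma_x)\left(\frac{M^{1/\epsilon}\log(pd+1)}{T_{\rm eff}}\right)^{\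frac{\epsilon}{1+\epsilon}}.$$
   Context: Model. Let $N,p\ge1$, $d=N(N+1)/2$. The $\mathbb R^N$-valued process $\{\boldsymbol r_t\}$ satisfies $\boldsymbol r_t=\boldsymbol\Sigma_t^{1/2}\boldsymbol\eta_t$, $\boldsymbol\Sigma_t=\boldsymbol\Omega^*+\sum_{i=1}^p\sum_{k=1}^{K_i}\mathbf A^*_{ik}\boldsymbol r_{t-i}\boldsymbol r_{t-i}^{\mathrm T}\mathbf A^{*\mathrm T}_{ik}$, where $\{\boldsymbol\eta_t\}$ are i.i.d. with mean zero and identity covariance, $\boldsymbol\Sigma_t$ is the conditional covariance of $\boldsymbol r_t$ given $\mathcal F_{t-1}=\sigma\{\boldsymbol r_{t-1},\boldsymbol r_{t-2},\dots\}$, $\boldsymbol\Omega^*$ is positive definite, and each row of each $\mathbf A^*_{ik}\in\mathbb R^{N\times N}$ has at most $s_A$ nonzero entries. Vech form. $\operatorname{vech}$ stacks the columns of the lower-triangular part; $\mathbf D_N\in\mathbb R^{N^2\times d}$ is the duplication matrix ($\mathbf D_N\operatorname{vech}(\mathbf S)=\operatorname{vec}(\mathbf S)$ for symmetric $\mathbf S$) and $\mathbf D_N^\dagger=(\mathbf D_N^{\mathrm T}\mathbf D_N)^{-1}\mathbf D_N^{\mathrm T}$. Put $\boldsymbol y_t=\operatorname{vech}(\boldsymbol r_t\boldsymbol r_t^{\mathrm T})\in\mathbb R^d$, $\boldsymbol\omega^*=\operatorname{vech}(\boldsymbol\Omega^* )$, $\boldsymbol\Phi_i^*=\mathbf D_N^\dagger(\sum_k\mathbf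 A^*_{ik}\otimes\mathbf A^*_{ik})\mathbf D_N$, $\boldsymbol\Theta^*=(\boldsymbol\omega^*,\boldsymbol\Phi_1^*,\dots,\boldsymbol\Phi_p^* )^{\mathrm T}\in\mathbb R^{(pd+1)\times d}$, $\boldsymbol x_t=(1,\boldsymbol y_{t-1}^{\mathrm T},\dots,\boldsymbol y_{t-p}^{\mathrm T})^{\mathrm T}$. Then $\boldsymbol y_t=\boldsymbol\Theta^{*\mathrm T}\boldsymbol x_t+\boldsymbol e_t$ with $\mathbb E(\boldsymbol e_t\mid\mathcal F_{t-1})=\boldsymbol 0$. $\mathcal S_j$ denotes the support of the $j$-th column of $\boldsymbol\Theta^*$, and $|\mathcal S_j|\le s$ for all $1\le j\le d$. Truncated regularized least squares estimator. For $\tau>0$ let $r_{t,j}(\tau)=\operatorname{sign}(r_{t,j})\min\{|r_{t,j}|,\tau\}$, $\boldsymbol y_t(\tau)=\operatorname{vech}(\boldsymbol r_t(\tau)\boldsymbol r_t(\tau)^{\mathrm T})$, $\boldsymbol x_t(\tau)=(1,\boldsymbol y_{t-1}^{\mathrm T}(\tau),\dots,\boldsymbol y_{t-p}^{\mathrm T}(\tau))^{\mathrm T}$, $\mathbf Y(\tau)=(\boldsymbol y_1(\tau),\dots,\boldsymbol y_T(\tau))^{\mathrm T}$, $\mathbf X(\tau)=(\boldsymbol x_1(\tau),\dots,\boldsymbol x_T(\tau))^{\mathrm T}$. For $\lambda>0$, $$\widehat{\boldsymbol\Theta}\in\arg\min_{\boldsymbol\Theta\in\mathbb R^{(pd+1)\times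 d}}\frac1{2T}\|\mathbf Y(\tau)-\mathbf X(\tau)\boldsymbol\Theta\|_{\mathrm F}^2+\lambda\|\boldsymbol\Theta\|_{1,1}.$$ Notation. $\|\mathbf A\|_{1,1}$ is the sum of absolute entries, $\|\mathbf A\|_{1,\infty}$ the maximum over columns of the column $\ell_1$-norm. It is assumed that $\lambda_{\min}(\boldsymbol\Gamma_x)>0$. $C$ denotes generic positive constants, possibly different at each occurrence, not depending on the dimension $N$ or the sample size $T$; $a\gtrsim b$ means $a\ge Cb$, $a\lesssim b$ means $b\gtrsim a$, and $a\asymp b$ means both. The $\gtrsim$ and $\asymp$ in the hypotheses are to be read with suitably chosen implied constants (not depending on $N,T$).
   Formalization: The implied constants may depend on a positive lower bound for ‖Θ*‖_{1,∞}; with constants uniform over all models the claim fails as ‖Θ*‖_{1,∞} tends to 0. *)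

(* Defs.v *)
From HB Require Import structures.
From mathcomp Require Import all_boot all_order all_algebra.
From mathcomp Require Import mxtens.
From mathcomp Require Import all_classical all_reals all_analysis.

Set Implicit Arguments.
Unset Strict Implicit.
Unset Printing Implicit Defensive.

Import Order.TTheory GRing.Theory Num.Theory.

Local Open Scope classical_set_scope.
Local Open Scope ring_scope.

Section Vech.
Variables (R : realType) (N : nat).

Definition vech_dim : nat := (N * N.+1)./2.

(* Positions (row, column) of the lower-triangular part, column after column. *)
Definition vech_pairs : seq ('I_N * 'I_N) :=
  [seq (i, j) | j : 'I_N <- enum 'I_N, i <- [seq i : 'I_N <- enum 'I_N | (j <= i)%N]].

Definition vech (S : 'M[R]_N) : 'cV[R]_vech_dim :=
  \col_k nth 0 [seq S ij.1 ij.2 | ij <- vech_pairs] k.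

(* Column stacking: [mxtens_unindex] sends the position j * N + i to (j, i),
   the index order used by the Kronecker product [*t]. *)
Definition vec (S : 'M[R]_N) : 'cV[R]_(N * N) :=
  \col_a S (mxtens_unindex a).2 (mxtens_unindex a).1.

(* The row of the duplication matrix at the position of (i, j) selects the
   entry of vech at (max i j, min i j); see [dup_mxP]. *)
Definition dup_mx : 'M[R]_(N * N, vech_dim) :=
  \matrix_(a, k)
    let j := (mxtens_unindex a).1 in let i := (mxtens_unindex a).2 in
    vech (if (j <= i)%N then delta_mx i j else delta_mx j i) k 0.

Definition dup_pinv : 'M[R]_(vech_dim, N * N) :=
  invmx (dup_mx^T *m dup_mx) *m dup_mx^T.

Lemma mem_vech_pairs (ij : 'I_N * 'I_N) :
  (ij \in vech_pairs) = (ij.2 <= ij.1)%N.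
Proof.
apply/allpairsPdep/idP => [[j [i [_]]]|le_ji].
  by rewrite mem_filter => /andP[ji _] ->.
exists ij.2, ij.1; split; rewrite ?mem_enum //; last by case: ij {le_ji}.
by rewrite mem_filter le_ji mem_enum.
Qed.

Lemma uniq_vech_pairs : uniq vech_pairs.
Proof.
apply: allpairs_uniq_dep; first exact: enum_uniq.
  by move=> j _; rewrite filter_uniq ?enum_uniq.
by move=> [j i] [j' i'] _ _ /= [-> ->].
Qed.

Lemma size_vech_pairs : size vech_pairs = vech_dim.
Proof.
rewrite size_allpairs_dep sumnE big_map big_enum /=.
under eq_bigr => j _ do rewrite size_filter -sum1_count big_enum_cond /= sum1_card.
transitivity (\sum_(j < N) (N - j))%N.
  apply: eq_bigr => j _; rewrite -sum1_card.
  rewrite -(big_mkord (fun i => j <= i)%N (fun=> 1%N)).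
  rewrite (big_cat_nat (n := j)) //=; last exact: ltnW.
  rewrite big_nat_cond big_pred0 ?add0n; last first.
    by move=> i; rewrite leq0n ltnNge /= andNb.
  rewrite big_nat_cond (eq_bigl (fun i => (j <= i < N)%N)); last first.
    by move=> i; case: (leqP j i); rewrite /= ?andbT ?andbF.
  by rewrite -big_nat sum_nat_const_nat muln1.
rewrite (reindex_inj rev_ord_inj) /=.
under eq_bigr => j _ do rewrite subKn //.
have := bin2_sum N.+1; rewrite big_ltn // add0n big_add1 big_mkord => ->.
by rewrite bin2 /vech_dim /= mulnC.
Qed.

Lemma dup_mxP (S : 'M[R]_N) : S^T = S -> dup_mx *m vech S = vec S.
Proof.
move=> symS; apply/colP => a; rewrite !mxE.
set j := (mxtens_unindex a).1; set i := (mxtens_unindex a).2.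
pose m := if (j <= i)%N then (i, j) else (j, i).
have mP : m \in vech_pairs by rewrite mem_vech_pairs /m; case: (leqP j i) => //= /ltnW.
have -> : S i j = S m.1 m.2.
  by rewrite /m; case: (leqP j i) => //= _; rewrite -[in LHS]symS mxE.
transitivity (\sum_(x <- vech_pairs) (x == m)%:R * S x.1 x.2).
  rewrite (big_nth m) size_vech_pairs big_mkord; apply: eq_bigr => k _.
  have vechE U : vech U k 0 = U (nth m vech_pairs k).1 (nth m vech_pairs k).2.
    by rewrite mxE (nth_map m) ?size_vech_pairs.
  rewrite mxE /= !vechE; congr (_ * _).
  by rewrite -/i -/j /m; case: (leqP j i) => _; rewrite mxE -pair_eqE.
rewrite (bigD1_seq m) ?uniq_vech_pairs //= eqxx mul1r big1 ?addr0 // => x.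
by move=> /negPf ->; rewrite mul0r.
Qed.

End Vech.

Section NormsSparsity.
Variables (R : realType) (m n : nat).
Implicit Type A : 'M[R]_(m, n).

Definition normF A : R := Num.sqrt (\sum_i \sum_j A i j ^+ 2).

Definition norm11 A : R := \sum_i \sum_j `|A i j|.

Definition norm1inf A : R := \big[Num.max/0]_j \sum_i `|A i j|.

Definition row_sparse (s : nat) A : Prop :=
  forall i, (#|[pred j | A i j != 0%R]| <= s)%N.

Definition col_sparse (s : nat) A : Prop :=
  forall j, (#|[pred i | A i j != 0%R]| <= s)%N.

End NormsSparsity.

Definition lambda_min (R : realType) (n : nat) (G : 'M[R]_n) : R :=
  inf [set a | eigenvalue G a].

Definition posdefmx (R : realType) (n : nat) (S : 'M[R]_n) : Prop :=
  S^T = S /\ forall v : 'cV[R]_n, v != 0 -> 0 < (v^T *m S *m v) 0 0.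

Definition psdmx (R : realType) (n : nat) (S : 'M[R]_n) : Prop :=
  S^T = S /\ forall v : 'cV[R]_n, 0 <= (v^T *m S *m v) 0 0.

Definition is_sqrtmx (R : realType) (n : nat) (S B : 'M[R]_n) : Prop :=
  psdmx B /\ B *m B = S.

Section BekkArch.
Variables (R : realType) (N p : nat).
Local Notation d := (vech_dim N).

(* [K i] and [A i] belong to lag i.+1; [rp] is a path t |-> r_t. *)
Variables (Omega : 'M[R]_N) (K : 'I_p -> nat).
Variable A : forall i : 'I_p, 'I_(K i) -> 'M[R]_N.
Implicit Type rp : int -> 'cV[R]_N.

Definition bekk_cov rp (t : int) : 'M[R]_N :=
  Omega + \sum_(i < p) \sum_(k < K i)
    A k *m (rp (t - i.+1%:Z) *m (rp (t - i.+1%:Z))^T) *m (A k)^T.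

Definition Phi (i : 'I_p) : 'M[R]_d :=
  dup_pinv R N *m (\sum_(k < K i) A k *t A k) *m dup_mx R N.

(* (Phi_1, ..., Phi_p) side by side: column i * d + l is column l of the
   block of lag i.+1. *)
Definition Phis : 'M[R]_(d, p * d) :=
  \matrix_(a, b) Phi (mxtens_unindex b).1 a (mxtens_unindex b).2.

Definition Theta : 'M[R]_(1 + p * d, d) := (row_mx (vech Omega) Phis)^T.

Definition yvec rp (t : int) : 'cV[R]_d := vech (rp t *m (rp t)^T).

Definition xvec rp (t : int) : 'cV[R]_(1 + p * d) :=
  col_mx (const_mx 1 : 'cV[R]_1)
    (\col_b yvec rp (t - (mxtens_unindex b : 'I_p * 'I_d).1.+1%:Z)
              (mxtens_unindex b).2 0).

Definition trunc (tau x : R) : R := Num.sg x * Num.min `|x| tau.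

Definition trunc_path (tau : R) rp (t : int) : 'cV[R]_N :=
  map_mx (trunc tau) (rp t).

(* Row k of the design matrices is time k.+1. *)
Definition Ymx (T : nat) (tau : R) rp : 'M[R]_(T, d) :=
  \matrix_(k, j) yvec (trunc_path tau rp) k.+1%:Z j 0.

Definition Xmx (T : nat) (tau : R) rp : 'M[R]_(T, 1 + p * d) :=
  \matrix_(k, a) xvec (trunc_path tau rp) k.+1%:Z a 0.

Definition objective (T : nat) (tau lambda : R) rp
    (B : 'M[R]_(1 + p * d, d)) : R :=
  (2 * T%:R)^-1 * normF (Ymx T tau rp - Xmx T tau rp *m B) ^+ 2
  + lambda * norm11 B.

Definition is_estimator (T : nat) (tau lambda : R) rp
    (B : 'M[R]_(1 + p * d, d)) : Prop :=
  forall B', objective T tau lambda rp B <= objective T tau lambda rp B'.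

End BekkArch.

Section Processes.
Context (disp : measure_display) (Om : measurableType disp) (R : realType).
Variable P : probability Om R.

Definition borel_mx (m n : nat) : set (set 'M[R]_(m, n)) :=
  <<s [set C | exists i j (B : set R),
         measurable B /\ C = [set M : 'M[R]_(m, n) | B (M i j)]] >>.

Definition same_law (m n : nat) (X Y : Om -> 'M[R]_(m, n)) : Prop :=
  forall C, borel_mx C -> P (X @^-1` C) = P (Y @^-1` C).

Definition is_cond_exp (G : set (set Om)) (X Y : Om -> R) : Prop :=
  [/\ P.-integrable setT (EFin \o X), P.-integrable setT (EFin \o Y),
      (forall B : set R, measurable B -> G (Y @^-1` B)) &
      forall E, G E ->
        (\int[P]_(w in E) (X w)%:E = \int[P]_(w in E) (Y w)%:E)%E].

Section Vectors.
Variable N : nat.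
Implicit Type X : int -> Om -> 'cV[R]_N.

Definition entry X (t : int) (j : 'I_N) : Om -> R := fun w => X t w j 0.

Definition process X : Prop := forall t j, measurable_fun setT (entry X t j).

Definition sigma_of (D : set int) X : set (set Om) :=
  <<s [set E | exists t j (B : set R),
         [/\ D t, measurable B & E = entry X t j @^-1` B]] >>.

Definition mutually_independent X : Prop :=
  forall (ts : seq int) (E : int -> set Om), uniq ts ->
    (forall t, t \in ts -> sigma_of [set t] X (E t)) ->
    fine (P (\bigcap_(t in [set` ts]) E t)) = \prod_(t <- ts) fine (P (E t)).

Definition iid X : Prop :=
  mutually_independent X /\ forall t t', same_law (X t) (X t').

Definition strictly_stationary X : Prop :=
  forall (n : nat) (ts : 'I_n -> int) (h : int),
    same_law (fun w => \matrix_(j < N, k < n) X (ts k) w j 0)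
             (fun w => \matrix_(j < N, k < n) X (ts k + h) w j 0).

Definition alpha_mix X (l : nat) : R :=
  sup [set a | exists t E F,
         [/\ sigma_of [set u | u <= t] X E,
             sigma_of [set u | t + l%:Z <= u] X F &
             a = `|fine (P (E `&` F)) - fine (P E) * fine (P F)|]].

Definition past X (t : int) : set (set Om) := sigma_of [set u | u < t] X.

(* The matrix square root is the symmetric positive semidefinite one.  The
   last two fields say that, given the past, r_t has conditional mean 0 and
   conditional covariance Sigma_t. *)
Record bekk_arch (p : nat) (Omega : 'M[R]_N) (K : 'I_p -> nat)
    (A : forall i : 'I_p, 'I_(K i) -> 'M[R]_N)
    (r eta : int -> Om -> 'cV[R]_N) : Prop := BekkArch {
  bekk_r_process : process r;
  bekk_eta_process : process eta;
  bekk_Omega : posdefmx Omega;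
  bekk_eta_iid : iid eta;
  bekk_eta_mean : forall t i, ('E_P[entry eta t i] = 0)%E;
  bekk_eta_cov : forall t i j,
    covariance P (entry eta t i) (entry eta t j) = ((i == j)%:R)%:E;
  bekk_eq : forall t, {ae P, forall w, exists2 B : 'M[R]_N,
    is_sqrtmx (bekk_cov Omega A (r^~ w) t) B & r t w = B *m eta t w};
  bekk_cond_mean : forall t i,
    is_cond_exp (past r t) (entry r t i) (fun=> 0);
  bekk_cond_cov : forall t i j,
    is_cond_exp (past r t) (entry r t i \* entry r t j)
      (fun w => bekk_cov Omega A (r^~ w) t i j)
}.

(* E(x_t x_t^T) does not depend on t for a stationary process. *)
Definition Gamma_x (p : nat) (r : int -> Om -> 'cV[R]_N)
    : 'M[R]_(1 + p * vech_dim N) :=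
  \matrix_(a, b)
    fine ('E_P[(fun w => xvec p (r^~ w) 0 a 0 * xvec p (r^~ w) 0 b 0)%R])%E.

End Vectors.
End Processes.

Definition T_eff (R : realType) (T : nat) : R := T%:R / ln T%:R ^+ 2.

Definition log_dim (R : realType) (p N : nat) : R :=
  ln ((p * vech_dim N).+1%:R).

Definition rate (R : realType) (p N T : nat) (eps M : R) : R :=
  (M `^ eps^-1 * log_dim R p N / T_eff R T) `^ (eps / (1 + eps)).

(* Main.v *)
(* The theorem reduces to one deviation inequality: every entry of the truncated
   sample second moments of (x_t, y_t) is within C s * rate of its population
   value with probability 1 - C exp (- s log T log (pd+1)).

   Lasso.  Column by column, the choice of lambda makes the score at Theta* at
   most lambda / 2, so the estimation error D satisfies |D|_1 <= 4 |Theta*_j|_1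
   and |D|_1 <= 4 sqrt s |D|_2.  Replacing the empirical Gram matrix by Gamma_x
   then costs only delta |D|_1 ^ 2 <= 4 delta |Theta*_j|_1 |D|_1, which is of the
   order of lambda |D|_1; hence the error bound without any lower bound on T in
   terms of lambda_min Gamma_x.  The population score vanishes because
   E (y_t x_t^T) = Theta*^T Gamma_x, by the conditional covariance equation.

   Deviation.  With B = tau ^ 4, truncation costs a bias of order M B ^ (- eps)
   and leaves variables bounded by B with second moments at most
   4 M B ^ (1 - eps).  The tail bound exp (- x / (C B log T)) is obtained from
   alpha-mixing through Laplace transforms at t ~ 1 / (B log T) of sums over
   Cantor-like sets: two copies of a set of 2 ^ j A_0 points are put at a distance
   of order A_0 + 2 ^ j, A_0 ~ log T, long enough for the mixing coefficient to
   beat the sup norm of the exponentials and short enough for the sets to keep a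
   positive density up to length T.  The full sum is an average over the
   translates of one such set, and convexity of exp concludes. *)
Require Import Defs.
From HB Require Import structures.
From mathcomp Require Import all_boot all_order all_algebra.
From mathcomp Require Import mxtens ring lra zify.
From mathcomp Require Import all_classical all_reals all_analysis.
From mathcomp Require Import measurable_realfun.

Set Implicit Arguments.
Unset Strict Implicit.
Unset Printing Implicit Defensive.

Import Order.TTheory GRing.Theory Num.Theory.
Import numFieldNormedType.Exports.

Local Open Scope classical_set_scope.
Local Open Scope ring_scope.

(** * Covariance inequality under mixing *)

(** Mixing is assumed for events, while Laplace transforms are expectations of functions;
    combinations of level-set indicators carry the one to the other, and the same device extends the
    conditional moment equations from events to past variables. Every entry of the second moments of
    (x_t, y_t) is the mean of a product of four coordinates, once the intercept is padded with
    factors 1. So one bias bound and one tail bound serve all entries, and M >= 1 and tau >= 1 let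
    the factor 1 count as a coordinate. The scales fit through B0 = (M T_eff / L) ^ (1 / (1 + eps)),
    of the order of tau ^ 4, with L = log (pd+1). The rate is M B0 ^ (- eps), the order of the bias,
    and T rate = B0 L (log T) ^ 2, so a deviation of order s rate, measured in the unit B0 log T of
    the tail bound, is a multiple of s L log T, while the variance contributes only L log T. The
    condition on T enters through L <= T_eff, that is, B0 >= 1. The score at Theta* is a deviation
    times 1 + |Theta*|, but lambda is proportional to |Theta*|; the lower bound theta0 on this norm
    closes the gap. *)

Definition staircase (R : realType) (h : R) (n : nat) (x : R) : R :=
  \sum_(i < n) h * (i.+1%:R * h <= x)%R%:R.

(** For x >= 0 the staircase is h times min(n, floor(x / h)), written as a sum of indicators of
    upper level sets, so that a statement on events can be summed into one on functions. *)
Lemma staircase_approx (R : realType) (h x : R) (n : nat) :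
  0 < h -> 0 <= x <= n%:R * h -> staircase h n x <= x <= staircase h n x + h.
Proof.
move=> h0 /andP[x0 xn].
(* Splitting at the top level [n%:R * h] keeps the induction free of the bound [x <= n%:R * h],
   which may fail for smaller [n]. *)
have [ge_n lt_n] : (n%:R * h <= x -> staircase h n x = n%:R * h) /\
    (x < n%:R * h -> staircase h n x <= x < staircase h n x + h).
  elim: n {xn} => [|n [IH1 IH2]].
    rewrite /staircase big_ord0 mul0r; split=> // x_lt0.
    by rewrite ltNge x0 in x_lt0.
  rewrite /staircase big_ord_recr /= -/(staircase h n x).
  split=> [le_x|x_lt].
    rewrite IH1 ?le_x ?mulr1 -?natr1; first lra.
    by apply: le_trans le_x; rewrite ler_pM2r// ler_nat.
  rewrite (_ : (n.+1%:R * h <= x)%R = false) ?mulr0 ?addr0; last by rewrite leNgt x_lt.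
  have [le_x|lt_x] := leP (n%:R * h) x; last exact: IH2.
  rewrite IH1// le_x /=; move: x_lt; rewrite -natr1; lra.
have [le_x|lt_x] := leP (n%:R * h) x; last by have /andP[-> /ltW] := lt_n lt_x.
by rewrite ge_n// le_x; lra.
Qed.

(** Cauchy-Schwarz against the constant 1, read off from the sum of squared deviations from the mean
    [m] being nonnegative. *)
Lemma sqr_sum_le (R : realType) (I : finType) (S : pred I) (x : I -> R) :
  (\sum_(k | S k) x k) ^+ 2 <= #|S|%:R * \sum_(k | S k) x k ^+ 2.
Proof.
have [S0|n0] := posnP #|S|.
  by rewrite !big_pred0 ?expr0n ?mulr0//; exact: card0_eq.
have n0' : 0 < #|S|%:R :> R by rewrite ltr0n.
set s := \sum_(k | S k) x k; pose m := s / #|S|%:R.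
have : 0 <= \sum_(k | S k) (x k - m) ^+ 2 by apply: sumr_ge0 => k _; exact: sqr_ge0.
have -> : \sum_(k | S k) (x k - m) ^+ 2 =
    \sum_(k | S k) x k ^+ 2 - s * m.
  have E k : (x k - m) ^+ 2 = x k ^+ 2 + ((- 2 * m) * x k + m ^+ 2) by ring.
  under eq_bigr do rewrite E.
  rewrite big_split /= big_split /= -mulr_sumr -/s sumr_const.
  rewrite -[m ^+ 2 *+ _]mulr_natl; congr (_ + _).
  by rewrite /m; field; rewrite gt_eqF.
by rewrite /m subr_ge0 mulrA -expr2 ler_pdivrMr// [leRHS]mulrC.
Qed.

Section Expectation.
Context (disp : measure_display) (Om : measurableType disp) (R : realType).
Variable P : probability Om R.
Implicit Types (f g : Om -> R) (G : set (set Om)).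

Definition integrable_rv f := P.-integrable setT (EFin \o f).

Lemma bounded_integrable f (b : R) :
  measurable_fun setT f -> (forall w, `|f w| <= b) -> integrable_rv f.
Proof.
move=> mf fb; apply: measurable_bounded_integrable => //.
  by rewrite (le_lt_trans (probability_le1 P measurableT))// ltry.
rewrite /bounded_near; near=> M => w _ /=.
rewrite (le_trans (fb w))//; near: M; exact: nbhs_pinfty_ge.
Unshelve. all: by end_near. Qed.

Lemma integrable_rvD f g : integrable_rv f -> integrable_rv g ->
  integrable_rv (fun w => f w + g w).
Proof. by move=> /integrableD H /H{H}; exact. Qed.

Lemma integrable_rvZ (c : R) f : integrable_rv f ->
  integrable_rv (fun w => c * f w).
Proof. by move=> /(integrableZl measurableT c). Qed.

Lemma integrable_rvB f g : integrable_rv f -> integrable_rv g ->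
  integrable_rv (fun w => f w - g w).
Proof. by move=> /integrableB H /H{H}; exact. Qed.

Lemma integrable_rv_sum I (s : seq I) (F : I -> Om -> R) :
  (forall i, integrable_rv (F i)) ->
  integrable_rv (fun w => \sum_(i <- s) F i w).
Proof.
move=> iF; elim: s => [|i s IH].
  under eq_fun do rewrite big_nil.
  by apply: (@bounded_integrable _ 0) => // w; rewrite normr0.
under eq_fun do rewrite big_cons.
exact: integrable_rvD.
Qed.

Lemma expect_sum I (s : seq I) (F : I -> Om -> R) :
  (forall i, integrable_rv (F i)) ->
  \int[P]_w (\sum_(i <- s) F i w) = \sum_(i <- s) \int[P]_w F i w.
Proof.
move=> iF; elim: s => [|i s IH].
  rewrite big_nil; under eq_Rintegral do rewrite big_nil.
  by rewrite Rintegral_cst// mul0r.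
rewrite big_cons -IH; under eq_Rintegral do rewrite big_cons.
rewrite RintegralD//; first exact: iF.
exact: integrable_rv_sum.
Qed.

Lemma expect_cst (c : R) : \int[P]_w c = c.
Proof. by rewrite Rintegral_cst//= probability_setT mulr1. Qed.

Lemma integrable_rv_cst (c : R) : integrable_rv (fun=> c).
Proof. exact: (@bounded_integrable _ `|c|). Qed.

Lemma le_expect f g : integrable_rv f -> integrable_rv g ->
  (forall w, f w <= g w) -> \int[P]_w f w <= \int[P]_w g w.
Proof. by move=> fi gi fg; apply: le_Rintegral. Qed.

Lemma expect_indicZ (A : set Om) (c : R) :
  measurable A -> \int[P]_w (c * \1_A w) = c * fine (P A).
Proof.
move=> mA; rewrite RintegralZl//; last exact: integrable_indic.
congr (c * fine _).
by rewrite -(expectation_indic P mA) unlock.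
Qed.

Lemma integrable_indicZ (A : set Om) (c : R) :
  measurable A -> integrable_rv (fun w => c * \1_A w).
Proof. by move=> mA; apply: integrable_rvZ; exact: integrable_indic. Qed.

Lemma integrable_rv_staircase f (h : R) n : measurable_fun setT f ->
  integrable_rv (fun w => staircase h n (f w)).
Proof.
move=> mf; apply: integrable_rv_sum => i.
pose A := f @^-1` `[i.+1%:R * h, +oo[%classic.
have -> : (fun w => h * (i.+1%:R * h <= f w)%R%:R) = (fun w => h * \1_A w).
  apply/funext => w; rewrite indicE; congr (_ * (nat_of_bool _)%:R).
  by apply/idP/idP; rewrite inE /A /= in_itv /= andbT.
by apply: integrable_indicZ; rewrite -[X in measurable X]setTI; exact: mf.
Qed.

(** [G] is only a generating family; past and future are compared on the one space [Om] by changing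
    the generated sigma-algebra. *)
Definition measurable_wrt G f :=
  @measurable_fun _ _ (g_sigma_algebraType G) R setT f.

Lemma measurable_wrt_sub G f :
  <<s G >> `<=` @measurable _ Om -> measurable_wrt G f -> measurable_fun setT f.
Proof.
move=> GT mf _ Y mY; rewrite setTI; apply: GT.
by have := mf measurableT Y mY; rewrite setTI.
Qed.

Lemma measurable_wrt_ge G f (c : R) : measurable_wrt G f ->
  <<s G >> [set w | c <= f w].
Proof.
move=> mf; have := mf measurableT `[c, +oo[%classic (measurable_itv _).
rewrite setTI; congr (<<s _ >> _); apply/seteqP; split=> w /=;
  by rewrite in_itv/= andbT.
Qed.

Section Covariance.
Variables (F G : set (set Om)) (alpha : R).
Hypothesis FT : <<s F >> `<=` @measurable _ Om.
Hypothesis GT : <<s G >> `<=` @measurable _ Om.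
Hypothesis mix : forall A B, <<s F >> A -> <<s G >> B ->
  fine (P (A `&` B)) <= fine (P A) * fine (P B) + alpha.

(** Both staircases expand into indicators with positive weights [h] and [k]; each of the [n * m]
    pairs of level sets pays [h * k * alpha]. *)
Lemma expect_mul_staircase (f g : Om -> R) (h k : R) (n m : nat) :
  0 < h -> 0 < k -> measurable_wrt F f -> measurable_wrt G g ->
  \int[P]_w (staircase h n (f w) * staircase k m (g w)) <=
  (\int[P]_w staircase h n (f w)) * (\int[P]_w staircase k m (g w))
  + (n%:R * h) * (m%:R * k) * alpha.
Proof.
move=> h0 k0 mf mg.
pose A (i : 'I_n) := [set w | i.+1%:R * h <= f w].
pose B (j : 'I_m) := [set w | j.+1%:R * k <= g w].
have FA i : <<s F >> (A i) by exact: measurable_wrt_ge.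
have GB j : <<s G >> (B j) by exact: measurable_wrt_ge.
have mA i : measurable (A i) by exact: FT.
have mB j : measurable (B j) by exact: GT.
have mAB i j : measurable (A i `&` B j) by exact: measurableI.
have sfE w : staircase h n (f w) = \sum_(i < n) h * \1_(A i) w.
  apply: eq_bigr => i _; rewrite indicE; congr (_ * (nat_of_bool _)%:R).
  by apply/idP/idP => [Qw|]; [exact: mem_set | rewrite inE].
have sgE w : staircase k m (g w) = \sum_(j < m) k * \1_(B j) w.
  apply: eq_bigr => i _; rewrite indicE; congr (_ * (nat_of_bool _)%:R).
  by apply/idP/idP => [Qw|]; [exact: mem_set | rewrite inE].
have -> : \int[P]_w staircase h n (f w) = \sum_(i < n) h * fine (P (A i)).
  under eq_Rintegral do rewrite sfE.
  rewrite expect_sum; last by move=> i; exact: integrable_indicZ.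
  by apply: eq_bigr => i _; rewrite expect_indicZ.
have -> : \int[P]_w staircase k m (g w) = \sum_(j < m) k * fine (P (B j)).
  under eq_Rintegral do rewrite sgE.
  rewrite expect_sum; last by move=> j; exact: integrable_indicZ.
  by apply: eq_bigr => j _; rewrite expect_indicZ.
have -> : \int[P]_w (staircase h n (f w) * staircase k m (g w)) =
    \sum_(i < n) \sum_(j < m) h * k * fine (P (A i `&` B j)).
  transitivity (\int[P]_w \sum_(i < n) \sum_(j < m)
      (h * k) * \1_(A i `&` B j) w).
    apply: eq_Rintegral => w _; rewrite sfE sgE mulr_suml.
    apply: eq_bigr => i _; rewrite mulr_sumr; apply: eq_bigr => j _.
    by rewrite indicI /=; ring.
  rewrite expect_sum; last first.
    by move=> i; apply: integrable_rv_sum => j; exact: integrable_indicZ.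
  apply: eq_bigr => i _; rewrite expect_sum; last first.
    by move=> j; exact: integrable_indicZ.
  by apply: eq_bigr => j _; rewrite expect_indicZ.
rewrite mulr_suml.
have -> : n%:R * h * (m%:R * k) * alpha =
    \sum_(i < n) \sum_(j < m) h * k * alpha.
  rewrite !sumr_const !card_ord -[RHS]mulr_natl -(mulr_natl (h * k * alpha) m).
  by ring.
rewrite -big_split /=; apply: ler_sum => i _.
rewrite mulr_sumr -big_split /=; apply: ler_sum => j _.
have := mix (FA i) (GB j); have := mulr_gt0 h0 k0; set hk := h * k => hk0 le1.
rewrite (_ : _ + _ = hk * (fine (P (A i)) * fine (P (B j)) + alpha)).
  by rewrite ler_pM2l.
by rewrite /hk; ring.
Qed.

(** The mixing cost of the staircases, [b * c * alpha], does not depend on the mesh, so the mesh can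
    be refined until the discretization error vanishes. An upper bound is what an estimate of
    Laplace transforms calls for. *)
Lemma mixing_covariance (f g : Om -> R) (b c : R) : 0 < b -> 0 < c ->
  measurable_wrt F f -> measurable_wrt G g ->
  (forall w, 0 <= f w <= b) -> (forall w, 0 <= g w <= c) ->
  \int[P]_w (f w * g w) <=
  (\int[P]_w f w) * (\int[P]_w g w) + b * c * alpha.
Proof.
move=> b0 c0 mf mg fb gc.
have mf' := measurable_wrt_sub FT mf; have mg' := measurable_wrt_sub GT mg.
have intf : integrable_rv f.
  by apply: (@bounded_integrable _ b) => // w; have := fb w; rewrite ler_norml; lra.
have intg : integrable_rv g.
  by apply: (@bounded_integrable _ c) => // w; have := gc w; rewrite ler_norml; lra.
have intfg : integrable_rv (fun w => f w * g w).
  apply: (@bounded_integrable _ (b * c)).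
    exact: measurable_funM.
  move=> w; rewrite normrM; have /andP[??] := fb w; have /andP[??] := gc w.
  by rewrite !ger0_norm// ler_pM.
have key n : (0 < n)%N -> \int[P]_w (f w * g w) <=
    (\int[P]_w f w) * (\int[P]_w g w) + b * c * alpha + 3 * (b * c) / n%:R.
  move=> n0; have n0' : 0 < n%:R :> R by rewrite ltr0n.
  pose h := b / n%:R; pose k := c / n%:R.
  have h0 : 0 < h by rewrite divr_gt0.
  have k0 : 0 < k by rewrite divr_gt0.
  have nh : n%:R * h = b by rewrite /h mulrC divfK// gt_eqF.
  have nk : n%:R * k = c by rewrite /k mulrC divfK// gt_eqF.
  have sf w : staircase h n (f w) <= f w <= staircase h n (f w) + h.
    by apply: staircase_approx => //; rewrite nh; have := fb w; lra.
  have sg w : staircase k n (g w) <= g w <= staircase k n (g w) + k.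
    by apply: staircase_approx => //; rewrite nk; have := gc w; lra.
  have s0 l x : 0 < l -> 0 <= staircase l n x :> R.
    by move=> l0; apply: sumr_ge0 => i _; rewrite mulr_ge0// ltW.
  have isf : integrable_rv (fun w => staircase h n (f w)).
    exact: integrable_rv_staircase.
  have isg : integrable_rv (fun w => staircase k n (g w)).
    exact: integrable_rv_staircase.
  have isfg : integrable_rv (fun w => staircase h n (f w) * staircase k n (g w)).
    apply: (@bounded_integrable _ (b * c)).
      by apply: measurable_funM; apply/measurable_EFinP;
        [exact: measurable_int isf | exact: measurable_int isg].
    move=> w; rewrite normrM !ger0_norm ?s0//.
    apply: ler_pM; rewrite ?s0//.
      by have := sf w; have := fb w; lra.
    by have := sg w; have := gc w; lra.
  have le1 : \int[P]_w (f w * g w) <=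
      \int[P]_w (staircase h n (f w) * staircase k n (g w) + 3 * (b * c) / n%:R).
    apply: le_expect => //; first exact: integrable_rvD isfg (integrable_rv_cst _).
    move=> w; have := sf w; have := sg w; have := fb w; have := gc w.
    have := s0 h (f w) h0; have := s0 k (g w) k0.
    set x := f w; set y := g w; set u := staircase h n x; set v := staircase k n y.
    move=> v0 u0 /andP[y0 yc] /andP[x0 xb] /andP[vy yv] /andP[ux xu].
    have -> : 3 * (b * c) / n%:R = 3 * b * k by rewrite /k; field; rewrite gt_eqF.
    have hE : h * c = b * k by rewrite /h /k; ring.
    (* Beyond [u * v] the product has the cross terms [h * v], [u * k] and [h * k], each at most
       [b * k = b * c / n]; hence the factor 3. *)
    have : x * y <= (u + h) * (v + k) by rewrite ler_pM.
    have : h * v <= h * c by rewrite ler_pM2l//; lra.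
    have : u * k <= b * k by rewrite ler_pM2r//; lra.
    have : h * k <= b * k.
      by rewrite ler_pM2r// /h ler_pdivrMr// ler_peMr ?ler1n// ltW.
    rewrite hE mulrDl !mulrDr; lra.
  apply: (le_trans le1).
  rewrite RintegralD//; last exact: integrable_rv_cst.
  rewrite expect_cst lerD2r.
  apply: (le_trans (expect_mul_staircase n n h0 k0 mf mg)).
  rewrite nh nk lerD2r; apply: ler_pM.
  - by apply: Rintegral_ge0 => w _; exact: s0.
  - by apply: Rintegral_ge0 => w _; exact: s0.
  - by apply: le_expect => // w; have /andP[] := sf w.
  - by apply: le_expect => // w; have /andP[] := sg w.
apply/ler_addgt0Pr => e e0.
pose n := (Num.truncn (3 * (b * c) / e)).+1.
apply: (le_trans (key n isT)); rewrite lerD2l.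
rewrite ler_pdivrMr ?ltr0n// [leRHS]mulrC -ler_pdivrMr//.
by apply/ltW; exact: truncnS_gt.
Qed.

End Covariance.

End Expectation.

(** * Bernstein inequality under geometric mixing *)

(** Since exp y <= 1 / (1 - y), it suffices that (1 - y)(1 + y + 2 y^2) = 1 + y^2 (1 - 2 y) is at
    least 1. *)
Lemma expR_le_quad (R : realType) (y : R) :
  y <= 2^-1 -> expR y <= 1 + y + 2 * y ^+ 2.
Proof.
move=> y2; have y1 : 0 < 1 - y by lra.
have : expR y * (1 - y) <= 1.
  rewrite -ler_pdivlMl ?expR_gt0// mulr1 -expRN.
  by have := expR_ge1Dx (- y).
move=> le1; rewrite -(ler_pM2r y1); apply: (le_trans le1).
have : 0 <= y ^+ 2 * (1 - 2 * y) by rewrite mulr_ge0 ?sqr_ge0//; lra.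
by rewrite !expr2; nra.
Qed.

(** Jensen for the uniform mean [m]: each exponential lies above its tangent line at [m], and the
    linear parts sum to zero. *)
Lemma expR_mean_le (R : realType) (q : nat) (y : nat -> R) : (0 < q)%N ->
  expR (q%:R^-1 * \sum_(a < q) y a) <= q%:R^-1 * \sum_(a < q) expR (y a).
Proof.
move=> q0; have q0' : 0 < q%:R :> R by rewrite ltr0n.
set m := q%:R^-1 * _.
have -> : expR m = q%:R^-1 * \sum_(a < q) expR m * (1 + (y a - m)).
  rewrite -mulr_sumr big_split /= sumrB !sumr_const !card_ord.
  have -> : \sum_(i < q) y i = q%:R * m by rewrite /m mulrA divff ?mul1r ?gt_eqF.
  by rewrite -[m *+ q]mulr_natl subrr addr0 mulrCA mulVf ?mulr1 ?gt_eqF.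
rewrite ler_pM2l ?invr_gt0//; apply: ler_sum => a _.
rewrite -ler_pdivlMl ?expR_gt0// -expRN -expRD [- m + _]addrC.
exact: expR_ge1Dx.
Qed.

(** Serves the cut in [laplace_block]: it sits at an integer that may be negative, because a
    translate can start before the sample, whereas the coordinates used have natural indices. *)
Lemma shift_before (a k W n : nat) : (W <= a + k)%N -> (k < n)%N ->
  (a + k - W)%N%:Z < (a + n)%N%:Z - W%:Z.
Proof. lia. Qed.

Lemma shift_after (a k W n g : nat) : (W <= a + (n + g) + k)%N ->
  (a + n)%N%:Z - W%:Z + g%:Z <= (a + (n + g) + k - W)%N%:Z.
Proof. lia. Qed.

Lemma double_pred_expn (R : realType) (j : nat) :
  (2 ^ j.+2 - 1)%:R = 2 * (2 ^ j.+1 - 1)%:R + 1 :> R.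
Proof.
rewrite -natrM natr1; congr _%:R; rewrite [in LHS]expnS.
by have := expn_gt0 2 j.+1; move: (2 ^ j.+1)%N => y; lia.
Qed.

(* [A0] points form a block; level [j.+1] puts two copies of level [j] at
   distance [cantor_gap j], long enough for the mixing coefficient to beat the
   supremum of the Laplace transform of a level-[j] sum. *)
Section CantorOffsets.
Variables c A0 : nat.

Definition cantor_gap (j : nat) : nat := c * (A0 + 2 ^ j).

Fixpoint cantor_span (j : nat) : nat :=
  if j is j'.+1 then (2 * cantor_span j' + cantor_gap j')%N else A0.

Fixpoint cantor_offs (j : nat) : seq nat :=
  if j is j'.+1 then
    cantor_offs j' ++ [seq (cantor_span j' + cantor_gap j' + k)%N | k <- cantor_offs j']
  else iota 0 A0.

Lemma size_cantor_offs j : size (cantor_offs j) = (2 ^ j * A0)%N.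
Proof.
elim: j => [|j IH] /=; first by rewrite size_iota mul1n.
by rewrite size_cat size_map IH expnS -mulnA mul2n addnn.
Qed.

Lemma cantor_offs_lt j k : k \in cantor_offs j -> (k < cantor_span j)%N.
Proof.
elim: j k => [|j IH] k /=; first by rewrite mem_iota.
rewrite mem_cat => /orP[/IH|/mapP[i /IH]]; last by lia.
by move=> ?; lia.
Qed.

(** The term [c * A0] on the left absorbs the constant part of each gap, so that span + c A0 doubles
    at each level up to the extra [c * 2 ^ j]; this makes the induction close. *)
Lemma cantor_span_le j : (cantor_span j + c * A0 <= 2 ^ j * (A0 + c * A0 + c * j))%N.
Proof.
elim: j => [|j IH] /=; first by rewrite expn0 muln0 addn0 mul1n.
rewrite /cantor_gap expnS; move: IH; set u := (2 ^ j)%N.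
rewrite -mulnA !(mulnDr, mulnS) => IH.
have -> : (u * c = c * u)%N by rewrite mulnC.
lia.
Qed.

End CantorOffsets.

(** Positive density, with [y = 2 ^ J]: when [J <= 2 * A0] the span is at most (1 + 3 c) y A0, and
    the sample adds at most one more y A0. *)
Lemma covering_span (c A0 J y n T : nat) :
  (n + c * A0 <= y * (A0 + c * A0 + c * J))%N -> (J <= 2 * A0)%N ->
  (T <= y * A0)%N -> (n + T <= (2 + 3 * c) * (y * A0))%N.
Proof.
move=> nle Jle Tle.
have : (c * y * J <= c * y * (2 * A0))%N by rewrite leq_mul2l Jle orbT.
by lia.
Qed.

Section Bernstein.
Context (disp : measure_display) (Om : measurableType disp) (R : realType).
Variable P : probability Om R.
Variables (Z : nat -> Om -> R) (b s2 rho K : R) (c0 c T : nat).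
Hypothesis mZ : forall i, measurable_fun setT (Z i).
Hypothesis b0 : 0 < b.
Hypothesis Zb : forall i w, `|Z i w| <= b.
Hypothesis Z0 : forall i, \int[P]_w Z i w = 0.
Hypothesis Z2 : forall i, \int[P]_w (Z i w ^+ 2) <= s2.
Hypothesis rho0 : 0 < rho.
Hypothesis K1 : 1 <= K.

Definition coord_gen (I : set nat) : set (set Om) :=
  [set E | exists i (B : set R), [/\ I i, measurable B & E = Z i @^-1` B]].

Hypothesis Zmix : forall (m : int) (g : nat) (A B : set Om), (c0 <= g)%N ->
  <<s coord_gen [set i | i%:Z < m] >> A ->
  <<s coord_gen [set i | m + g%:Z <= i%:Z] >> B ->
  fine (P (A `&` B)) <=
    fine (P A) * fine (P B) + K * expR (- (rho * (g - c0)%:R)).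

Hypothesis cP : (c0 <= c)%N /\ 2 + ln K <= rho * (c - c0)%:R.
Hypothesis T1 : 1 <= ln (T%:R : R).

Let l : R := ln (T%:R : R).
Let A0 : nat := (Num.truncn l).+1.
(** As [A0 <= 2 * l], this choice gives t b A0 <= 1/2, the range of [expR_le_quad] for a sum over
    one base block. In [v] the first term is the quadratic term of that expansion; 1 / T is kept in
    reserve for the mixing error of each doubling. *)
Let t : R := (4 * b * l)^-1.
Let v : R := 2 * t ^+ 2 * A0%:R ^+ 2 * s2 + T%:R^-1.
Variable J : nat.
Let W := cantor_span c A0 J.

(** Delaying by [W] and padding with zeros lets translates of the offset set stick out of the sample
    on both sides; zeros satisfy the same mean, size and variance bounds. *)
Definition window (i : nat) (w : Om) : R :=
  if (W <= i < W + T)%N then Z (i - W) w else 0.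

Definition block (j a : nat) (w : Om) : R :=
  \sum_(k <- cantor_offs c A0 j) window (a + k) w.

Let T0 : 0 < T%:R :> R.
Proof.
rewrite lt0r ler0n andbT; apply/negP => /eqP T0.
by move: T1; rewrite T0 ln0//; lra.
Qed.

Let l_lt : l < A0%:R. Proof. exact: truncnS_gt. Qed.

Let A0_le : A0%:R <= 2 * l.
Proof.
have : (Num.truncn l)%:R <= l by rewrite truncn_le // (le_trans _ T1).
rewrite /A0 -natr1; move: T1; rewrite -/l; lra.
Qed.

Let l0 : 0 < l. Proof. exact: lt_le_trans T1. Qed.
Let t0 : 0 < t. Proof. by rewrite invr_gt0 !mulr_gt0. Qed.
Let tbl : t * b * l = 4^-1.
Proof. by rewrite /t; field; rewrite !gt_eqF. Qed.

Let s20 : 0 <= s2.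
Proof. by apply: le_trans (Z2 0); apply: Rintegral_ge0 => w _; exact: sqr_ge0. Qed.

Let v0 : 0 <= v.
Proof.
by rewrite addr_ge0 ?invr_ge0 ?ler0n// mulr_ge0// mulr_ge0 ?sqr_ge0// mulr_ge0 ?sqr_ge0.
Qed.

Lemma coord_gen_measurable I : <<s coord_gen I >> `<=` @measurable _ Om.
Proof.
apply: smallest_sub; first exact: sigma_algebra_measurable.
move=> _ [i [B [_ mB ->]]]; rewrite -[X in measurable X]setTI.
exact: mZ.
Qed.

Lemma measurable_coord I i : I i -> measurable_wrt (coord_gen I) (Z i).
Proof.
move=> Ii _ B mB; rewrite setTI; apply: sub_gen_smallest.
by exists i, B.
Qed.

Lemma windowE i :
  window i = if (W <= i < W + T)%N then Z (i - W) else (fun=> 0).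
Proof. by apply/funext => w; rewrite /window; case: ifP. Qed.

Lemma window_le i w : `|window i w| <= b.
Proof. by rewrite /window; case: ifP => // _; rewrite normr0 ltW. Qed.

Lemma measurable_block I j a :
  (forall k, k \in cantor_offs c A0 j -> (W <= a + k)%N -> I (a + k - W)%N) ->
  measurable_wrt (coord_gen I) (block j a).
Proof.
move=> HI; rewrite /block.
rewrite (_ : (fun w => _) = fun w => \sum_(k <- cantor_offs c A0 j)
    if k \in cantor_offs c A0 j then window (a + k) w else 0); last first.
  by apply/funext => w; apply: eq_big_seq => k ->.
apply: measurable_sum => k.
case kin: (k \in _); last exact: measurable_cst.
rewrite windowE; case: ifP => [/andP[Wk _]|_]; last exact: measurable_cst.
by apply: measurable_coord; exact: HI.
Qed.

Lemma measurable_block_T j a : measurable_fun setT (block j a).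
Proof.
apply: (measurable_wrt_sub (@coord_gen_measurable setT)).
exact: measurable_block.
Qed.

Lemma block_le j a w : `|block j a w| <= (2 ^ j * A0)%:R * b.
Proof.
rewrite /block (le_trans (ler_norm_sum _ _ _))//.
rewrite -(size_cantor_offs c A0 j); elim: (cantor_offs c A0 j) => [|k s IH] /=.
  by rewrite big_nil mul0r.
by rewrite big_cons -nat1r mulrDl mul1r lerD// window_le.
Qed.

Lemma block_step j a w :
  block j.+1 a w =
  block j a w + block j (a + (cantor_span c A0 j + cantor_gap c A0 j)) w.
Proof.
rewrite /block /= big_cat big_map /=; congr (_ + _).
by apply: eq_bigr => k _; rewrite addnA.
Qed.

Let laplace j a := \int[P]_w expR (t * block j a w).

Lemma expR_block_range j a w :
  0 <= expR (t * block j a w) <= expR (t * ((2 ^ j * A0)%:R * b)).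
Proof.
rewrite expR_ge0 ler_expR ler_pM2l//.
exact: le_trans (ler_norm _) (block_le j a w).
Qed.

Lemma integrable_expR_block j a :
  integrable_rv P (fun w => expR (t * block j a w)).
Proof.
apply: (@bounded_integrable _ _ _ _ _ (expR (t * ((2 ^ j * A0)%:R * b)))).
  apply: measurableT_comp => //; apply: measurable_funM => //.
  exact: measurable_block_T.
by move=> w; have := expR_block_range j a w; rewrite ger0_norm ?expR_ge0// => /andP[].
Qed.

(** Inside a base block no decorrelation is sought: Cauchy-Schwarz bounds the squared sum by [A0]
    times the sum of squares, which is affordable because the block has length of order log T. *)
Lemma laplace_base a : laplace 0 a <= expR v.
Proof.
have mX i : measurable_fun setT (window i).
  by rewrite windowE; case: ifP => _; [exact: mZ | exact: measurable_cst].
have iX i : integrable_rv P (window i).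
  by apply: (bounded_integrable P (mX i)) => w; exact: window_le.
have X0 i : \int[P]_w window i w = 0.
  by rewrite windowE; case: ifP => _; [exact: Z0 | rewrite expect_cst].
have X2 i : \int[P]_w (window i w ^+ 2) <= s2.
  rewrite windowE; case: ifP => _; first exact: Z2.
  by rewrite expr0n /= expect_cst.
have iX2 i : integrable_rv P (fun w => window i w ^+ 2).
  apply: (@bounded_integrable _ _ _ _ _ (b ^+ 2)); first exact: measurable_funX.
  by move=> w; rewrite normrX lerXn2r ?nnegrE ?window_le// ltW.
have bE w : block 0 a w = \sum_(k < A0) window (a + k) w.
  by rewrite -(big_mkord xpredT (fun k => window (a + k) w)) /index_iota subn0.
have sq w : block 0 a w ^+ 2 <= A0%:R * \sum_(k < A0) window (a + k) w ^+ 2.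
  rewrite bE -[X in X%:R * _](card_ord A0).
  exact: (sqr_sum_le xpredT (fun k : 'I_A0 => window (a + k) w)).
have ib : integrable_rv P (block 0 a).
  by rewrite /block; apply: integrable_rv_sum.
have b00 : \int[P]_w block 0 a w = 0.
  by rewrite /block expect_sum// big1.
have iq : integrable_rv P (fun w => \sum_(k < A0) window (a + k) w ^+ 2).
  by apply: integrable_rv_sum => k; exact: iX2.
have le1 : laplace 0 a <= \int[P]_w (1 + (t * block 0 a w +
    2 * t ^+ 2 * A0%:R * \sum_(k < A0) window (a + k) w ^+ 2)).
  apply: le_expect; first exact: integrable_expR_block.
    apply: integrable_rvD; first exact: integrable_rv_cst.
    by apply: integrable_rvD; exact: integrable_rvZ.
  move=> w; rewrite addrA; apply: (le_trans (expR_le_quad _)).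
    have := block_le 0 a w; rewrite mul1n => bl.
    apply: (@le_trans _ _ (t * (A0%:R * b))).
      by rewrite ler_pM2l// (le_trans (ler_norm _)).
    rewrite (_ : t * _ = t * b * A0%:R); last by ring.
    apply: (@le_trans _ _ (t * b * (2 * l))).
      by rewrite ler_pM2l ?mulr_gt0.
    by rewrite mulrCA tbl; lra.
  by rewrite lerD2l exprMn -!mulrA !ler_pM2l //; exact: sq.
apply: (le_trans le1).
rewrite RintegralD//; [|exact: integrable_rv_cst|]; last first.
  by apply: integrable_rvD; exact: integrable_rvZ.
rewrite expect_cst RintegralD//; [|exact: integrable_rvZ|exact: integrable_rvZ].
rewrite !RintegralZl// b00 mulr0 add0r expect_sum//.
have le2 : \sum_(k < A0) \int[P]_w (window (a + k) w ^+ 2) <= A0%:R * s2.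
  apply: (@le_trans _ _ (\sum_(k < A0) s2)); first by apply: ler_sum => k _.
  by rewrite sumr_const card_ord mulr_natl.
apply: le_trans (expR_ge1Dx v).
rewrite lerD2l /v; apply: (@le_trans _ _ (2 * t ^+ 2 * A0%:R * (A0%:R * s2))).
  by rewrite ler_wpM2l// mulr_ge0// mulr_ge0// sqr_ge0.
by rewrite (_ : _ * (A0%:R * s2) = 2 * t ^+ 2 * A0%:R ^+ 2 * s2);
  [rewrite lerDl invr_ge0 ler0n | ring].
Qed.

(** The two sup norms multiply to at most exp(2 ^ j), while the gap yields a coefficient at most K
    exp(- (2 + ln K)(A0 + 2 ^ j)). The part [2 ^ j] of the gap pays for the sup norms, and the part
    [A0 > log T] leaves at most 1 / T. *)
Lemma mixing_error j : expR (t * ((2 ^ j * A0)%:R * b)) ^+ 2 *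
  (K * expR (- (rho * (cantor_gap c A0 j - c0)%:R))) <= v.
Proof.
have [c0c rc] := cP.
have vT : T%:R^-1 <= v.
  by rewrite /v lerDr mulr_ge0// mulr_ge0 ?sqr_ge0// mulr_ge0// sqr_ge0.
apply: le_trans vT.
set u : R := (2 ^ j)%:R.
have u1 : 1 <= u by rewrite ler1n expn_gt0.
have -> : T%:R^-1 = expR (- l) by rewrite expRN lnK// posrE.
have -> : K = expR (ln K) by rewrite lnK// posrE (lt_le_trans _ K1).
rewrite -expRM_natl -!expRD ler_expR.
have le1 : t * ((2 ^ j * A0)%:R * b) <= u / 2.
  rewrite natrM -/u (_ : t * _ = u * (t * b * A0%:R)); last by ring.
  rewrite ler_wpM2l ?(le_trans _ u1)//.
  apply: (@le_trans _ _ (t * b * (2 * l))); first by rewrite ler_pM2l ?mulr_gt0.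
  by rewrite mulrCA tbl; lra.
have le2 : (c - c0)%:R * (A0%:R + u) <= (cantor_gap c A0 j - c0)%:R :> R.
  rewrite -natrD -natrM ler_nat /cantor_gap.
  have : (0 < A0 + 2 ^ j)%N by [].
  by move: (A0 + 2 ^ j)%N => y y0; rewrite mulnBl leq_sub2l// leq_pmulr.
have le3 : (2 + ln K) * (A0%:R + u) <= rho * (cantor_gap c A0 j - c0)%:R.
  apply: (@le_trans _ _ (rho * ((c - c0)%:R * (A0%:R + u)))).
    by rewrite mulrA ler_wpM2r// addr_ge0// (le_trans _ u1).
  by rewrite ler_pM2l.
have lnK0 : 0 <= ln K by exact: ln_ge0.
have : 0 <= ln K * (A0%:R + u - 1).
  by rewrite mulr_ge0//; have := ler0n R A0; lra.
move: le1 le3 l_lt; rewrite -mulr_natl; have := l0.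
move: (_ * _) => z; nra.
Qed.

(** Each doubling squares the bound [x] and adds an error [v]; as x >= 1, x^2 + v <= x^2 (1 + v) <=
    x^2 exp v. The exponents thus obey e' = 2 e + 1, solved by 2 ^ (j+1) - 1. *)
Lemma laplace_block j a : laplace j a <= expR ((2 ^ j.+1 - 1)%:R * v).
Proof.
elim: j a => [|j IH] a; first by rewrite mul1r laplace_base.
rewrite /laplace; under eq_Rintegral do rewrite block_step mulrDr expRD.
set a' := (a + _)%N.
(* The cut just behind the first copy, in the time of [Z]: the first copy uses indices below [m],
   the second indices from [m] plus the gap on. *)
pose m : int := (a + cantor_span c A0 j)%:Z - W%:Z.
have c0g : (c0 <= cantor_gap c A0 j)%N.
  have [c0c _] := cP; rewrite (leq_trans c0c)// /cantor_gap leq_pmulr//.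
have cov := @mixing_covariance _ _ _ P (coord_gen [set i | i%:Z < m])
  (coord_gen [set i | m + (cantor_gap c A0 j)%:Z <= i%:Z]) _
  (@coord_gen_measurable _) (@coord_gen_measurable _)
  (fun A B => @Zmix m (cantor_gap c A0 j) A B c0g)
  (fun w => expR (t * block j a w)) (fun w => expR (t * block j a' w)).
apply: le_trans (cov (expR (t * ((2 ^ j * A0)%:R * b)))
  (expR (t * ((2 ^ j * A0)%:R * b))) _ _ _ _ _ _) _.
- exact: expR_gt0.
- exact: expR_gt0.
- apply: measurableT_comp => //; apply: measurable_funM => //.
  apply: measurable_block => k /cantor_offs_lt kW Wak.
  exact: shift_before.
- apply: measurableT_comp => //; apply: measurable_funM => //.
  apply: measurable_block => k _ Wak.
  exact: shift_after.
- by move=> w; exact: expR_block_range.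
- by move=> w; exact: expR_block_range.
rewrite -expr2.
set x := expR ((2 ^ j.+1 - 1)%:R * v) in IH.
have x1 : 1 <= x.
  by rewrite /x -expR0 ler_expR mulr_ge0.
have -> : expR ((2 ^ j.+2 - 1)%:R * v) = x ^+ 2 * expR v.
  rewrite /x -expRM_natl -expRD; congr expR.
  by rewrite double_pred_expn; ring.
apply: (@le_trans _ _ (x ^+ 2 + v)).
  apply: lerD; last exact: mixing_error.
  rewrite expr2 ler_pM//.
  - by apply: Rintegral_ge0 => w _; exact: expR_ge0.
  - by apply: Rintegral_ge0 => w _; exact: expR_ge0.
  - exact: IH.
  - exact: IH.
apply: (@le_trans _ _ (x ^+ 2 * (1 + v))).
  have x2 : 1 <= x ^+ 2 by rewrite exprn_ege1.
  have : 0 <= (x ^+ 2 - 1) * v by rewrite mulr_ge0// subr_ge0.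
  by move: (x ^+ 2) v => y z; rewrite mulrBl mulrDr mul1r mulr1; lra.
by rewrite ler_wpM2l ?sqr_ge0// expR_ge1Dx.
Qed.

Hypothesis J_le : (T <= 2 ^ J * A0)%N.
Hypothesis J_min : (0 < J)%N -> (2 ^ J.-1 * A0 < T)%N.

Let q := (W + T)%N.

(** Every offset is smaller than [W], so as [a] runs over all [q] translates, [a + k] passes exactly
    once over the whole sample; each [Z i] is counted once per offset. *)
Lemma sum_block w :
  \sum_(a < q) block J a w = (2 ^ J * A0)%:R * \sum_(i < T) Z i w.
Proof.
rewrite /block exchange_big /= -(size_cantor_offs c A0 J).
transitivity (\sum_(k <- cantor_offs c A0 J) \sum_(i < T) Z i w); last first.
  by rewrite big_const_seq count_predT iter_addr_0 mulr_natl.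
apply: eq_big_seq => k /cantor_offs_lt kW.
rewrite -(big_mkord xpredT (fun a => window (a + k) w)).
have := @big_addn _ 0 +%R 0 (q + k) k xpredT (fun a => window a w).
rewrite addnK add0n => <-.
rewrite (@big_cat_nat _ _ _ W)//=; [|exact: ltnW|by rewrite /q -addnA leq_addr].
rewrite big_nat big1 ?add0r; last first.
  by move=> i /andP[_ iW]; rewrite /window leqNgt iW.
rewrite (@big_cat_nat _ _ _ q)//=; [|by rewrite leq_addr|by rewrite leq_addr].
rewrite [X in _ + X]big_nat [X in _ + X]big1 ?addr0; last first.
  by move=> i /andP[qi _]; rewrite /window -/q [(i < q)%N]ltnNge qi andbF.
have -> : \sum_(W <= i < q) window i w = \sum_(0 <= i < T) window (i + W) w.
  have := @big_addn _ 0 +%R 0 q W xpredT (fun a => window a w).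
  by rewrite add0n {2}/q addKn => ->.
rewrite big_mkord.
apply: eq_bigr => i _.
by rewrite /window leq_addl addnK [(i + W)%N]addnC ltn_add2l ltn_ord.
Qed.

(** Minimality of [J] gives 2 ^ (J-1) < T = exp l < exp A0 <= 4 ^ A0, hence J <= 2 A0, as required
    by [covering_span]; it also keeps 2 ^ J of order T / A0. *)
Lemma J_bounds : (q%:R <= (2 + 3 * c)%:R * (2 ^ J * A0)%:R :> R) /\
  (2 ^ J)%:R <= 2 * T%:R / A0%:R + 1 :> R.
Proof.
have A00 : 0 < A0%:R :> R by rewrite ltr0n.
have J2 : (J <= 2 * A0)%N.
  case: J J_min => [//|j] /(_ isT) /= jT.
  suff : (2 ^ j < 2 ^ (2 * A0))%N by rewrite ltn_exp2l.
  rewrite -(ltr_nat R).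
  apply: (@lt_le_trans _ _ T%:R).
    by rewrite ltr_nat (leq_ltn_trans _ jT)// leq_pmulr.
  rewrite -[T%:R]lnK ?posrE// -/l.
  (* At 1/2 the quadratic bound gives exp(1/2) <= 2. *)
  have e4 : expR 1 <= 4 :> R.
    have := @expR_le_quad R 2^-1 (lexx _) => e2.
    have -> : 1 = 2^-1 + 2^-1 :> R by lra.
    rewrite expRD (@le_trans _ _ (2 * 2))//; last by lra.
    by apply: ler_pM; rewrite ?expR_ge0//; lra.
  apply: (@le_trans _ _ (expR A0%:R)); first by rewrite ler_expR ltW.
  rewrite -[A0%:R]mulr1 expRM_natl expnM natrX.
  by rewrite lerXn2r ?nnegrE ?expR_ge0.
split.
  rewrite -natrM ler_nat /q.
  exact: (covering_span (cantor_span_le c A0 J)).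
case: J J_min => [_|j /(_ isT) /= jT].
  by rewrite expn0 lerDr divr_ge0 ?mulr_ge0// ltW.
rewrite expnS natrM (@le_trans _ _ (2 * T%:R / A0%:R))//; last by lra.
rewrite -mulrA ler_pM2l// ler_pdivlMr// -natrM ler_nat; exact: ltnW.
Qed.

Let q0 : (0 < q)%N.
Proof. by rewrite /q addn_gt0 -[X in _ || X](ltr0n R) T0 orbT. Qed.

(** The parameter for the full sum: averaging the [q] translates scales it by the density of the
    offset set, which is at least 1 / (2 + 3 c). *)
Let t' : R := t * (2 ^ J * A0)%:R / q%:R.

Lemma integrable_expR_sum (u : R) :
  integrable_rv P (fun w => expR (u * \sum_(i < T) Z i w)).
Proof.
apply: (@bounded_integrable _ _ _ _ _ (expR (`|u| * (T%:R * b)))).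
  apply: measurableT_comp => //; apply: measurable_funM => //.
  by apply: measurable_sum => i.
move=> w; rewrite ger0_norm ?expR_ge0// ler_expR (le_trans (ler_norm _))//.
rewrite normrM ler_wpM2l// (le_trans (ler_norm_sum _ _ _))//.
apply: (@le_trans _ _ (\sum_(i < T) b)); first by apply: ler_sum => i _.
by rewrite sumr_const card_ord mulr_natl.
Qed.

Lemma laplace_sum :
  \int[P]_w expR (t' * \sum_(i < T) Z i w) <= expR ((2 ^ J.+1)%:R * v).
Proof.
have q0' : 0 < q%:R :> R by rewrite ltr0n.
pose F w := q%:R^-1 * \sum_(a < q) expR (t * block J a w).
apply: (@le_trans _ _ (\int[P]_w F w)).
  apply: le_expect; first exact: integrable_expR_sum.
    apply: integrable_rvZ; apply: integrable_rv_sum => a.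
    exact: integrable_expR_block.
  move=> w; rewrite /F; apply: le_trans (expR_mean_le (fun a => t * block J a w) q0).
  rewrite ler_expR -mulr_sumr sum_block /t'.
  by rewrite le_eqVlt; apply/orP; left; apply/eqP; ring.
rewrite /F RintegralZl//; last first.
  by apply: integrable_rv_sum => a; exact: integrable_expR_block.
rewrite expect_sum; last by move=> a; exact: integrable_expR_block.
rewrite ler_pdivrMl//.
apply: (@le_trans _ _ (\sum_(a < q) expR ((2 ^ J.+1)%:R * v))); last first.
  by rewrite sumr_const card_ord [leRHS]mulr_natl.
apply: ler_sum => a _; apply: (le_trans (laplace_block J a)).
by rewrite ler_expR ler_wpM2r// ler_nat leq_subr.
Qed.

(** With t A0 <= 1 / (2 b), the two terms containing [s2] are each at most T s2 / (b^2 l), the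
    second because l <= T. The remaining 4 / A0 + 2 / T is at most 6. *)
Lemma laplace_exponent :
  (2 ^ J.+1)%:R * v <= 6 + 2 * T%:R * s2 / (b ^+ 2 * l).
Proof.
have [_ J2] := J_bounds.
have A00 : 1 <= A0%:R :> R by rewrite ler1n.
have A0p : 0 < A0%:R :> R by rewrite ltr0n.
have lT : l <= T%:R.
  by have := expR_ge1Dx l; rewrite lnK ?posrE//; lra.
have T1' : 1 <= T%:R :> R by rewrite (le_trans T1).
set a : R := A0%:R in A00 A0p J2 *.
set y : R := (2 ^ J)%:R in J2 *.
have tab : t * a <= (2 * b)^-1.
  rewrite (_ : (2 * b)^-1 = t * (2 * l)); last by rewrite /t; field; rewrite !gt_eqF.
  by rewrite ler_pM2l.
have ta0 : 0 <= t * a by rewrite mulr_ge0 // ltW.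
rewrite expnS natrM -/y.
have -> : v = 2 * (t * a) ^+ 2 * s2 + T%:R^-1 by rewrite /v -/a; ring.
apply: (@le_trans _ _ (2 * (2 * T%:R / a + 1) * (2 * (t * a) ^+ 2 * s2 + T%:R^-1))).
  rewrite ler_wpM2r ?ler_pM2l//.
  by rewrite addr_ge0 ?invr_ge0 ?ler0n// mulr_ge0// mulr_ge0// sqr_ge0.
have -> : 2 * (2 * T%:R / a + 1) * (2 * (t * a) ^+ 2 * s2 + T%:R^-1) =
    8 * T%:R * s2 * (t * (t * a)) + 4 * s2 * ((t * a) * (t * a)) + (4 / a + 2 / T%:R).
  by field; rewrite !gt_eqF.
have le1 : t * (t * a) <= t * (2 * b)^-1 by rewrite ler_pM2l.
have le2 : t * a * (t * a) <= (2 * b)^-1 * (2 * b)^-1 by rewrite ler_pM.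
have le3 : 4 / a <= 4 by rewrite ler_pdivrMr// ler_peMr.
have le4 : 2 / T%:R <= 2 :> R by rewrite ler_pdivrMr// ler_peMr.
have le5 : 8 * T%:R * s2 * (t * (t * a)) <= T%:R * s2 / (b ^+ 2 * l).
  apply: (@le_trans _ _ (8 * T%:R * s2 * (t * (2 * b)^-1))).
    by rewrite ler_wpM2l// mulr_ge0// mulr_ge0// ltW.
  by rewrite /t le_eqVlt; apply/orP; left; apply/eqP; field; rewrite !gt_eqF.
have le6 : 4 * s2 * (t * a * (t * a)) <= T%:R * s2 / (b ^+ 2 * l).
  apply: (@le_trans _ _ (4 * s2 * ((2 * b)^-1 * (2 * b)^-1))).
    by rewrite ler_wpM2l// mulr_ge0.
  rewrite (_ : 4 * s2 * _ = l * (s2 / (b ^+ 2 * l))); last first.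
    by field; rewrite !gt_eqF.
  rewrite -mulrA ler_wpM2r// divr_ge0// mulr_ge0 ?sqr_ge0// ltW//.
have -> : 2 * T%:R * s2 / (b ^+ 2 * l) = 2 * (T%:R * s2 / (b ^+ 2 * l)) by ring.
lra.
Qed.

Lemma bernstein_upper_level (x : R) : 0 <= x ->
  fine (P [set w | x <= \sum_(i < T) Z i w]) <=
  expR (6 + 2 * T%:R * s2 / (b ^+ 2 * l) - x / ((2 + 3 * c)%:R * (4 * b * l))).
Proof.
move=> x0; have [qle _] := J_bounds.
have q0' : 0 < q%:R :> R by rewrite ltr0n.
have c30 : 0 < (2 + 3 * c)%:R :> R by rewrite ltr0n addn_gt0.
have t't : t / (2 + 3 * c)%:R <= t'.
  rewrite /t' -mulrA ler_pM2l// ler_pdivlMr// mulrC ler_pdivrMr//.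
  by rewrite [leRHS]mulrC.
have t'0 : 0 < t' by apply: lt_le_trans t't; rewrite divr_gt0.
set A := [set w | _].
have mA : measurable A.
  have mS : measurable_fun setT (fun w => \sum_(i < T) Z i w) by apply: measurable_sum => i.
  have := mS measurableT `[x, +oo[%classic (measurable_itv _).
  rewrite setTI; congr measurable; apply/seteqP; split=> w /=;
    by rewrite in_itv/= andbT.
have := expect_indicZ P 1 mA; rewrite mul1r => <-.
apply: (@le_trans _ _ (\int[P]_w (expR (- (t' * x)) *
    expR (t' * \sum_(i < T) Z i w)))).
  apply: le_expect; first exact: integrable_indicZ.
    by apply: integrable_rvZ; exact: integrable_expR_sum.
  move=> w; rewrite mul1r indicE -expRD addrC -mulrBr.
  have [|_] := boolP (w \in A); last exact: expR_ge0.
  rewrite inE /A /= => xS; rewrite -expR0 ler_expR mulr_ge0 ?subr_ge0//.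
  exact: ltW.
rewrite RintegralZl//; last exact: integrable_expR_sum.
apply: (@le_trans _ _ (expR (- (t' * x)) * expR ((2 ^ J.+1)%:R * v))).
  by rewrite ler_pM2l ?expR_gt0//; exact: laplace_sum.
rewrite -expRD ler_expR addrC; apply: lerB; first exact: laplace_exponent.
apply: le_trans (_ : t / (2 + 3 * c)%:R * x <= _); last by rewrite ler_wpM2r.
rewrite /t le_eqVlt; apply/orP; left; apply/eqP; field.
by rewrite !gt_eqF.
Qed.

End Bernstein.

Section BernsteinTail.
Context (disp : measure_display) (Om : measurableType disp) (R : realType).
Variable P : probability Om R.

Lemma bernstein_upper (Z : nat -> Om -> R) (b s2 rho K : R) (c0 c T : nat) (x : R) :
  (forall i, measurable_fun setT (Z i)) -> 0 < b -> (forall i w, `|Z i w| <= b) ->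
  (forall i, \int[P]_w Z i w = 0) -> (forall i, \int[P]_w (Z i w ^+ 2) <= s2) ->
  0 < rho -> 1 <= K ->
  (forall (m : int) (g : nat) (A B : set Om), (c0 <= g)%N ->
    <<s coord_gen Z [set i | i%:Z < m] >> A ->
    <<s coord_gen Z [set i | m + g%:Z <= i%:Z] >> B ->
    fine (P (A `&` B)) <=
    fine (P A) * fine (P B) + K * expR (- (rho * (g - c0)%:R))) ->
  (c0 <= c)%N -> 2 + ln K <= rho * (c - c0)%:R -> 1 <= ln (T%:R : R) -> 0 <= x ->
  fine (P [set w | x <= \sum_(i < T) Z i w]) <=
  expR (6 + 2 * T%:R * s2 / (b ^+ 2 * ln T%:R)
        - x / ((2 + 3 * c)%:R * (4 * b * ln T%:R))).
Proof.
move=> mZ b0 Zb Z0 Z2 rho0 K1 Zmix c0c rc T1 x0.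
pose A0 := (Num.truncn (ln (T%:R : R))).+1.
(* The exponent [T] already works, by [T < 2 ^ T]; the least one satisfies both requirements on
   [J]. *)
have exJ : exists j, (T <= 2 ^ j * A0)%N.
  exists T; rewrite (leq_trans (ltnW (ltn_expl T (leqnn 2))))//.
  by rewrite leq_pmulr.
case: (ex_minnP exJ) => J JT Jmin.
apply: (bernstein_upper_level mZ b0 Zb Z0 Z2 rho0 K1 Zmix (conj c0c rc) T1 JT) => //.
by case: J Jmin {JT} => // j Jmin _; rewrite ltnNge; apply/negP => /Jmin; rewrite ltnn.
Qed.

Lemma bernstein_abs (Z : nat -> Om -> R) (b s2 rho K : R) (c0 c T : nat) (x : R) :
  (forall i, measurable_fun setT (Z i)) -> 0 < b -> (forall i w, `|Z i w| <= b) ->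
  (forall i, \int[P]_w Z i w = 0) -> (forall i, \int[P]_w (Z i w ^+ 2) <= s2) ->
  0 < rho -> 1 <= K ->
  (forall (m : int) (g : nat) (A B : set Om), (c0 <= g)%N ->
    <<s coord_gen Z [set i | i%:Z < m] >> A ->
    <<s coord_gen Z [set i | m + g%:Z <= i%:Z] >> B ->
    fine (P (A `&` B)) <=
    fine (P A) * fine (P B) + K * expR (- (rho * (g - c0)%:R))) ->
  (c0 <= c)%N -> 2 + ln K <= rho * (c - c0)%:R -> 1 <= ln (T%:R : R) -> 0 <= x ->
  fine (P [set w | x <= `|\sum_(i < T) Z i w|]) <=
  2 * expR (6 + 2 * T%:R * s2 / (b ^+ 2 * ln T%:R)
        - x / ((2 + 3 * c)%:R * (4 * b * ln T%:R))).
Proof.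
move=> mZ b0 Zb Z0 Z2 rho0 K1 Zmix c0c rc T1 x0.
have up := bernstein_upper mZ b0 Zb Z0 Z2 rho0 K1 Zmix c0c rc T1 x0.
pose Z' i w := - Z i w.
(* The variables [- Z i] generate no new events, so the mixing hypothesis passes to them and the
   lower tail follows from the upper one. *)
have gen' I : coord_gen Z' I `<=` coord_gen Z I.
  move=> _ [i [B [Ii mB ->]]]; exists i, (-%R @^-1` B); split=> //.
  by rewrite -[X in measurable X]setTI; exact: oppr_measurable.
have sub' I : <<s coord_gen Z' I >> `<=` <<s coord_gen Z I >>.
  exact: sub_smallest2r (gen' I).
have lo : fine (P [set w | x <= \sum_(i < T) Z' i w]) <=
    expR (6 + 2 * T%:R * s2 / (b ^+ 2 * ln T%:R)
        - x / ((2 + 3 * c)%:R * (4 * b * ln T%:R))).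
  apply: (@bernstein_upper Z' b s2 rho K c0) => //.
  - by move=> i; apply: measurableT_comp (mZ i).
  - by move=> i w; rewrite normrN.
  - move=> i; rewrite /Z'; under eq_Rintegral do rewrite -mulN1r.
    by rewrite RintegralZl ?Z0 ?mulr0//; exact: bounded_integrable (mZ i) (Zb i).
  - by move=> i; rewrite /Z'; under eq_Rintegral do rewrite sqrrN.
  - by move=> m g A B gc /sub' FA /sub' GB; exact: Zmix gc FA GB.
have mS (Y : nat -> Om -> R) : (forall i, measurable_fun setT (Y i)) ->
    measurable [set w | x <= \sum_(i < T) Y i w].
  move=> mY.
  have mS : measurable_fun setT (fun w => \sum_(i < T) Y i w) by apply: measurable_sum => i.
  have := mS measurableT `[x, +oo[%classic (measurable_itv _).
  rewrite setTI; congr measurable; apply/seteqP; split=> w /=;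
    by rewrite in_itv/= andbT.
have mZ' i : measurable_fun setT (Z' i) by apply: measurableT_comp (mZ i).
rewrite mulr2n mulrDl mul1r; apply: le_trans (lerD up lo).
have -> : [set w | x <= `|\sum_(i < T) Z i w|] =
    [set w | x <= \sum_(i < T) Z i w] `|` [set w | x <= \sum_(i < T) Z' i w].
  apply/seteqP; split=> w /=; rewrite sumrN ler_normr.
    by move=> /orP.
  by move=> H; apply/orP.
rewrite -fineD; [|exact: fin_num_measure (mS _ mZ)|exact: fin_num_measure (mS _ mZ')].
apply: fine_le; last exact: measureU2 (mS _ mZ) (mS _ mZ').
  by apply: fin_num_measure; apply: measurableU; exact: mS.
by rewrite fin_numD !fin_num_measure//; exact: mS.
Qed.

End BernsteinTail.

(** * Smallest eigenvalue and lasso *)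

Section SmallestEigenvalue.
Variables (R : realType) (n : nat) (G : 'M[R]_n).
Hypothesis symG : G^T = G.

Let form (x y : 'rV[R]_n) : R := (x *m G *m y^T) 0 0.
Let dot (x y : 'rV[R]_n) : R := (x *m y^T) 0 0.

Let dotE x : dot x x = \sum_i x 0 i ^+ 2.
Proof. by rewrite /dot mxE; apply: eq_bigr => i _; rewrite mxE expr2. Qed.

Let formC x y : form x y = form y x.
Proof.
rewrite /form -[in LHS](trmxK (x *m G *m y^T)) mxE !trmx_mul trmxK symG.
by rewrite mulmxA.
Qed.

Let dotC x y : dot x y = dot y x.
Proof. by rewrite /dot -[in LHS](trmxK (x *m y^T)) mxE trmx_mul trmxK. Qed.

Let formZ a x : form (a *: x) (a *: x) = a ^+ 2 * form x x.
Proof. by rewrite /form linearZ /= -!scalemxAl -scalemxAr !mxE; ring. Qed.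

Let dotZ a x : dot (a *: x) (a *: x) = a ^+ 2 * dot x x.
Proof. by rewrite /dot linearZ /= -!scalemxAl -scalemxAr !mxE; ring. Qed.

Let formD x y e : form (x + e *: y) (x + e *: y) =
  form x x + 2 * e * form x y + e ^+ 2 * form y y.
Proof.
have -> : form (x + e *: y) (x + e *: y) =
  form x x + e * form x y + e * form y x + e ^+ 2 * form y y.
  rewrite /form linearD linearZ /= !mulmxDl !mulmxDr -!scalemxAl -!scalemxAr.
  by rewrite !mxE; ring.
by rewrite (formC y x); ring.
Qed.

Let dotD x y e : dot (x + e *: y) (x + e *: y) =
  dot x x + 2 * e * dot x y + e ^+ 2 * dot y y.
Proof.
have -> : dot (x + e *: y) (x + e *: y) =
  dot x x + e * dot x y + e * dot y x + e ^+ 2 * dot y y.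
  rewrite /dot linearD linearZ /= !mulmxDl !mulmxDr -!scalemxAl -!scalemxAr.
  by rewrite !mxE; ring.
by rewrite (dotC y x); ring.
Qed.

Let dot_ge0 x : 0 <= dot x x.
Proof. by rewrite dotE sumr_ge0// => i _; rewrite sqr_ge0. Qed.

Let dot_eq0 x : dot x x = 0 -> x = 0.
Proof.
rewrite dotE => /eqP; rewrite psumr_eq0 => [/allP x0|i _]; last exact: sqr_ge0.
apply/rowP => i; rewrite mxE.
by have := x0 i (mem_index_enum _); rewrite sqrf_eq0 => /eqP.
Qed.

Let form_continuous : continuous (fun x => form x x).
Proof.
have -> : (fun x => form x x) =
    (fun x => \sum_j (\sum_i x 0 i * G i j) * x 0 j).
  by apply/funext => x; rewrite /form mxE; apply: eq_bigr => j _; rewrite !mxE.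
apply: continuous_big => [|j _ x]; first exact: add_continuous.
have cs : continuous (fun x : 'rV[R]_n => \sum_i x 0 i * G i j).
  apply: continuous_big => [|i _ y]; first exact: add_continuous.
  by apply: continuousM; [exact: (@coord_continuous R 1 n 0 i y) | exact: cst_continuous].
by apply: continuousM; [exact: cs | exact: (@coord_continuous R 1 n 0 j x)].
Qed.

Let dot_continuous : continuous (fun x => dot x x).
Proof.
have -> : (fun x => dot x x) = (fun x => \sum_i x 0 i * x 0 i).
  by apply/funext => x; rewrite dotE.
apply: continuous_big => [|i _ x]; first exact: add_continuous.
by apply: continuousM; exact: (@coord_continuous R 1 n 0 i x).
Qed.

(** The minimum [m] of the quadratic form over the unit sphere, attained by compactness, is an
    eigenvalue; so the infimum defining [lambda_min] is at most [m]. *)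
Lemma lambda_min_quad (x : 'rV[R]_n) :
  lambda_min G * (x *m x^T) 0 0 <= (x *m G *m x^T) 0 0.
Proof.
rewrite -/(dot x x) -/(form x x).
have [->|x0] := eqVneq x 0.
  by rewrite /dot /form !mul0mx mxE mulr0.
have dot_gt0 y : y != 0 -> 0 < dot y y.
  by move=> y0; rewrite lt0r dot_ge0 andbT; apply: contra y0 => /eqP/dot_eq0 ->.
have normalize y : y != 0 -> dot ((Num.sqrt (dot y y))^-1 *: y)
    ((Num.sqrt (dot y y))^-1 *: y) = 1.
  by move=> /dot_gt0 y0; rewrite dotZ exprVn sqr_sqrtr ?ltW// mulVf// gt_eqF.
pose S := [set y | dot y y = 1].
have S0 : S !=set0 by eexists; exact: normalize x0.
have cS : compact S.
  apply: bounded_closed_compact; last first.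
    have -> : S = (fun y => dot y y) @^-1` [set 1] by [].
    apply: closed_comp => [y _|]; [exact: dot_continuous | exact: closed_eq].
  exists 1; split=> // M M1 y Sy /=.
  apply: le_trans (ltW M1); rewrite /Num.norm /= mx_normrE.
  apply/bigmax_leP; split=> // -[i j] _ /=; rewrite ord1.
  rewrite -(@ler_pXn2r _ 2)// ?nnegrE// expr1n -normrX ger0_norm ?sqr_ge0//.
  rewrite -Sy dotE (bigD1 j)//= lerDl sumr_ge0// => k _; exact: sqr_ge0.
have [c cS1 cmin] := EVT_min_rV S0 cS (continuous_subspaceT form_continuous).
set m := form c c in cmin.
have form_ge y : m * dot y y <= form y y.
  have [->|y0] := eqVneq y 0.
    by rewrite /dot /form !mul0mx mxE mulr0.
  have := cmin _ (mem_set (normalize y y0)).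
  rewrite formZ exprVn sqr_sqrtr ?dot_ge0// -ler_pdivlMr ?dot_gt0//.
  by rewrite mulrC.
(* The residual at the minimizer. If it were nonzero, moving [c] against it would push the form
   below [m] times the squared norm. *)
pose u := c *m G - m *: c.
have u0 : u = 0.
  apply: dot_eq0; apply/eqP; rewrite eq_le dot_ge0 andbT leNgt; apply/negP => a0.
  set a := dot u u in a0.
  pose k := form u u - m * dot u u.
  have k0 : 0 <= k by rewrite subr_ge0.
  (* The step - a / (k + 1) avoids dividing by [k], which may vanish; it changes form minus m times
     dot by - a^2 (k + 2) / (k + 1)^2, a negative amount. *)
  have := form_ge (c + (- a / (k + 1)) *: u).
  rewrite formD dotD (_ : dot c c = 1); last exact: set_mem cS1.
  have ua : form c u = a + m * dot c u.
    suff -> : a = form c u - m * dot c u by rewrite subrK.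
    by rewrite /a /form /dot {1}/u mulmxBl -scalemxAl !mxE.
  rewrite ua -/m (_ : form u u = k + m * a); last by rewrite /k /a; ring.
  rewrite -/a; set z := dot c u => le1.
  have : 0 <= 2 * (- a / (k + 1)) * a + (- a / (k + 1)) ^+ 2 * k by lra.
  rewrite (_ : _ + _ = - (a ^+ 2 * (k + 2) / (k + 1) ^+ 2)); last first.
    by field; rewrite gt_eqF// ltr_wpDl.
  by rewrite oppr_ge0 leNgt divr_gt0// ?mulr_gt0 ?exprn_gt0 ?ltr_wpDl.
have eig : eigenvalue G m.
  apply/eigenvalueP; exists c; first by apply/eqP; rewrite -subr_eq0 -/u u0.
  apply/eqP => c0; have := set_mem cS1; rewrite /S /= c0 /dot mul0mx mxE => /esym/eqP.
  by rewrite oner_eq0.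
apply: le_trans (form_ge x); rewrite ler_wpM2r//.
(* [ge_inf] asks for a lower bound of the spectrum; [m] is one, because an eigenvalue is the
   Rayleigh quotient of its eigenvector. *)
apply: ge_inf => //; exists m => a /eigenvalueP[w wG w0].
rewrite -(ler_pM2r (dot_gt0 w w0)); apply: (le_trans (form_ge w)).
by rewrite /form wG -scalemxAl mxE.
Qed.
End SmallestEigenvalue.

Lemma lasso_column (R : realType) (T n s : nat) (X : 'I_T -> 'I_n -> R)
    (y : 'I_T -> R) (bh b : 'I_n -> R) (G : 'I_n -> 'I_n -> R)
    (kappa lam delta theta : R) :
  (0 < T)%N -> 0 < kappa -> 0 < lam -> 0 <= delta ->
  (forall v : 'I_n -> R,
    kappa * \sum_a v a ^+ 2 <= \sum_a \sum_a' v a * v a' * G a a') ->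
  (2 * T%:R)^-1 * \sum_k (y k - \sum_a X k a * bh a) ^+ 2 + lam * \sum_a `|bh a|
    <= (2 * T%:R)^-1 * \sum_k (y k - \sum_a X k a * b a) ^+ 2
       + lam * \sum_a `|b a| ->
  (forall a, `|\sum_k X k a * (y k - \sum_a X k a * b a)| <= T%:R * (lam / 2)) ->
  (forall a a', `|T%:R^-1 * (\sum_k X k a * X k a') - G a a'| <= delta) ->
  \sum_a `|b a| <= theta -> (#|[pred a | b a != 0%R]| <= s)%N ->
  kappa * Num.sqrt (\sum_a (bh a - b a) ^+ 2) <=
    4 * Num.sqrt s%:R * (3 * lam + 4 * theta * delta).
Proof.
move=> T0 kappa0 lam0 delta0 Gmin opt score gram btheta bs.
have T0' : 0 < T%:R :> R by rewrite ltr0n.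
pose D a := bh a - b a.
pose u k := y k - \sum_a X k a * b a.
pose v k := \sum_a X k a * D a.
pose V := T%:R^-1 * \sum_k v k ^+ 2.
set n1 := \sum_a `|b a| in opt btheta; set nh := \sum_a `|bh a| in opt.
pose nD := \sum_a `|D a|.
have nD0 : 0 <= nD by apply: sumr_ge0.
have V0 : 0 <= V.
  by rewrite mulr_ge0 ?invr_ge0 ?ler0n// sumr_ge0// => k _; exact: sqr_ge0.
have cross : \sum_k u k * v k <= T%:R * (lam / 2) * nD.
  have -> : \sum_k u k * v k = \sum_a D a * (\sum_k X k a * u k).
    under eq_bigr do rewrite mulr_sumr.
    rewrite exchange_big; apply: eq_bigr => a _; rewrite mulr_sumr.
    by apply: eq_bigr => k _; ring.
  rewrite /nD mulr_sumr; apply: ler_sum => a _.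
  rewrite (le_trans (ler_norm _))// normrM mulrC ler_wpM2r//; exact: score.
(* Twice the comparison of objectives, with the squares expanded around [b] and the cross term
   bounded by the score times [nD]. *)
have basic : V + 2 * lam * nh <= lam * nD + 2 * lam * n1.
  have E k : (y k - \sum_a X k a * bh a) ^+ 2 = u k ^+ 2 + (-2 * (u k * v k) + v k ^+ 2).
    have -> : \sum_a X k a * bh a = \sum_a X k a * b a + v k.
      by rewrite -big_split /=; apply: eq_bigr => a _; rewrite /D; ring.
    by rewrite /u; ring.
  move: opt; under eq_bigr do rewrite E.
  rewrite big_split /= big_split /= -mulr_sumr -/(u _).
  have -> : \sum_k v k ^+ 2 = T%:R * V by rewrite /V mulrA divff ?mul1r ?gt_eqF.
  move: cross; set c := \sum_k u k * v k; set U := \sum_k u k ^+ 2.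
  move=> cle opt.
  have opt2 : (2 * T%:R)^-1 * (-2 * c + T%:R * V) + lam * nh <= lam * n1.
    by move: opt; rewrite mulrDr -/U; lra.
  have E2 : (2 * T%:R)^-1 * (-2 * c + T%:R * V) = V / 2 - c / T%:R.
    by field; rewrite gt_eqF.
  have : c / T%:R <= lam / 2 * nD.
    by rewrite ler_pdivrMr// mulrC mulrA.
  by move: opt2; rewrite E2; lra.
pose nS := \sum_(a | b a != 0) `|D a|.
have nhD : nh <= nD + n1.
  rewrite /nh /nD /n1 -big_split; apply: ler_sum => a _ /=.
  by rewrite -[X in `|X| <= _](subrK (b a)) ler_normD.
have nDh : nD <= nh + n1.
  by rewrite /nh /nD /n1 -big_split; apply: ler_sum => a _ /=; exact: ler_normB.
have n1D : n1 <= nD + nh.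
  rewrite /nh /nD /n1 -big_split; apply: ler_sum => a _ /=.
  by rewrite /D distrC -[X in `|X| <= _](subrK (bh a)) ler_normD.
(* Off the support of [b] the entries of [bh] and [D] coincide; on the support the triangle
   inequality loses [2 * nS]. *)
have nSle : n1 + nD - 2 * nS <= nh.
  rewrite /nS big_mkcond /= mulr_sumr /n1 /nD -big_split -sumrB; apply: ler_sum => a _ /=.
  have [b0|b0] /= := eqVneq (b a) 0.
    by rewrite /D b0 normr0 subr0; lra.
  have : `|b a| <= `|D a| + `|bh a|.
    by rewrite /D distrC -[X in `|X| <= _](subrK (bh a)) ler_normD.
  lra.
have lamD (p q : R) : lam * p <= lam * q -> p <= q by rewrite ler_pM2l.
(* Dropping [V >= 0] from [basic] leaves 2 nh <= nD + 2 n1. Inserting nD - n1 <= nh gives this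
   bound, and inserting [nSle] gives the next one. *)
have nD4 : nD <= 4 * n1.
  suff : 2 * nh <= nD + 2 * n1 by lra.
  by apply: lamD; rewrite mulrDr; lra.
have nDS : nD <= 4 * nS.
  suff : 2 * nh <= nD + 2 * n1 by lra.
  by apply: lamD; rewrite mulrDr; lra.
have V3 : V <= 3 * lam * nD.
  have : lam * (n1 - nh) <= lam * nD by rewrite ler_pM2l//; lra.
  by rewrite mulrBr; lra.
pose q := \sum_a D a ^+ 2.
have q0 : 0 <= q by apply: sumr_ge0 => a _; exact: sqr_ge0.
have rhs0 : 0 <= 3 * lam + 4 * theta * delta.
  have theta0 : 0 <= theta by apply: le_trans btheta; apply: sumr_ge0.
  by rewrite addr_ge0// mulr_ge0// ?mulr_ge0// ltW.
have quad : kappa * q <= V + delta * nD ^+ 2.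
  apply: (le_trans (Gmin D)).
  have -> : V = \sum_a \sum_a' D a * D a' * (T%:R^-1 * \sum_k X k a * X k a').
    rewrite /V mulr_sumr.
    have E k : T%:R^-1 * v k ^+ 2 =
        \sum_a \sum_a' D a * D a' * (T%:R^-1 * (X k a * X k a')).
      rewrite expr2 /v mulr_suml mulr_sumr; apply: eq_bigr => a _.
      by rewrite !mulr_sumr; apply: eq_bigr => a' _; ring.
    under eq_bigr do rewrite E.
    rewrite exchange_big; apply: eq_bigr => a _.
    rewrite exchange_big; apply: eq_bigr => a' _.
    by rewrite -!mulr_sumr.
  have -> : delta * nD ^+ 2 = \sum_a \sum_a' delta * (`|D a| * `|D a'|).
    rewrite expr2 {1}/nD mulr_suml mulr_sumr; apply: eq_bigr => a _.
    by rewrite /nD !mulr_sumr.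
  rewrite -big_split; apply: ler_sum => a _ /=; rewrite -big_split.
  apply: ler_sum => a' _ /=; rewrite -lerBlDl -mulrBr (le_trans (ler_norm _))//.
  by rewrite normrM normrM mulrC ler_wpM2r ?mulr_ge0// distrC gram.
have nS_le : nS <= Num.sqrt s%:R * Num.sqrt q.
  have nS0 : 0 <= nS by apply: sumr_ge0.
  rewrite -sqrtrM ?ler0n// -[leLHS]ger0_norm// -sqrtr_sqr.
  rewrite ler_wsqrtr// (le_trans (sqr_sum_le _ _))//.
  apply: ler_pM; first by rewrite ler0n.
  - by apply: sumr_ge0 => a _; exact: sqr_ge0.
  - by rewrite ler_nat; exact: bs.
  - rewrite /q [leRHS](bigID (fun a => b a != 0)) /= ler_wpDr ?sumr_ge0//.
      by move=> a _; exact: sqr_ge0.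
    by apply: ler_sum => a _; rewrite -normrX ger0_norm ?sqr_ge0.
rewrite -[\sum_a (bh a - b a) ^+ 2]/q.
(* The quadratic bound is linear in [nD], hence in [Num.sqrt q]; one factor [Num.sqrt q] is
   cancelled, which requires it to be nonzero. *)
have [q_eq0|q_neq0] := eqVneq q 0.
  rewrite q_eq0 sqrtr0 mulr0.
  by rewrite mulr_ge0// mulr_ge0// sqrtr_ge0.
have sq0 : 0 < Num.sqrt q by rewrite sqrtr_gt0 lt0r q_neq0.
rewrite -(ler_pM2r sq0) -[leLHS]mulrA -[X in kappa * X]expr2 sqr_sqrtr// (le_trans quad)//.
apply: (@le_trans _ _ ((3 * lam + 4 * theta * delta) * nD)).
  rewrite mulrDl lerD// expr2 mulrA ler_wpM2r// mulrC ler_wpM2r//.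
  by rewrite (le_trans nD4)// ler_pM2l.
rewrite mulrC [leRHS](_ : _ =
    4 * (Num.sqrt s%:R * Num.sqrt q) * (3 * lam + 4 * theta * delta)); last by ring.
rewrite ler_wpM2r//.
by rewrite (le_trans nDS)// ler_pM2l.
Qed.

(** * Vech form of the conditional covariance *)

Section VechAlgebra.
Variables (R : realType) (N : nat).
Local Notation d := (vech_dim N).

Definition vech_pair (hN : (0 < N)%N) (k : 'I_d) : 'I_N * 'I_N :=
  nth (Ordinal hN, Ordinal hN) (vech_pairs N) k.

Lemma vechE (hN : (0 < N)%N) (S : 'M[R]_N) k :
  vech S k 0 = S (vech_pair hN k).1 (vech_pair hN k).2.
Proof.
by rewrite mxE (nth_map (Ordinal hN, Ordinal hN)) ?size_vech_pairs.
Qed.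

Lemma vech_pair_inj (hN : (0 < N)%N) : injective (vech_pair hN).
Proof.
move=> k l /eqP; rewrite nth_uniq ?size_vech_pairs ?uniq_vech_pairs// => /eqP.
exact: val_inj.
Qed.

Lemma ord_vech_dim_pos (k : 'I_d) : (0 < N)%N.
Proof. by case: N k => // -[]. Qed.

(** The row of the duplication matrix at the position of the k-th lower-triangular pair is the k-th
    unit vector, so [v] can be read off from the product. *)
Lemma dup_mx_ker (v : 'cV[R]_d) : dup_mx R N *m v = 0 -> v = 0.
Proof.
move=> Dv; apply/colP => k; rewrite [RHS]mxE.
have hN := ord_vech_dim_pos k.
have pk : ((vech_pair hN k).2 <= (vech_pair hN k).1)%N.
  by rewrite -mem_vech_pairs mem_nth ?size_vech_pairs.
pose m := mxtens_index ((vech_pair hN k).2, (vech_pair hN k).1).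
have := congr1 (fun D : 'cV_(N * N) => D m 0) Dv.
rewrite mxE [in RHS]mxE => <-.
rewrite (bigD1 k)//= big1 ?addr0 => [|l lk];
  rewrite mxE mxtens_indexK /= pk (vechE hN) mxE.
  by rewrite !eqxx mul1r.
case: eqP => //= e1; last by rewrite mul0r.
case: eqP => //= e2; last by rewrite mul0r.
case/eqP: lk; apply: (@vech_pair_inj hN).
by case: (vech_pair hN l) (vech_pair hN k) e1 e2 => ? ? [? ?] /= -> ->.
Qed.

(** A row [u] killed by the Gram matrix makes the squared norm of [dup_mx *m u^T] vanish;
    injectivity of the duplication matrix finishes. *)
Lemma dup_gram_unit : (dup_mx R N)^T *m dup_mx R N \in unitmx.
Proof.
rewrite -row_free_unit; apply: inj_row_free => u uD.
apply: trmx_inj; rewrite trmx0; apply: dup_mx_ker.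
have : ((u *m ((dup_mx R N)^T *m dup_mx R N)) *m u^T) 0 0 = 0.
  by rewrite uD mul0mx mxE.
rewrite mulmxA -mulmxA -[u *m _^T](trmxK) trmx_mul trmxK.
set x := dup_mx R N *m u^T; rewrite mxE => /eqP.
under eq_bigr do rewrite mxE -expr2.
rewrite psumr_eq0 => [/allP x0|a _]; last exact: sqr_ge0.
rewrite -/x; apply/colP => a.
have := x0 a (mem_index_enum _); rewrite sqrf_eq0 => /eqP.
by rewrite -/x => ->; rewrite mxE.
Qed.

Lemma dup_pinvK : dup_pinv R N *m dup_mx R N = 1%:M.
Proof. by rewrite /dup_pinv -mulmxA mulVmx ?dup_gram_unit. Qed.

Lemma tens_vec (A S : 'M[R]_N) : (A *t A) *m vec S = vec (A *m S *m A^T).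
Proof.
apply/colP => a; rewrite -[a](mxtens_unindexK a); case: (mxtens_unindex a) => j i.
rewrite [RHS]mxE mxtens_indexK /= [LHS]mxE [RHS]mxE.
rewrite (reindex (@mxtens_index N N)) /=; last first.
  by exists (@mxtens_unindex N N) => ? _; [exact: mxtens_indexK | exact: mxtens_unindexK].
transitivity (\sum_j' \sum_i' A j j' * A i i' * S i' j').
  rewrite pair_big; apply: eq_bigr => -[j' i'] _ /=.
  by rewrite tensmxE mxE mxtens_indexK.
apply: eq_bigr => j' _; rewrite mxE mulr_suml; apply: eq_bigr => i' _.
by rewrite !mxE; ring.
Qed.

Lemma vec_sum I (s : seq I) (F : I -> 'M[R]_N) :
  vec (\sum_(i <- s) F i) = \sum_(i <- s) vec (F i).
Proof.
by apply/colP => a; rewrite !mxE !summxE; apply: eq_bigr => i _; rewrite !mxE.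
Qed.

Variables (p : nat) (Omega : 'M[R]_N) (K : 'I_p -> nat).
Variable A : forall i : 'I_p, 'I_(K i) -> 'M[R]_N.

(** Duplication turns vech into vec, the Kronecker squares act on vec as congruences, and their sum
    is again symmetric, so it is the duplicate of a vech and the left inverse undoes it. *)
Lemma Phi_vech (i : 'I_p) (S : 'M[R]_N) : S^T = S ->
  Phi A i *m vech S = vech (\sum_(k < K i) A k *m S *m (A k)^T).
Proof.
move=> symS; rewrite /Phi -mulmxA dup_mxP// -mulmxA mulmx_suml.
under eq_bigr do rewrite tens_vec.
rewrite -vec_sum -dup_mxP ?mulmxA ?dup_pinvK ?mul1mx//.
rewrite linear_sum; apply: eq_bigr => k _ /=.
by rewrite !trmx_mul trmxK symS mulmxA.
Qed.

Lemma Theta_const j : Theta Omega A (lshift (p * d) 0) j = vech Omega j 0.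
Proof. by rewrite /Theta mxE row_mxEl. Qed.

Lemma Theta_lag i l j :
  Theta Omega A (rshift 1 (mxtens_index (i, l))) j = Phi A i j l.
Proof. by rewrite /Theta mxE row_mxEr mxE mxtens_indexK. Qed.

Lemma xvec_const (rp : int -> 'cV[R]_N) t : xvec p rp t (lshift (p * d) 0) 0 = 1.
Proof. by rewrite /xvec col_mxEu mxE. Qed.

Lemma xvec_lag (rp : int -> 'cV[R]_N) t (i : 'I_p) (l : 'I_d) :
  xvec p rp t (rshift 1 (mxtens_index (i, l))) 0 = yvec rp (t - i.+1%:Z) l 0.
Proof. by rewrite /xvec col_mxEd mxE mxtens_indexK. Qed.

Lemma bekk_covE (rp : int -> 'cV[R]_N) t (j : 'I_d) :
  vech (bekk_cov Omega A rp t) j 0 =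
  \sum_b Theta Omega A b j * xvec p rp t b 0.
Proof.
have hN := ord_vech_dim_pos j.
rewrite big_split_ord /= big_ord1 Theta_const xvec_const mulr1.
rewrite (vechE hN) /bekk_cov mxE -(vechE hN); congr (_ + _).
rewrite summxE (reindex (@mxtens_index p d)) /=; last first.
  by exists (@mxtens_unindex p d) => ? _; [exact: mxtens_indexK | exact: mxtens_unindexK].
transitivity (\sum_(i < p) (Phi A i *m yvec rp (t - i.+1%:Z)) j 0).
  apply: eq_bigr => i _; rewrite Phi_vech ?trmx_mul ?trmxK//.
  by rewrite (vechE hN).
transitivity (\sum_(i < p) \sum_l Phi A i j l * yvec rp (t - i.+1%:Z) l 0).
  by apply: eq_bigr => i _; rewrite mxE.
rewrite pair_big; apply: eq_bigr => -[i l] _ /=.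
by rewrite Theta_lag xvec_lag.
Qed.

End VechAlgebra.

(** * Truncated monomials *)

Section TruncatedProducts.
Variables (R : realType) (eps tau : R).
Hypothesis heps : 0 < eps <= 1.
Hypothesis tau0 : 0 < tau.
Implicit Type xs : seq R.

Let eps0 : 0 < eps. Proof. by case/andP: heps. Qed.
Let ep10 : 0 <= 1 + eps. Proof. by rewrite addr_ge0// ltW. Qed.

Lemma trunc_id x : `|x| <= tau -> trunc tau x = x.
Proof. by move=> xt; rewrite /trunc min_l// -numEsg. Qed.

Lemma norm_trunc_le x : `|trunc tau x| <= tau.
Proof.
rewrite /trunc normrM [X in _ * X]ger0_norm; last by rewrite le_min normr_ge0 ltW.
have [->|x0] := eqVneq x 0; first by rewrite sgr0 normr0 mul0r ltW.
by rewrite normr_sg x0 mul1r ge_min lexx orbT.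
Qed.

Lemma trunc_shrink x : exists2 c : R, 0 <= c <= 1 & trunc tau x = c * x.
Proof.
have [->|x0] := eqVneq x 0.
  by exists 1; rewrite ?ler01 ?lexx// /trunc sgr0 mul0r mulr0.
have nx0 : 0 < `|x| by rewrite normr_gt0.
exists (Num.min `|x| tau / `|x|).
  rewrite ler_pdivrMr// mul1r ge_min lexx /= divr_ge0//.
  by rewrite le_min normr_ge0 ltW.
rewrite /trunc -[RHS]mulrA [X in _ = _ * (_ * X)]numEsg.
move: (Num.min _ _) (Num.sg x) => u v; field.
by rewrite gt_eqF.
Qed.

Lemma prod_trunc_shrink xs :
  exists2 c : R, 0 <= c <= 1 & \prod_(x <- xs) trunc tau x = c * \prod_(x <- xs) x.
Proof.
elim: xs => [|x xs [c /andP[c0 c1] IH]].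
  by exists 1; rewrite ?ler01 ?lexx// !big_nil mulr1.
have [k /andP[k0 k1] kx] := trunc_shrink x.
exists (k * c); first by rewrite mulr_ge0//= mulr_ile1.
by rewrite !big_cons IH kx; ring.
Qed.

Lemma norm_prod_trunc_le xs : `|\prod_(x <- xs) trunc tau x| <= tau ^+ size xs.
Proof.
elim: xs => [|x xs IH]; first by rewrite big_nil normr1 expr0.
by rewrite big_cons normrM exprS ler_pM// norm_trunc_le.
Qed.

Definition power_sum xs : R := \sum_(x <- xs) `|x| `^ (4 + 4 * eps).

Lemma power_sum_ge0 xs : 0 <= power_sum xs.
Proof. by apply: sumr_ge0 => x _; exact: powR_ge0. Qed.

Lemma powR_pow4 (m z : R) : 0 <= m -> (m ^+ 4) `^ z = m `^ (4 * z).
Proof. by move=> m0; rewrite -powR_mulrn// -powRrM. Qed.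

(** [m] is the largest absolute value: the product is then at most m^4, and m^(4 + 4 eps) is a
    single term of the power sum. This replaces Hoelder for the moments of four-fold products. *)
Lemma prod_max xs : size xs = 4%N -> exists2 m : R,
  m `^ (4 + 4 * eps) <= power_sum xs &
  [/\ 0 <= m, `|\prod_(x <- xs) x| <= m ^+ 4 & (forall x, x \in xs -> `|x| <= m)].
Proof.
move=> xs4.
have [m [m0 mP] mxs] : exists2 m : R, (0 <= m /\ forall x, x \in xs -> `|x| <= m) &
    m `^ (4 + 4 * eps) <= power_sum xs.
  have : (0 < size xs)%N by rewrite xs4.
  elim: xs {xs4} => [//|x xs IH] _.
  have [xs0|xs0] := posnP (size xs).
    move: xs0 => /eqP; rewrite size_eq0 => /eqP ->.
    exists `|x|; first by split=> // y; rewrite inE => /eqP ->.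
    by rewrite /power_sum big_seq1.
  have [m [m0 mP] mxs] := IH xs0.
  have [xm|mx] := leP `|x| m.
    exists m.
      by split=> // y; rewrite inE => /orP[/eqP ->//|/mP].
    by rewrite /power_sum big_cons (le_trans mxs)// lerDr powR_ge0.
  exists `|x|.
    split=> // y; rewrite inE => /orP[/eqP ->//|/mP ym].
    exact: le_trans ym (ltW mx).
  by rewrite /power_sum big_cons lerDl power_sum_ge0.
exists m => //; split=> //; rewrite -xs4.
elim: xs {xs4 mxs} mP => [|x xs IH] mP; first by rewrite big_nil normr1 expr0.
rewrite big_cons normrM exprS ler_pM// ?mP ?mem_head//.
by apply: IH => y yxs; apply: mP; rewrite inE yxs orbT.
Qed.

Lemma prod_powR_le xs : size xs = 4%N ->
  `|\prod_(x <- xs) x| `^ (1 + eps) <= power_sum xs.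
Proof.
move=> /prod_max[m mxs [m0 xm _]]; apply: le_trans mxs.
rewrite (_ : 4 + 4 * eps = 4 * (1 + eps)); last by ring.
by rewrite -powR_pow4// ge0_ler_powR ?nnegrE ?exprn_ge0.
Qed.

Lemma norm_prod_le xs : size xs = 4%N -> `|\prod_(x <- xs) x| <= 1 + power_sum xs.
Proof.
move=> xs4; have [y1|y1] := leP `|\prod_(x <- xs) x| 1.
  by rewrite (le_trans y1)// lerDl power_sum_ge0.
apply: le_trans (_ : power_sum xs <= _); last by rewrite lerDr.
apply: le_trans (prod_powR_le xs4); apply: le1r_powR; first exact: ltW.
by rewrite lerDl ltW.
Qed.

(** The square is split as |z|^(1 - eps) |z|^(1 + eps): the first factor takes the sup bound, which
    uses eps <= 1, and the second the moment of the product, as truncation only shrinks. *)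
Lemma sqr_prod_trunc_le xs : size xs = 4%N ->
  (\prod_(x <- xs) trunc tau x) ^+ 2 <= (tau ^+ 4) `^ (1 - eps) * power_sum xs.
Proof.
move=> xs4; set z := \prod_(x <- xs) trunc tau x.
have e1 : 0 <= 1 - eps by rewrite subr_ge0; case/andP: heps.
have -> : z ^+ 2 = `|z| `^ (1 - eps) * `|z| `^ (1 + eps).
  rewrite -powRD; last by apply/implyP => /eqP; lra.
  by rewrite (_ : 1 - eps + (1 + eps) = 2%:R) ?powR_mulrn ?real_normK ?num_real//; lra.
rewrite ler_pM ?powR_ge0//.
  apply: ge0_ler_powR => //; rewrite ?nnegrE ?exprn_ge0 ?(ltW tau0)//.
  by have := norm_prod_trunc_le xs; rewrite xs4.
apply: le_trans (prod_powR_le xs4); rewrite ge0_ler_powR ?nnegrE//.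
have [c /andP[c0 c1] zc] := prod_trunc_shrink xs; rewrite /z zc.
by rewrite normrM ger0_norm// ler_piMl.
Qed.

(** Nothing changes unless the largest entry [m] exceeds [tau]; in that case the error is at most
    m^4 = (m^4)^(- eps) m^(4 + 4 eps), and m > tau bounds the first factor. *)
Lemma prod_trunc_bias xs : size xs = 4%N ->
  `|\prod_(x <- xs) trunc tau x - \prod_(x <- xs) x| <=
  (tau ^+ 4) `^ (- eps) * power_sum xs.
Proof.
move=> xs4; have [m mxs [m0 xm mP]] := prod_max xs4.
have [mt|tm] := leP m tau.
  rewrite (_ : \prod_(x <- xs) trunc tau x = \prod_(x <- xs) x).
    by rewrite subrr normr0 mulr_ge0 ?powR_ge0 ?power_sum_ge0.
  by apply: eq_big_seq => x /mP xm'; rewrite trunc_id// (le_trans xm').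
have [c /andP[c0 c1] ->] := prod_trunc_shrink xs.
apply: (@le_trans _ _ `|\prod_(x <- xs) x|).
  rewrite -{2}[\prod_(x <- xs) x]mul1r -mulrBl normrM distrC [`|1 - c|]ger0_norm ?subr_ge0//.
  by rewrite ler_piMl// gerBl.
apply: (le_trans xm).
have m0' : 0 < m by exact: lt_trans tm.
have -> : m ^+ 4 = (m ^+ 4) `^ (- eps) * m `^ (4 + 4 * eps).
  rewrite powR_pow4// -powRD; last by rewrite [m == 0]gt_eqF// implybT.
  by rewrite (_ : 4 * - eps + _ = 4%:R) ?powR_mulrn//; ring.
rewrite ler_pM ?powR_ge0// !powRN lef_pV2 ?posrE ?powR_gt0 ?exprn_gt0//.
by rewrite ge0_ler_powR ?nnegrE ?exprn_ge0 ?ltW// ltr_pXn2r ?nnegrE ?ltW.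
Qed.

End TruncatedProducts.

Lemma trunc_clamp (R : realType) (tau x : R) : 0 < tau ->
  trunc tau x = Num.min (Num.max x (- tau)) tau.
Proof.
move=> tau0; rewrite /trunc; have [->|x0|x0] := sgrP x.
- rewrite mul0r max_l ?oppr_le0 ?(ltW tau0)// min_l//; exact: ltW.
- by rewrite mul1r max_l//; lra.
- rewrite mulN1r; have [xt|xt] := leP (- x) tau.
    by rewrite max_l ?min_l//; lra.
  by rewrite max_r ?min_l//; lra.
Qed.

Lemma measurable_trunc (d : measure_display) (T : measurableType d)
    (R : realType) (tau : R) (f : T -> R) : 0 < tau ->
  measurable_fun setT f -> measurable_fun setT (fun w => trunc tau (f w)).
Proof.
move=> tau0 mf; under eq_fun do rewrite trunc_clamp//.
by apply: measurable_minr => //; apply: measurable_maxr.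
Qed.

Section Monomials.
Context (disp : measure_display) (Om : measurableType disp) (R : realType).
Variable P : probability Om R.
Variable N : nat.

(* [Some (l, k)] stands for the entry [k] of [r_(t-l)], [None] for the
   constant 1. *)
Definition lag_entry : Type := option (nat * 'I_N).

Definition lag_val (rp : int -> 'cV[R]_N) (t : int) (f : lag_entry) : R :=
  if f is Some lk then rp (t - lk.1%:Z) lk.2 0 else 1.

Definition monomial (rp : int -> 'cV[R]_N) (t : int) (fs : seq lag_entry) : R :=
  \prod_(f <- fs) lag_val rp t f.

Definition lag_in (p q : nat) (f : lag_entry) : bool :=
  if f is Some lk then (p <= lk.1 <= q)%N else true.

Variable r : int -> Om -> 'cV[R]_N.
Hypothesis mr : process r.

Definition entry_gen (D : set int) : set (set Om) :=
  [set E | exists t j (B : set R),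
     [/\ D t, measurable B & E = entry r t j @^-1` B]].

Lemma sigma_of_measurable D : sigma_of D r `<=` @measurable _ Om.
Proof.
apply: smallest_sub; first exact: sigma_algebra_measurable.
move=> _ [t [j [B [_ mB ->]]]]; rewrite -[X in measurable X]setTI.
exact: mr.
Qed.

Lemma measurable_factor (D : set int) t f :
  (forall lk, f = Some lk -> D (t - lk.1%:Z)) ->
  measurable_wrt (entry_gen D) (fun w => lag_val (r^~ w) t f).
Proof.
case: f => [lk|] Df; last exact: measurable_cst.
move=> _ B mB; rewrite setTI; apply: sub_gen_smallest.
by exists (t - lk.1%:Z), lk.2, B; split => //; exact: Df.
Qed.

Lemma measurable_factor_T t f :
  measurable_fun setT (fun w => lag_val (r^~ w) t f).
Proof.
apply: (measurable_wrt_sub (@sigma_of_measurable setT)).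
exact: measurable_factor.
Qed.

Lemma measurable_monomial (D : set int) t fs :
  (forall lk, Some lk \in fs -> D (t - lk.1%:Z)) ->
  measurable_wrt (entry_gen D) (fun w => monomial (r^~ w) t fs).
Proof.
move=> Df; apply: measurable_prod => f ffs.
by apply: measurable_factor => lk fE; apply: Df; rewrite -fE.
Qed.

Lemma measurable_monomial_T t fs :
  measurable_fun setT (fun w => monomial (r^~ w) t fs).
Proof.
apply: (measurable_wrt_sub (@sigma_of_measurable setT)).
exact: measurable_monomial.
Qed.

(** For the padding factor 1 the bound [1 <= tau] is what makes truncation harmless. *)
Lemma trunc_factor tau (rp : int -> 'cV[R]_N) t f : 1 <= tau ->
  lag_val (trunc_path tau rp) t f = trunc tau (lag_val rp t f).
Proof.
case: f => [lk|] tau1 /=; first by rewrite mxE.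
by rewrite trunc_id ?normr1.
Qed.

Lemma trunc_monomial tau (rp : int -> 'cV[R]_N) t fs : 1 <= tau ->
  monomial (trunc_path tau rp) t fs =
  \prod_(x <- [seq lag_val rp t f | f <- fs]) trunc tau x.
Proof.
by move=> tau1; rewrite big_map; apply: eq_bigr => f _; rewrite trunc_factor.
Qed.

Lemma monomialE (rp : int -> 'cV[R]_N) t fs :
  monomial rp t fs = \prod_(x <- [seq lag_val rp t f | f <- fs]) x.
Proof. by rewrite big_map. Qed.

Lemma measurable_trunc_monomial (D : set int) tau t fs : 1 <= tau ->
  (forall lk, Some lk \in fs -> D (t - lk.1%:Z)) ->
  measurable_wrt (entry_gen D) (fun w => monomial (trunc_path tau (r^~ w)) t fs).
Proof.
move=> tau1 Df; rewrite /monomial.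
under eq_fun do under eq_bigr do rewrite trunc_factor//.
apply: measurable_prod => f ffs.
apply: measurable_trunc; first exact: lt_le_trans tau1.
by apply: measurable_factor => lk fE; apply: Df; rewrite -fE.
Qed.

Section Moments.
Variables (eps M : R).
Hypothesis heps : 0 < eps <= 1.
Hypothesis M1 : 1 <= M.
Hypothesis moment : forall t j,
  ('E_P[(fun w => `|entry r t j w| `^ (4 + 4 * eps))%R] <= M%:E)%E.

Let pw t f w := `|lag_val (r^~ w) t f| `^ (4 + 4 * eps).

(** The padding factor has moment 1, which is covered by [1 <= M]. *)
Lemma factor_moment t f :
  integrable_rv P (pw t f) /\ \int[P]_w pw t f w <= M.
Proof.
have mp : measurable_fun setT (pw t f).
  apply: (@measurableT_comp _ _ _ _ _ _ (fun x : R => x `^ (4 + 4 * eps))).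
    exact: measurable_powR.
  by apply: measurableT_comp => //; exact: measurable_factor_T.
have le : (\int[P]_w (pw t f w)%:E <= M%:E)%E.
  rewrite /pw; case: f mp => [lk|] _ /=.
    by have := moment (t - lk.1%:Z) lk.2; rewrite unlock.
  under eq_integral do rewrite normr1 powR1.
  by rewrite integral_cst//= probability_setT mule1 lee_fin.
split.
  apply/integrableP; split; first exact/measurable_EFinP.
  apply: le_lt_trans (ltry M); apply: le_trans le.
  by under eq_integral do rewrite /= ger0_norm ?powR_ge0//.
rewrite /Rintegral -[leRHS]/(fine M%:E) fine_le//.
rewrite ge0_fin_numE ?(le_lt_trans le) ?ltry// integral_ge0// => w _.
by rewrite lee_fin powR_ge0.
Qed.

Definition factor_power_sum t fs w : R :=
  power_sum eps [seq lag_val (r^~ w) t f | f <- fs].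

Lemma factor_power_sum_moment t fs :
  integrable_rv P (factor_power_sum t fs) /\
  \int[P]_w factor_power_sum t fs w <= (size fs)%:R * M.
Proof.
have E : factor_power_sum t fs = fun w => \sum_(f <- fs) pw t f w.
  by apply/funext => w; rewrite /factor_power_sum /power_sum big_map.
have ip f : integrable_rv P (pw t f) by case: (factor_moment t f).
rewrite E; split; first exact: integrable_rv_sum.
rewrite expect_sum//.
elim: fs {E} => [|f fs IH]; first by rewrite big_nil mul0r.
rewrite big_cons /= -nat1r mulrDl mul1r lerD//.
by case: (factor_moment t f).
Qed.

Lemma integrable_monomial t fs : size fs = 4%N ->
  integrable_rv P (fun w => monomial (r^~ w) t fs).
Proof.
move=> fs4.
have [ip _] := factor_power_sum_moment t fs.
apply: (@le_integrable _ _ _ P setT _ _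
  (EFin \o (fun w => 1 + factor_power_sum t fs w))) => //.
- by apply/measurable_EFinP; exact: measurable_monomial_T.
- move=> w _ /=; rewrite lee_fin monomialE.
  apply: le_trans (norm_prod_le heps _) _; first by rewrite size_map.
  exact: ler_norm.
- by apply: integrable_rvD => //; exact: integrable_rv_cst.
Qed.

Variable tau : R.
Hypothesis tau1 : 1 <= tau.
Let tau0 : 0 < tau. Proof. exact: lt_le_trans tau1. Qed.

Lemma trunc_monomial_le rp t fs : size fs = 4%N ->
  `|monomial (trunc_path tau rp) t fs| <= tau ^+ 4.
Proof.
move=> fs4; rewrite trunc_monomial//.
have := norm_prod_trunc_le tau0 [seq lag_val rp t f | f <- fs].
by rewrite size_map fs4.
Qed.

Lemma measurable_trunc_monomial_T t fs :
  measurable_fun setT (fun w => monomial (trunc_path tau (r^~ w)) t fs).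
Proof.
apply: (measurable_wrt_sub (@sigma_of_measurable setT)).
exact: measurable_trunc_monomial.
Qed.

Lemma integrable_trunc_monomial t fs : size fs = 4%N ->
  integrable_rv P (fun w => monomial (trunc_path tau (r^~ w)) t fs).
Proof.
move=> fs4; apply: (bounded_integrable P (measurable_trunc_monomial_T t fs)) => w.
exact: trunc_monomial_le.
Qed.

Lemma trunc_monomial_bias t fs : size fs = 4%N ->
  `|\int[P]_w monomial (trunc_path tau (r^~ w)) t fs
    - \int[P]_w monomial (r^~ w) t fs| <= (tau ^+ 4) `^ (- eps) * (4 * M).
Proof.
move=> fs4.
have [ip pM] := factor_power_sum_moment t fs.
have it := integrable_trunc_monomial t fs4.
have im := integrable_monomial t fs4.
rewrite -RintegralB//.
apply: (le_trans (le_normr_Rintegral _ (integrable_rvB it im))) => //.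
apply: (@le_trans _ _ (\int[P]_w ((tau ^+ 4) `^ (- eps) * factor_power_sum t fs w))).
  apply: le_expect; [exact: integrable_norm (integrable_rvB it im)|exact: integrable_rvZ|].
  move=> w; rewrite trunc_monomial// monomialE.
  by apply: prod_trunc_bias => //; rewrite size_map.
rewrite RintegralZl// ler_wpM2l ?powR_ge0//.
by rewrite fs4 in pM.
Qed.

Lemma trunc_monomial_second t fs : size fs = 4%N ->
  \int[P]_w (monomial (trunc_path tau (r^~ w)) t fs ^+ 2) <=
  (tau ^+ 4) `^ (1 - eps) * (4 * M).
Proof.
move=> fs4.
have [ip pM] := factor_power_sum_moment t fs.
apply: (@le_trans _ _ (\int[P]_w ((tau ^+ 4) `^ (1 - eps) * factor_power_sum t fs w))).
  apply: le_expect; last first.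
  - move=> w; rewrite trunc_monomial//.
    by apply: sqr_prod_trunc_le => //; rewrite size_map.
  - exact: integrable_rvZ.
  - apply: (@bounded_integrable _ _ _ _ _ ((tau ^+ 4) ^+ 2)).
      by apply: measurable_funX; exact: measurable_trunc_monomial_T.
    move=> w; rewrite normrX lerXn2r ?nnegrE ?exprn_ge0 ?(ltW tau0)//.
    exact: trunc_monomial_le.
rewrite RintegralZl// ler_wpM2l ?powR_ge0//.
by rewrite fs4 in pM.
Qed.

End Moments.
End Monomials.

(** * Exponential deviation bound for sums of truncated monomials *)

Lemma time_before (i q : nat) (m : int) :
  i%:Z < m -> i.+1%:Z - q%:Z <= m.
Proof. lia. Qed.

(** A monomial at index [i] reads [r] at times from i + 1 - p to i + 1. A gap [g] between indices
    therefore leaves g + 1 - p between times, and starting from [p + lmix] keeps that in the range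
    where mixing is assumed. *)
Lemma time_after (i q p lmix g : nat) (m : int) : (p + lmix <= g)%N -> (q <= p)%N ->
  m + g%:Z <= i%:Z -> m + (g.+1 - p)%N%:Z <= i.+1%:Z - q%:Z.
Proof. lia. Qed.

Lemma gap_lmix (p lmix g : nat) : (p + lmix <= g)%N -> (lmix <= g.+1 - p)%N.
Proof. lia. Qed.

Lemma gap_sub (p lmix g : nat) : (g - (p + lmix) <= g.+1 - p)%N.
Proof. lia. Qed.

Section Deviation.
Context (disp : measure_display) (Om : measurableType disp) (R : realType).
Variable P : probability Om R.
Variables (N : nat) (r : int -> Om -> 'cV[R]_N).
Hypothesis mr : process r.

Lemma alpha_mix_bound (t : int) (l : nat) (A B : set Om) :
  sigma_of [set u | u <= t] r A -> sigma_of [set u | t + l%:Z <= u] r B ->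
  fine (P (A `&` B)) <= fine (P A) * fine (P B) + alpha_mix P r l.
Proof.
move=> sA sB; rewrite -lerBlDl; apply: le_trans (ler_norm _) _.
apply: ub_le_sup; last by exists t, A, B.
have p01 E : measurable E -> 0 <= fine (P E) <= 1.
  move=> mE; rewrite fine_ge0//= -[leRHS]/(fine 1%E) fine_le ?probability_le1//.
  exact: fin_num_measure.
(* The supremum defining [alpha_mix] dominates its members only once the set is known to be
   bounded. *)
exists 1 => _ [t' [E [F [/(sigma_of_measurable mr) mE /(sigma_of_measurable mr) mF ->]]]].
have /andP[? ?] := p01 _ mE; have /andP[? ?] := p01 _ mF.
have /andP[? ?] := p01 _ (measurableI _ _ mE mF).
have : 0 <= fine (P E) * fine (P F) <= 1 by rewrite mulr_ge0//= mulr_ile1.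
by rewrite ler_norml; lra.
Qed.

Variables (p : nat) (fs : seq (lag_entry N)) (eps M tau rho K : R) (lmix c T : nat).
Hypothesis heps : 0 < eps <= 1.
Hypothesis M1 : 1 <= M.
Hypothesis moment : forall t j,
  ('E_P[(fun w => `|entry r t j w| `^ (4 + 4 * eps))%R] <= M%:E)%E.
Hypothesis tau1 : 1 <= tau.
Hypothesis fs4 : size fs = 4%N.
Hypothesis fsp : all (lag_in 0 p) fs.
Hypothesis rho0 : 0 < rho.
Hypothesis K1 : 1 <= K.
Hypothesis mixing : forall l, (lmix <= l)%N ->
  alpha_mix P r l <= K * expR (- (rho * l%:R)).
Hypothesis cP : (p + lmix <= c)%N /\ 2 + ln K <= rho * (c - (p + lmix))%:R.
Hypothesis T1 : 1 <= ln (T%:R : R).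

Let Z (i : nat) (w : Om) : R := monomial (trunc_path tau (r^~ w)) i.+1%:Z fs.
Let Zc (i : nat) (w : Om) : R := Z i w - \int[P]_w Z i w.

Lemma coord_gen_sigma_of (I : set nat) (D : set int) :
  (forall i lk, I i -> Some lk \in fs -> D (i.+1%:Z - lk.1%:Z)) ->
  <<s coord_gen Zc I >> `<=` sigma_of D r.
Proof.
move=> ID; apply: smallest_sub; first exact: smallest_sigma_algebra.
move=> _ [i [B [Ii mB ->]]].
have mZ : measurable_wrt (entry_gen r D) (Zc i).
  apply: measurable_funB; last exact: measurable_cst.
  by apply: measurable_trunc_monomial => // lk; exact: ID.
by have := mZ measurableT B mB; rewrite setTI.
Qed.

Lemma trunc_monomial_deviation (x : R) : 0 <= x ->
  fine (P [set w | x <= `|\sum_(i < T) Zc i w|]) <=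
  2 * expR (6 + 2 * T%:R * ((tau ^+ 4) `^ (1 - eps) * (4 * M)) /
                  ((2 * tau ^+ 4) ^+ 2 * ln T%:R)
        - x / ((2 + 3 * c)%:R * (4 * (2 * tau ^+ 4) * ln T%:R))).
Proof.
have [c0c rc] := cP.
have tau0 : 0 < tau by exact: lt_le_trans tau1.
have B0 : 0 < tau ^+ 4 by exact: exprn_gt0.
have iZ i : integrable_rv P (Z i) by exact: integrable_trunc_monomial.
have mZ i : measurable_fun setT (Z i) by exact: measurable_trunc_monomial_T.
have ZB i w : `|Z i w| <= tau ^+ 4 by exact: trunc_monomial_le.
have EZB i : `|\int[P]_w Z i w| <= tau ^+ 4.
  apply: (le_trans (le_normr_Rintegral _ (iZ i))) => //.
  rewrite -[leRHS](expect_cst P); apply: le_expect => //.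
  - exact: integrable_norm (iZ i).
  - exact: integrable_rv_cst.
have iZ2 i : integrable_rv P (fun w => Z i w ^+ 2).
  apply: (@bounded_integrable _ _ _ _ _ ((tau ^+ 4) ^+ 2)).
    exact: measurable_funX.
  by move=> w; rewrite normrX lerXn2r ?nnegrE ?exprn_ge0 ?(ltW tau0).
apply: (@bernstein_abs _ _ _ _ Zc (2 * tau ^+ 4) _ rho K (p + lmix)) => //.
- by move=> i; apply: measurable_funB.
- by rewrite mulr_gt0.
- move=> i w; apply: (le_trans (ler_normB _ _)).
  by rewrite mulr2n mulrDl mul1r lerD.
- move=> i; have ic := integrable_rv_cst P (\int[P]_w Z i w).
  by rewrite (RintegralB measurableT (iZ i) ic) expect_cst subrr.
- move=> i; apply: le_trans (trunc_monomial_second mr heps M1 moment tau1 i.+1%:Z fs4).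
  rewrite -/(Z i).
  set m := \int[P]_w Z i w.
  have E w : Zc i w ^+ 2 = Z i w ^+ 2 + ((- 2 * m) * Z i w + m ^+ 2).
    by rewrite /Zc -/m; ring.
  under eq_Rintegral do rewrite E.
  have ic : integrable_rv P (fun=> m ^+ 2) by exact: integrable_rv_cst.
  have iz : integrable_rv P (fun w => (-2 * m) * Z i w) by exact: integrable_rvZ.
  rewrite (RintegralD measurableT (iZ2 i) (integrable_rvD iz ic)).
  rewrite (RintegralD measurableT iz ic) expect_cst.
  rewrite (RintegralZl _ measurableT (iZ i)) -/m gerDl.
  have := sqr_ge0 m; rewrite expr2; lra.
- move=> m g A B pg FA GB.
  have sA : sigma_of [set u | u <= m] r A.
    apply: coord_gen_sigma_of FA => i lk /= im _.
    exact: time_before.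
  have sB : sigma_of [set u | m + (g.+1 - p)%N%:Z <= u] r B.
    apply: coord_gen_sigma_of GB => i lk /= im /(allP fsp) /= lkp.
    exact: time_after pg lkp im.
  apply: (le_trans (alpha_mix_bound sA sB)); rewrite lerD2l.
  apply: (le_trans (mixing _)); first exact: gap_lmix.
  rewrite ler_pM2l ?(lt_le_trans _ K1)// ler_expR lerN2 ler_pM2l// ler_nat.
  exact: gap_sub.
Qed.

End Deviation.

(** * Moment equations *)

Section Orthogonality.
Context (disp : measure_display) (Om : measurableType disp) (R : realType).
Variable P : probability Om R.
Variables (G : set (set Om)) (U : Om -> R).
Hypothesis GT : <<s G >> `<=` @measurable _ Om.
Hypothesis iU : integrable_rv P U.
Hypothesis U0 : forall E, <<s G >> E -> \int[P]_(w in E) U w = 0.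

Let mU : measurable_fun setT U.
Proof. by apply/measurable_EFinP; exact: measurable_int iU. Qed.

Lemma integrable_mul_bounded (W : Om -> R) (b : R) : measurable_fun setT W ->
  (forall w, `|W w| <= b) -> integrable_rv P (fun w => U w * W w).
Proof.
move=> mW Wb.
have ib : integrable_rv P (fun w => b * `|U w|).
  by apply: integrable_rvZ; exact: integrable_norm iU.
apply: le_integrable ib => //; first by apply/measurable_EFinP; exact: measurable_funM.
move=> w _ /=; rewrite lee_fin normrM mulrC [leRHS]ger0_norm.
  by rewrite ler_wpM2r.
by rewrite mulr_ge0// (le_trans (normr_ge0 _) (Wb w)).
Qed.

Lemma orthogonal_staircase (W : Om -> R) (h : R) (n : nat) : measurable_wrt G W ->
  \int[P]_w (U w * staircase h n (W w)) = 0.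
Proof.
move=> mW; pose A (i : 'I_n) := [set w | i.+1%:R * h <= W w].
have GA i : <<s G >> (A i) by exact: measurable_wrt_ge.
have E w : U w * staircase h n (W w) = \sum_(i < n) h * (U \_ (A i)) w.
  rewrite /staircase mulr_sumr; apply: eq_bigr => i _; rewrite patchE.
  case: ifPn => [|]; first by rewrite inE /A /= => ->; rewrite mulr1 mulrC.
  by rewrite notin_setE /A /= => /negP/negbTE ->; rewrite !mulr0.
under eq_Rintegral do rewrite E.
have iA (i : 'I_n) : integrable_rv P (U \_ (A i)).
  rewrite /integrable_rv -restrict_EFin -integrable_mkcond; last exact: GT.
  by apply: integrableS iU => //; exact: GT.
rewrite expect_sum; last by move=> i; exact: integrable_rvZ.
rewrite big1// => i _; rewrite RintegralZl; [|exact: measurableT|exact: iA].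
by rewrite -Rintegral_mkcond U0 ?mulr0.
Qed.

(** Replacing [W] by a staircase of mesh [h] costs at most h E|U|, and [U] integrates to zero
    against the staircase, level set by level set. *)
Lemma orthogonal_range (W : Om -> R) (b : R) : 0 < b -> measurable_wrt G W ->
  (forall w, 0 <= W w <= b) -> \int[P]_w (U w * W w) = 0.
Proof.
move=> b0 mW Wb; have mW' := measurable_wrt_sub GT mW.
have iUW : integrable_rv P (fun w => U w * W w).
  apply: (integrable_mul_bounded mW') => w; have /andP[W0 Wb'] := Wb w.
  by rewrite ger0_norm//; exact: Wb'.
have iaU : integrable_rv P (fun w => `|U w|) by exact: integrable_norm iU.
apply/eqP; rewrite -normr_eq0 eq_le normr_ge0 andbT.
apply/ler_addgt0Pr => e e0; rewrite add0r.
pose C := \int[P]_w `|U w|.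
have C0 : 0 <= C by apply: Rintegral_ge0.
pose n := (Num.truncn (b * C / e)).+1; pose h := b / n%:R.
have n0 : 0 < n%:R :> R by rewrite ltr0n.
have h0 : 0 < h by rewrite divr_gt0.
have nh : n%:R * h = b by rewrite /h mulrC divfK// gt_eqF.
have sW w : staircase h n (W w) <= W w <= staircase h n (W w) + h.
  by apply: staircase_approx => //; rewrite nh.
have isW : integrable_rv P (fun w => U w * staircase h n (W w)).
  apply: (@integrable_mul_bounded _ b).
    apply/measurable_EFinP.
    exact: measurable_int (integrable_rv_staircase P h n mW').
  move=> w; rewrite ger0_norm; first by have := sW w; have := Wb w; lra.
  by apply: sumr_ge0 => i _; rewrite mulr_ge0// ltW.
rewrite -[\int[P]_w (U w * W w)]subr0 -(orthogonal_staircase h n mW).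
rewrite -RintegralB//.
apply: (le_trans (le_normr_Rintegral _ (integrable_rvB iUW isW))) => //.
apply: (@le_trans _ _ (\int[P]_w (h * `|U w|))).
  apply: le_expect; [exact: integrable_norm (integrable_rvB iUW isW)|exact: integrable_rvZ|].
  move=> w; rewrite -mulrBr normrM mulrC ler_wpM2r//.
  by rewrite ger0_norm; have := sW w; lra.
rewrite (RintegralZl _ measurableT iaU) -/C /h mulrAC ler_pdivrMr// [leRHS]mulrC.
by rewrite -ler_pdivrMr//; apply/ltW; exact: truncnS_gt.
Qed.

Lemma orthogonal_bounded (W : Om -> R) (b : R) : 0 < b -> measurable_wrt G W ->
  (forall w, `|W w| <= b) -> \int[P]_w (U w * W w) = 0.
Proof.
move=> b0 mW Wb; have mW' := measurable_wrt_sub GT mW.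
have iUW := integrable_mul_bounded mW' Wb.
have iUb : integrable_rv P (fun w => U w * b).
  by apply: (@integrable_mul_bounded _ `|b|).
have : \int[P]_w (U w * (W w + b)) = 0.
  apply: (@orthogonal_range _ (2 * b)); first by rewrite mulr_gt0.
    by apply: measurable_funD.
  by move=> w; have := Wb w; rewrite ler_norml; lra.
have : \int[P]_w (U w * b) = 0.
  apply: (@orthogonal_range (fun=> b) b) => //; first exact: measurable_cst.
  by move=> _; rewrite ltW/=.
move=> E1 E2; rewrite -E2.
under [RHS]eq_Rintegral do rewrite mulrDr.
by rewrite RintegralD// E1 addr0.
Qed.

(** [W] is a product of past coordinates and so unbounded: it is truncated at n + 1, and dominated
    convergence applies with |U W|, which is assumed integrable. *)
Lemma expect_mul_eq0 (W : Om -> R) : measurable_wrt G W ->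
  integrable_rv P (fun w => U w * W w) -> \int[P]_w (U w * W w) = 0.
Proof.
move=> mW iUW; have mW' := measurable_wrt_sub GT mW.
pose f n w := (U w * trunc n.+1%:R (W w))%:E.
have tb n w : `|trunc n.+1%:R (W w)| <= n.+1%:R by rewrite norm_trunc_le.
have mt n : measurable_wrt G (fun w => trunc n.+1%:R (W w)) by exact: measurable_trunc.
have it n : integrable_rv P (fun w => U w * trunc n.+1%:R (W w)).
  exact: (integrable_mul_bounded (measurable_wrt_sub GT (mt n)) (tb n)).
have f0 n : (\int[P]_w f n w = 0)%E.
  have n0 : 0 < n.+1%:R :> R by rewrite ltr0n.
  rewrite -[LHS]fineK; last exact: integrable_fin_num (it n).
  by congr EFin; exact: orthogonal_bounded n0 (mt n) (tb n).
have cv : (\int[P]_w f n w)%E @[n --> \oo] --> (\int[P]_w (U w * W w)%:E)%E.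
  apply: (@dominated_cvg _ _ _ P setT measurableT f _ (fun w => `|U w * W w|%:E)) => //.
  - by move=> n; exact: measurable_int (it n).
  - move=> w _; apply: cvg_near_cst; near=> n; rewrite /f trunc_id//.
    apply: (@le_trans _ _ n%:R); last by rewrite ler_nat.
    by near: n; exact: nbhs_infty_ger.
  - exact: integrable_norm iUW.
  - move=> n w _; rewrite /f lee_fin normrM [leRHS]normrM ler_wpM2l//.
    have [c /andP[c0 c1] ->] := @trunc_shrink R n.+1%:R (ltr0Sn _ _) (W w).
    by rewrite normrM ger0_norm// ler_piMl.
rewrite /Rintegral.
rewrite (_ : (\int[P]_w (U w * W w)%:E)%E = 0%E)//.
move/cvg_lim: cv => <-//; under eq_fun do rewrite f0.
by rewrite lim_cst.
Unshelve. all: by end_near. Qed.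

End Orthogonality.

Lemma same_law_expect (disp : measure_display) (Om : measurableType disp)
    (R : realType) (P : probability Om R) (m n : nat)
    (X Y : Om -> 'M[R]_(m, n)) (g : 'M[R]_(m, n) -> R) :
  (forall B : set R, measurable B -> borel_mx (g @^-1` B)) ->
  same_law P X Y ->
  integrable_rv P (g \o X) -> integrable_rv P (g \o Y) ->
  \int[P]_w g (X w) = \int[P]_w g (Y w).
Proof.
move=> mg XY iX iY.
have mX : measurable_fun setT (g \o X).
  by apply/measurable_EFinP; exact: measurable_int iX.
have mY : measurable_fun setT (g \o Y).
  by apply/measurable_EFinP; exact: measurable_int iY.
pose GX : {RV P >-> R} := HB.pack (g \o X) (isMeasurableFun.Build _ _ _ _ _ mX).
pose GY : {RV P >-> R} := HB.pack (g \o Y) (isMeasurableFun.Build _ _ _ _ _ mY).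
congr fine.
(* Equality of laws is known on sets, so both expectations are moved to the image measures on the
   line, which coincide. *)
transitivity (\int[distribution P GX]_y y%:E)%E.
  by rewrite integral_distribution.
transitivity (\int[distribution P GY]_y y%:E)%E; last first.
  by rewrite integral_distribution.
apply: eq_measure_integral => A mA _.
exact: XY (mg A mA).
Qed.

(** * Entries of the second moments as four-fold monomials *)

Section Entries.
Variables (R : realType) (N p : nat) (hN : (0 < N)%N).
Local Notation d := (vech_dim N).

Definition y_entries (l : nat) (j : 'I_d) : seq (lag_entry N) :=
  [:: Some (l, (vech_pair hN j).1); Some (l, (vech_pair hN j).2)].

Definition x_entries (a : 'I_(1 + p * d)) : seq (lag_entry N) :=
  match fintype.split a with
  | inl _ => [:: None; None]
  | inr b => y_entries (mxtens_unindex b).1.+1 (mxtens_unindex b).2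
  end.

Lemma monomial_cat (rp : int -> 'cV[R]_N) t fs gs :
  monomial rp t (fs ++ gs) = monomial rp t fs * monomial rp t gs.
Proof. by rewrite /monomial big_cat. Qed.

Lemma yvecE (rp : int -> 'cV[R]_N) t (l : nat) j :
  yvec rp (t - l%:Z) j 0 = monomial rp t (y_entries l j).
Proof.
by rewrite /yvec (vechE hN) mxE big_ord1 mxE /monomial !big_cons big_nil mulr1.
Qed.

Lemma yvec0E (rp : int -> 'cV[R]_N) t j :
  yvec rp t j 0 = monomial rp t (y_entries 0 j).
Proof. by rewrite -yvecE subr0. Qed.

Lemma xvecE (rp : int -> 'cV[R]_N) t a :
  xvec p rp t a 0 = monomial rp t (x_entries a).
Proof.
rewrite /x_entries; case: fintype.splitP => [i ai|b ab].
  have -> : a = lshift (p * d) 0 by apply: val_inj; rewrite /= ai ord1.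
  by rewrite xvec_const /monomial !big_cons big_nil !mulr1.
have -> : a = rshift 1 b by apply: val_inj.
rewrite -[b](mxtens_unindexK b) mxtens_indexK; case: (mxtens_unindex b) => i l.
by rewrite xvec_lag yvecE.
Qed.

Lemma size_x_entries a : size (x_entries a) = 2%N.
Proof. by rewrite /x_entries; case: fintype.split. Qed.

Lemma lag_x_entries a : all (lag_in 1 p) (x_entries a).
Proof. by rewrite /x_entries; case: fintype.split => // b;
  case: (mxtens_unindex b) => i l; rewrite /y_entries /= ltn_ord. Qed.

Lemma lag_in_weaken fs : all (@lag_in N 1 p) fs -> all (lag_in 0 p) fs.
Proof. by apply: sub_all => -[lk|] //= /andP[_ ->]. Qed.

End Entries.

Section Stationarity.
Context (disp : measure_display) (Om : measurableType disp) (R : realType).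
Variable P : probability Om R.
Variables (N p : nat) (r : int -> Om -> 'cV[R]_N) (eps M : R).
Hypothesis mr : process r.
Hypothesis heps : 0 < eps <= 1.
Hypothesis M1 : 1 <= M.
Hypothesis moment : forall t j,
  ('E_P[(fun w => `|entry r t j w| `^ (4 + 4 * eps))%R] <= M%:E)%E.

(** Column k of the matrix stands for lag k, so that stationarity of finite families of times
    applies; [inord] returns the lag itself as long as it is at most [p]. *)
Definition matrix_monomial (fs : seq (lag_entry N)) (X : 'M[R]_(N, p.+1)) : R :=
  \prod_(f <- fs) if f is Some lk then X lk.2 (inord lk.1) else 1.

Lemma borel_matrix_monomial fs (B : set R) : measurable B ->
  borel_mx (matrix_monomial fs @^-1` B).
Proof.
move=> mB.
pose gen := [set C | exists i j (B : set R),
  measurable B /\ C = [set X : 'M[R]_(N, p.+1) | B (X i j)]].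
have mg : @measurable_fun _ _ (g_sigma_algebraType gen) R setT (matrix_monomial fs).
  apply: measurable_prod => -[lk|] _; last exact: measurable_cst.
  move=> _ C mC; rewrite setTI; apply: sub_gen_smallest.
  by exists lk.2, (inord lk.1), C.
by have := mg measurableT B mB; rewrite setTI.
Qed.

Lemma monomial_stationary (t : int) fs : strictly_stationary P r ->
  size fs = 4%N -> all (lag_in 0 p) fs ->
  \int[P]_w monomial (r^~ w) t fs = \int[P]_w monomial (r^~ w) 0 fs.
Proof.
move=> stat fs4 fsp.
pose X (h : int) w : 'M[R]_(N, p.+1) := \matrix_(j, k) r (- k%:Z + h) w j 0.
have XE h w : monomial (r^~ w) h fs = matrix_monomial fs (X h w).
  rewrite /matrix_monomial /monomial; apply: eq_big_seq => -[lk|] //.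
  by move=> /(allP fsp) /= lkp; rewrite mxE inordK // addrC.
have iX h : integrable_rv P (matrix_monomial fs \o X h).
  have := integrable_monomial mr heps M1 moment h fs4.
  by congr integrable_rv; apply/funext => w /=; rewrite XE.
under eq_Rintegral do rewrite XE.
under [RHS]eq_Rintegral do rewrite XE.
apply: (same_law_expect (@borel_matrix_monomial fs)) => //.
have := stat p.+1 (fun k => - k%:Z) t.
have -> : (fun w => \matrix_(j < N, k < p.+1) r (- k%:Z) w j 0) = X 0.
  by apply/funext => w; apply/matrixP => j k; rewrite !mxE addr0.
by move=> s C mC; rewrite s.
Qed.

End Stationarity.

Section MomentEquation.
Context (disp : measure_display) (Om : measurableType disp) (R : realType).
Variable P : probability Om R.
Variables (N p : nat) (hN : (0 < N)%N) (r eta : int -> Om -> 'cV[R]_N) (eps M : R).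
Variables (Omega : 'M[R]_N) (K : 'I_p -> nat).
Variable A : forall i : 'I_p, 'I_(K i) -> 'M[R]_N.
Hypothesis model : bekk_arch P Omega A r eta.
Hypothesis heps : 0 < eps <= 1.
Hypothesis M1 : 1 <= M.
Hypothesis moment : forall t j,
  ('E_P[(fun w => `|entry r t j w| `^ (4 + 4 * eps))%R] <= M%:E)%E.

(** The conditional covariance equation says that r_k r_l - Sigma_kl integrates to zero over past
    events. Since the lags in [fs] are at least 1, the monomial is a past variable and orthogonality
    extends to it; the vech form makes Sigma_kl linear in x_t. *)
Lemma moment_equation (t : int) j (fs : seq (lag_entry N)) :
  size fs = 2%N -> all (lag_in 1 p) fs ->
  \int[P]_w monomial (r^~ w) t (y_entries hN 0 j ++ fs) =
  \sum_b Theta Omega A b j *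
    \int[P]_w monomial (r^~ w) t (x_entries hN b ++ fs).
Proof.
move=> fs2 fsp.
have mr := bekk_r_process model.
set k := (vech_pair hN j).1; set l := (vech_pair hN j).2.
have [iX iY _ XY] := bekk_cond_cov model t k l.
set Y := fun w => bekk_cov Omega A (r^~ w) t k l in iY XY.
pose X := entry r t k \* entry r t l.
have YE w : Y w = \sum_b Theta Omega A b j * monomial (r^~ w) t (x_entries hN b).
  rewrite /Y -(vechE hN) bekk_covE; apply: eq_bigr => b _.
  by rewrite xvecE.
have XE w : X w = monomial (r^~ w) t (y_entries hN 0 j).
  by rewrite /X -yvec0E /yvec (vechE hN) mxE big_ord1 mxE.
pose W w := monomial (r^~ w) t fs.
have mW : measurable_wrt (entry_gen r [set u | u < t]) W.
  apply: measurable_monomial => lk /(allP fsp) /= /andP[lk1 _].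
  by rewrite /= ltrBlDr ltrDl.
have im b : integrable_rv P (fun w => monomial (r^~ w) t (x_entries hN b ++ fs)).
  by apply: (integrable_monomial mr heps M1 moment); rewrite size_cat size_x_entries fs2.
have iXW : integrable_rv P (fun w => X w * W w).
  have : integrable_rv P (fun w => monomial (r^~ w) t (y_entries hN 0 j ++ fs)).
    by apply: (integrable_monomial mr heps M1 moment); rewrite size_cat fs2.
  by congr integrable_rv; apply/funext => w; rewrite monomial_cat XE.
have YWE w : Y w * W w =
    \sum_b Theta Omega A b j * monomial (r^~ w) t (x_entries hN b ++ fs).
  rewrite YE mulr_suml; apply: eq_bigr => b _.
  by rewrite monomial_cat mulrA.
have iYW : integrable_rv P (fun w => Y w * W w).
  under eq_fun do rewrite YWE.
  by apply: integrable_rv_sum => b; exact: integrable_rvZ.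
have U0 E : sigma_of [set u | u < t] r E -> \int[P]_(w in E) (X w - Y w) = 0.
  move=> GE; have mE := sigma_of_measurable mr GE.
  rewrite RintegralB//; [|exact: integrableS iX|exact: integrableS iY].
  by rewrite /Rintegral (XY _ GE) subrr.
have orth := expect_mul_eq0 (sigma_of_measurable mr (D := _)) (integrable_rvB iX iY) U0 mW.
have {}orth : \int[P]_w ((X w - Y w) * W w) = 0.
  apply: orth.
  have := integrable_rvB iXW iYW.
  by congr integrable_rv; apply/funext => w; rewrite mulrBl.
have : \int[P]_w (X w * W w) = \int[P]_w (Y w * W w).
  apply/eqP; rewrite -subr_eq0 -RintegralB// -[X in _ == X]orth; apply/eqP.
  by apply: eq_Rintegral => w _; rewrite mulrBl.
under eq_Rintegral do rewrite XE -monomial_cat.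
move=> ->; under eq_Rintegral do rewrite YWE.
rewrite expect_sum; last by move=> b; exact: integrable_rvZ.
by apply: eq_bigr => b _; rewrite RintegralZl//; exact: im.
Qed.

End MomentEquation.

(** * Sample size and rates *)

Section SampleSize.
Variable R : realType.

Lemma ln2_ge : 2^-1 <= ln (2 : R).
Proof.
rewrite -[2^-1]expRK ler_ln ?posrE ?expR_gt0//.
have : expR (2^-1) * (1 - 2^-1) <= 1 :> R.
  by rewrite -ler_pdivlMl ?expR_gt0// mulr1 -expRN; exact: (expR_ge1Dx (- 2^-1)).
lra.
Qed.

Lemma vech_dim_le N : (vech_dim N <= N * N)%N.
Proof.
rewrite /vech_dim -[X in (_ <= X)%N](doubleK (N * N)) half_leq// -mul2n mulnS.
by case: N => // N; nia.
Qed.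

Lemma regressors_le p N : (0 < p)%N -> (0 < N)%N ->
  ((p * vech_dim N).+1 <= 2 * p * N ^ 2)%N.
Proof.
move=> p0 N0; rewrite -mulnA mul2n -addnn -addn1 leq_add//.
  by rewrite leq_mul2l vech_dim_le orbT.
by rewrite muln_gt0 p0 expn_gt0 N0.
Qed.

Lemma vech_dim_gt0 N : (0 < N)%N -> (0 < vech_dim N)%N.
Proof. by case: N => // -[|N] _; rewrite /vech_dim // half_gt0; nia. Qed.

Lemma log_dim_ge p N : (0 < p)%N -> (0 < N)%N -> 2^-1 <= log_dim R p N.
Proof.
move=> p0 N0; apply: (le_trans ln2_ge); rewrite /log_dim ler_ln ?posrE ?ltr0n//.
by rewrite ler_nat ltnS muln_gt0 p0 vech_dim_gt0.
Qed.

(** The assumption gives T >= exp(24 A) N^2, using 1 + 1 / eps >= 2 and 2 L >= 1. Hence 24 A <= l,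
    and from pd + 1 <= 2 p N^2 also L <= A l. *)
Lemma sample_size p N T (eps : R) : (0 < p)%N -> (0 < N)%N -> 0 < eps <= 1 ->
  2 * expR (24 * (1 + ln (2 * p)%:R)) * N%:R `^ (1 + eps^-1) * log_dim R p N <= T%:R ->
  1 <= ln (T%:R : R) /\ log_dim R p N <= T_eff R T.
Proof.
move=> p0 N0 /andP[e0 e1] hT.
set L := log_dim R p N in hT *; set A := 1 + ln (2 * p)%:R in hT *.
have L2 : 2^-1 <= L by exact: log_dim_ge.
have A1 : 1 <= A by rewrite lerDl ln_ge0// ler1n muln_gt0.
have N1 : 1 <= N%:R :> R by rewrite ler1n.
have N2 : N%:R ^+ 2 <= N%:R `^ (1 + eps^-1) :> R.
  rewrite -powR_mulrn ?ler0n// ler_powR// [2%:R](_ : _ = 1 + 1)//.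
  by rewrite lerD2l invf_ge1.
have E0 := expR_gt0 (24 * A).
have TN : expR (24 * A) * N%:R ^+ 2 <= T%:R.
  apply: le_trans hT; rewrite mulrAC [2 * _]mulrC -!mulrA ler_pM2l//.
  have : 1 <= 2 * L by lra.
  set u := N%:R ^+ 2 in N2 *; set z := N%:R `^ _ in N2 * => h.
  have u0 : 0 <= u by exact: sqr_ge0.
  have -> : 2 * (L * z) = (2 * L) * z by ring.
  rewrite (le_trans N2)// ler_peMl// (le_trans u0)//.
have NN1 : 1 <= N%:R ^+ 2 :> R by rewrite exprn_ege1.
have ET : expR (24 * A) <= T%:R by apply: le_trans TN; rewrite ler_peMr// ltW.
have T0 : 0 < T%:R :> R by exact: lt_le_trans ET.
have lA : 24 * A <= ln (T%:R : R) by rewrite -[24 * A]expRK ler_ln ?posrE.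
have l1 : 1 <= ln (T%:R : R) by lra.
split=> //.
set l := ln (T%:R : R) in lA l1 *.
have N2T : N%:R ^+ 2 <= T%:R :> R.
  apply: le_trans TN; rewrite ler_peMl ?sqr_ge0//.
  by rewrite -[X in X <= _]expR0 ler_expR; lra.
have LA : L <= A * l.
  apply: (@le_trans _ _ (ln ((2 * p)%:R * N%:R ^+ 2))).
    rewrite /L /log_dim ler_ln ?posrE ?ltr0n//; last first.
      by rewrite mulr_gt0 ?ltr0n ?muln_gt0 ?exprn_gt0 ?ltr0n.
    by rewrite -natrX -natrM ler_nat; exact: regressors_le.
  rewrite lnM ?posrE ?ltr0n ?muln_gt0 ?exprn_gt0 ?ltr0n//.
  have : ln (N%:R ^+ 2) <= l.
    by rewrite ler_ln ?posrE// exprn_gt0// ltr0n.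
  have lp0 : 0 <= ln ((2 * p)%:R : R) by rewrite ln_ge0// ler1n muln_gt0.
  have : 0 <= ln ((2 * p)%:R : R) * (l - 1) by rewrite mulr_ge0// subr_ge0.
  by rewrite /A; move: (ln (2 * p)%:R) => q; nra.
rewrite /T_eff -/l ler_pdivlMr ?exprn_gt0 ?(lt_le_trans _ l1)//.
have l0 : 0 < l by exact: lt_le_trans l1.
(* The fourth-order term of the exponential series at [l]. It ends the chain L l^2 <= A l^3 <= l^4 /
   24 <= T and is the origin of 24. *)
have lT : l ^+ 4 / 24 <= T%:R.
  have := expR_ge1Dxn 3 (ltW l0); rewrite lnK ?posrE// (_ : 4`!%:R = 24 :> R)//.
  lra.
apply: le_trans lT.
rewrite ler_pdivlMr//.
have -> : l ^+ 4 = (l * l) * (l ^+ 2) by ring.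
rewrite mulrAC ler_pM2r ?exprn_gt0//.
apply: (@le_trans _ _ (A * l * 24)); first by rewrite ler_pM2r.
by rewrite (_ : A * l * 24 = 24 * A * l) ?ler_pM2r//; ring.
Qed.

End SampleSize.

Section Rates.
Variables (R : realType) (p N T : nat) (eps M : R).
Hypothesis heps : 0 < eps <= 1.
Hypothesis M1 : 1 <= M.
Local Notation L := (log_dim R p N).
Local Notation l := (ln (T%:R : R)).
Hypothesis L0 : 0 < L.
Hypothesis l0 : 0 < l.
Hypothesis LT : L <= T_eff R T.

(** Fourth power of the reference truncation level of a single coordinate, hence the size of a
    truncated four-fold product. *)
Definition trunc_level : R := (M * T_eff R T / L) `^ (1 + eps)^-1.

Let u := M * T_eff R T / L.
Let e10 : 0 < 1 + eps. Proof. by rewrite addr_gt0//; case/andP: heps. Qed.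
Let Te0 : 0 < T_eff R T. Proof. exact: lt_le_trans LT. Qed.
Let M0 : 0 < M. Proof. exact: lt_le_trans M1. Qed.
Let u1 : 1 <= u.
Proof. by rewrite /u ler_pdivlMr// mul1r (le_trans LT)// ler_peMl// ltW. Qed.
Let u0 : 0 < u. Proof. exact: lt_le_trans u1. Qed.

Lemma trunc_level_ge1 : 1 <= trunc_level.
Proof.
rewrite /trunc_level -[leLHS](powRr0 u); apply: ler_powR => //.
by rewrite invr_ge0 ltW.
Qed.

Lemma trunc_level_root : (u `^ (4 + 4 * eps)^-1) ^+ 4 = trunc_level.
Proof.
rewrite -powR_mulrn ?powR_ge0// -powRrM /trunc_level; congr (_ `^ _).
have e4 : 4 + 4 * eps = 4 * (1 + eps) by ring.
by rewrite e4; field; rewrite gt_eqF.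
Qed.

Lemma trunc_root_ge1 : 1 <= u `^ (4 + 4 * eps)^-1.
Proof.
rewrite -[leLHS](powRr0 u); apply: ler_powR => //.
by rewrite invr_ge0 addr_ge0// mulr_ge0// ltW; case/andP: heps.
Qed.

Lemma rateE : rate p N T eps M = M * trunc_level `^ (- eps).
Proof.
rewrite /rate /trunc_level -/u -powRrM.
have eps0 : 0 < eps by case/andP: heps.
have -> : M `^ eps^-1 * L / T_eff R T = M `^ (1 + eps^-1) * u^-1.
  rewrite powRD ?powRr1 ?(ltW M0)//; last by rewrite [M == 0]gt_eqF// implybT.
  by rewrite /u; field; rewrite !gt_eqF.
rewrite powRM ?powR_ge0 ?invr_ge0 ?(ltW u0)// -powRrM.
have -> : (1 + eps^-1) * (eps / (1 + eps)) = 1 by field; rewrite !gt_eqF.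
rewrite powRr1 ?(ltW M0)//; congr (_ * _).
rewrite -powR_inv1 ?(ltW u0)// -powRrM; congr (_ `^ _).
by field; rewrite gt_eqF.
Qed.

(** Relative to the squared bound, the second moments of the [T] summands add up to order L l^2;
    division by [l] leaves the order L l in the Bernstein exponent. *)
Lemma trunc_level_moment : T%:R * M * trunc_level `^ (- (1 + eps)) = L * l ^+ 2.
Proof.
rewrite /trunc_level -powRrM mulrN mulVf ?gt_eqF// powR_inv1 ?(ltW u0)//.
have T0 : 0 < T%:R :> R.
  by move: Te0; rewrite /T_eff pmulr_lgt0 ?invr_gt0 ?exprn_gt0.
by rewrite -/u /u /T_eff; field; rewrite !gt_eqF.
Qed.

Lemma T_rate : T%:R * rate p N T eps M = trunc_level * (L * l ^+ 2).
Proof.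
rewrite rateE -trunc_level_moment opprD powRD; last first.
  by rewrite (gt_eqF (lt_le_trans ltr01 trunc_level_ge1)) implybT.
have t0 : 0 < trunc_level by exact: lt_le_trans trunc_level_ge1.
by rewrite powR_inv1 ?(ltW t0)//; field; rewrite gt_eqF.
Qed.

Lemma rate_gt0 : 0 < rate p N T eps M.
Proof.
by rewrite rateE mulr_gt0// powR_gt0// (lt_le_trans ltr01 trunc_level_ge1).
Qed.

End Rates.

(** * Norms and column-wise reduction of the estimator *)

Lemma normF_sqr (R : realType) (m n : nat) (A : 'M[R]_(m, n)) :
  normF A ^+ 2 = \sum_j \sum_i A i j ^+ 2.
Proof.
rewrite sqr_sqrtr; last by do 2 (apply: sumr_ge0 => ? _); exact: sqr_ge0.
by rewrite exchange_big.
Qed.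

Lemma normF_columns (R : realType) (m n : nat) (A : 'M[R]_(m, n)) (q : R) :
  0 <= q -> (forall j, Num.sqrt (\sum_i A i j ^+ 2) <= q) ->
  normF A <= Num.sqrt n%:R * q.
Proof.
move=> q0 Aq; rewrite -[q]ger0_norm// -sqrtr_sqr -sqrtrM ?ler0n//.
rewrite ler_wsqrtr// exchange_big /=.
apply: (@le_trans _ _ (\sum_(j < n) q ^+ 2)); last first.
  by rewrite sumr_const card_ord mulr_natl.
apply: ler_sum => j _.
have s0 : 0 <= \sum_i A i j ^+ 2 by apply: sumr_ge0 => i _; exact: sqr_ge0.
by rewrite -(sqr_sqrtr s0) lerXn2r ?nnegrE ?sqrtr_ge0.
Qed.

Lemma col_norm1_le (R : realType) (m n : nat) (A : 'M[R]_(m, n)) j :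
  \sum_i `|A i j| <= norm1inf A.
Proof. by rewrite /norm1inf; apply: (le_bigmax_cond _ (fun j => \sum_i `|A i j|)). Qed.

(** With s = 0 every column would vanish; positivity of [s] is later used to absorb terms free of
    [s]. *)
Lemma norm1inf_gt0_sparse (R : realType) (m n s : nat) (A : 'M[R]_(m, n)) :
  0 < norm1inf A -> col_sparse s A -> (0 < s)%N.
Proof.
move=> A0 As; rewrite lt0n; apply/eqP => s0; move: A0; apply/negP; rewrite -leNgt.
apply/bigmax_leP; split=> // j _; rewrite big1// => i _.
apply/eqP; rewrite normr_eq0; apply/negPn/negP => Aij.
have := As j; rewrite s0 leqn0 => /eqP/card0_eq /(_ i).
by rewrite inE /= Aij.
Qed.

Lemma sub_mulmxE (R : pzRingType) (m n q : nat) (Y : 'M[R]_(m, q))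
    (X : 'M[R]_(m, n)) (C : 'M[R]_(n, q)) k i :
  (Y - X *m C) k i = Y k i - \sum_a X k a * C a i.
Proof. by rewrite !mxE. Qed.

Lemma estimator_column (R : realType) (N p T : nat) (tau lam : R)
    (rp : int -> 'cV[R]_N) (Bh B : 'M[R]_(1 + p * vech_dim N, vech_dim N)) j :
  is_estimator T tau lam rp Bh ->
  (2 * T%:R)^-1 * \sum_k (Ymx T tau rp k j - \sum_a Xmx p T tau rp k a * Bh a j) ^+ 2
    + lam * \sum_a `|Bh a j| <=
  (2 * T%:R)^-1 * \sum_k (Ymx T tau rp k j - \sum_a Xmx p T tau rp k a * B a j) ^+ 2
    + lam * \sum_a `|B a j|.
Proof.
pose g (C : 'M[R]_(1 + p * vech_dim N, vech_dim N)) i := (2 * T%:R)^-1 *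
  \sum_k (Ymx T tau rp k i - \sum_a Xmx p T tau rp k a * C a i) ^+ 2
    + lam * \sum_a `|C a i|.
have objE C : objective T tau lam rp C = \sum_i g C i.
  rewrite /objective normF_sqr /norm11 [X in lam * X]exchange_big /=.
  rewrite !mulr_sumr -big_split /=.
  apply: eq_bigr => i _; rewrite /g; congr (_ * _ + _).
  by apply: eq_bigr => k _; rewrite sub_mulmxE.
(* The objective is a sum over columns; a competitor that differs from the minimizer in column [j]
   alone isolates that column's problem. *)
pose B' := \matrix_(a, i) if i == j then B a i else Bh a i.
move=> /(_ B'); rewrite !objE (bigD1 j)//= [leRHS](bigD1 j)//=.
have gE i : (forall a, B' a i = (if i == j then B a i else Bh a i)) ->
    g B' i = if i == j then g B i else g Bh i.
  by move=> E; rewrite /g; case: eqP E => _ E;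
    under eq_bigr do (under eq_bigr do rewrite E);
    under [X in _ + lam * X]eq_bigr do rewrite E.
have B'E a i : B' a i = (if i == j then B a i else Bh a i) by rewrite mxE.
rewrite gE// eqxx [X in _ <= _ + X](eq_bigr (g Bh)) => [|i /negPf ij].
  by rewrite lerD2r.
by rewrite gE// ij.
Qed.

Lemma union_bound (disp : measure_display) (Om : measurableType disp)
    (R : realType) (P : probability Om R) (I : eqType) (s : seq I)
    (F : I -> set Om) (q : R) :
  (forall i, i \in s -> measurable (F i) /\ fine (P (F i)) <= q) ->
  measurable (\big[setU/set0]_(i <- s) F i) /\
  fine (P (\big[setU/set0]_(i <- s) F i)) <= (size s)%:R * q.
Proof.
elim: s => [|i s IH] Fq; first by rewrite big_nil measure0 mul0r.
have [mF FP] := Fq i (mem_head _ _).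
have [|mB BP] := IH; first by move=> k ks; apply: Fq; rewrite inE ks orbT.
rewrite big_cons; split; first exact: measurableU.
rewrite /= -nat1r mulrDl mul1r; apply: le_trans (lerD FP BP).
rewrite -fineD; [|exact: fin_num_measure|exact: fin_num_measure].
apply: fine_le; last exact: measureU2.
  by apply: fin_num_measure; exact: measurableU.
by rewrite fin_numD !fin_num_measure.
Qed.

(** * Deviation event and error bound *)

Lemma lasso_frobenius (R : realType) (N p T s : nat) (tau lam delta : R)
    (rp : int -> 'cV[R]_N) (Bh B : 'M[R]_(1 + p * vech_dim N, vech_dim N))
    (G : 'M[R]_(1 + p * vech_dim N)) :
  (0 < T)%N -> 0 < lam -> 0 <= delta -> G^T = G -> 0 < lambda_min G ->
  is_estimator T tau lam rp Bh -> col_sparse s B ->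
  2 * delta * (1 + norm1inf B) <= lam ->
  (forall a b, `|\sum_k Xmx p T tau rp k a * Xmx p T tau rp k b - T%:R * G a b|
    <= T%:R * delta) ->
  (forall a j, `|\sum_k Ymx T tau rp k j * Xmx p T tau rp k a
      - T%:R * \sum_b B b j * G b a| <= T%:R * delta) ->
  normF (Bh - B) <= Num.sqrt (vech_dim N)%:R *
    (4 * Num.sqrt s%:R * (3 * lam + 4 * norm1inf B * delta) / lambda_min G).
Proof.
move=> T0 lam0 delta0 symG Gpos est Bs lamd gram cross.
have T0' : 0 < T%:R :> R by rewrite ltr0n.
have theta0 : 0 <= norm1inf B by apply/bigmax_geP; left.
apply: normF_columns.
  rewrite divr_ge0 ?(ltW Gpos)// mulr_ge0 ?mulr_ge0 ?sqrtr_ge0//.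
  by rewrite addr_ge0 ?mulr_ge0 ?(ltW lam0).
move=> j; rewrite ler_pdivlMr// mulrC.
have -> : \sum_i (Bh - B) i j ^+ 2 = \sum_i (Bh i j - B i j) ^+ 2.
  by apply: eq_bigr => i _; rewrite !mxE.
apply: (@lasso_column _ T _ s
  (fun k a => Xmx p T tau rp k a) (fun k => Ymx T tau rp k j)
  (fun a => Bh a j) (fun a => B a j) (fun a b => G a b)) => //.
- move=> v; have := lambda_min_quad symG (\row_a v a).
  have -> : ((\row_a v a) *m (\row_a v a)^T) 0 0 = \sum_a v a ^+ 2.
    by rewrite mxE; apply: eq_bigr => a _; rewrite !mxE expr2.
  have -> // : ((\row_a v a) *m G *m (\row_a v a)^T) 0 0 =
      \sum_a \sum_b v a * v b * G a b.
  rewrite mxE exchange_big; apply: eq_bigr => b _; rewrite mxE mulr_suml.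
  by apply: eq_bigr => a _; rewrite !mxE; ring.
- exact: estimator_column.
- move=> a.
  (* The population parts cancel, leaving a cross-moment deviation minus a [B]-weighted sum of Gram
     deviations; this gives [delta * (1 + norm1inf B)]. *)
  have -> : \sum_k Xmx p T tau rp k a *
      (Ymx T tau rp k j - \sum_b Xmx p T tau rp k b * B b j) =
    (\sum_k Ymx T tau rp k j * Xmx p T tau rp k a - T%:R * \sum_b B b j * G b a)
    - \sum_b B b j *
      (\sum_k Xmx p T tau rp k b * Xmx p T tau rp k a - T%:R * G b a).
    under [X in _ = _ - X]eq_bigr do rewrite mulrBr.
    rewrite sumrB.
    have -> : \sum_b B b j * (T%:R * G b a) = T%:R * \sum_b B b j * G b a.
      by rewrite mulr_sumr; apply: eq_bigr => b _; ring.
    rewrite opprB addrA subrK.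
    under eq_bigr do rewrite mulrBr mulr_sumr.
    rewrite sumrB; congr (_ - _).
      by apply: eq_bigr => k _; rewrite mulrC.
    rewrite exchange_big; apply: eq_bigr => b _; rewrite mulr_sumr.
    by apply: eq_bigr => k _; ring.
  apply: le_trans (ler_normB _ _) _.
  apply: (@le_trans _ _ (T%:R * delta + norm1inf B * (T%:R * delta))).
    rewrite lerD//; apply: le_trans (ler_norm_sum _ _ _) _.
    apply: (@le_trans _ _ (\sum_b `|B b j| * (T%:R * delta))).
      by apply: ler_sum => b _; rewrite normrM ler_wpM2l.
    rewrite -mulr_suml ler_wpM2r ?col_norm1_le// mulr_ge0// ltW//.
  rewrite (_ : _ + _ = T%:R * (delta * (1 + norm1inf B))); last by ring.
  by rewrite ler_pM2l// ler_pdivlMr// mulrC mulrA.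
- move=> a b.
  rewrite -(ler_pM2l T0') -[X in X * `|_|]ger0_norm ?(ltW T0')// -normrM mulrBr.
  by rewrite mulrA divff ?gt_eqF// mul1r; exact: gram.
- exact: col_norm1_le.
Qed.

Section ExponentBound.
Variables (R : realType) (p N T : nat) (eps M tau : R) (c s : nat).
Hypothesis heps : 0 < eps <= 1.
Hypothesis M1 : 1 <= M.
Local Notation L := (log_dim R p N).
Local Notation l := (ln (T%:R : R)).
Hypothesis L0 : 0 < L.
Hypothesis l0 : 0 < l.
Hypothesis LT : L <= T_eff R T.
Local Notation root := ((M * T_eff R T / L) `^ (4 + 4 * eps)^-1).
Hypothesis tau_ge : root <= tau.
Hypothesis tau_le : tau <= 2 * root.
Hypothesis s0 : (0 < s)%N.
Local Notation level := (trunc_level p N T eps M).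

Let root0 : 0 < root.
Proof. exact: lt_le_trans ltr01 (trunc_root_ge1 heps M1 L0 LT). Qed.

Lemma tau4_ge : level <= tau ^+ 4.
Proof.
rewrite -(trunc_level_root p N T M heps) lerXn2r ?nnegrE ?(ltW root0)//.
exact: ltW (lt_le_trans root0 tau_ge).
Qed.

Lemma tau4_le : tau ^+ 4 <= 16 * level.
Proof.
rewrite -(trunc_level_root p N T M heps) (_ : 16 = 2 ^+ 4 :> R); last by ring.
rewrite -exprMn lerXn2r ?nnegrE ?mulr_ge0 ?(ltW root0)//.
exact: ltW (lt_le_trans root0 tau_ge).
Qed.

(** The variance term is at most 2 L l and the deviation term at least 5 s L l, so that with s >= 1
    a surplus of 3 s L l remains. *)
Lemma exponent_bound :
  6 + 2 * T%:R * ((tau ^+ 4) `^ (1 - eps) * (4 * M)) / ((2 * tau ^+ 4) ^+ 2 * l)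
  - 640 * (2 + 3 * c)%:R * s%:R * (T%:R * rate p N T eps M) /
      ((2 + 3 * c)%:R * (4 * (2 * tau ^+ 4) * l)) <= 6 - 3 * (s%:R * L * l).
Proof.
have level0 : 0 < level by exact: lt_le_trans (trunc_level_ge1 heps M1 L0 LT).
have ge := tau4_ge; have le := tau4_le.
have tau0 : 0 < tau by exact: lt_le_trans root0 tau_ge.
have Te0 : 0 < T_eff R T by exact: lt_le_trans LT.
have u0 : 0 < M * T_eff R T / L.
  by rewrite divr_gt0// mulr_gt0// (lt_le_trans ltr01 M1).
set B := tau ^+ 4 in ge le *.
have B0 : 0 < B by exact: lt_le_trans ge.
have c0 : 0 < (2 + 3 * c)%:R :> R by rewrite ltr0n addn_gt0.
have T0 : 0 < T%:R :> R.
  have : 0 < T_eff R T by exact: lt_le_trans LT.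
  by rewrite /T_eff pmulr_lgt0 ?invr_gt0 ?exprn_gt0.
rewrite (T_rate heps M1 L0 l0 LT).
have le1 : 2 * T%:R * (B `^ (1 - eps) * (4 * M)) / ((2 * B) ^+ 2 * l) <= 2 * (L * l).
  have -> : B `^ (1 - eps) = B ^+ 2 * B `^ (- (1 + eps)).
    rewrite -powR_mulrn ?(ltW B0)// -powRD; last by rewrite [B == 0]gt_eqF// implybT.
    by congr (_ `^ _); ring.
  have -> : 2 * T%:R * (B ^+ 2 * B `^ (- (1 + eps)) * (4 * M)) / ((2 * B) ^+ 2 * l) =
      2 * (T%:R * M * B `^ (- (1 + eps))) / l.
    by move: (B `^ (- (1 + eps))) => z; field; rewrite !gt_eqF.
  rewrite ler_pdivrMr// (_ : 2 * (L * l) * l = 2 * (L * l ^+ 2)); last by ring.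
  rewrite ler_pM2l// -(trunc_level_moment heps M1 L0 l0 LT).
  rewrite ler_pM2l ?mulr_gt0 ?(lt_le_trans ltr01 M1)//.
  rewrite !powRN lef_pV2 ?posrE ?powR_gt0//.
  rewrite ge0_ler_powR ?nnegrE ?(ltW level0) ?(ltW B0)//.
  by rewrite addr_ge0// ltW; case/andP: heps.
(* The factor 640 is 5 * 8 * 16: 8 from the Bernstein denominator with bound 2 tau^4, 16 from tau <=
   2 root. *)
have le2 : 5 * (s%:R * L * l) <= 640 * (2 + 3 * c)%:R * s%:R * (level * (L * l ^+ 2)) /
      ((2 + 3 * c)%:R * (4 * (2 * B) * l)).
  rewrite ler_pdivlMr ?mulr_gt0//.
  have : 5 * (s%:R * L * l) * ((2 + 3 * c)%:R * (4 * 2 * l)) * B <=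
      5 * (s%:R * L * l) * ((2 + 3 * c)%:R * (4 * 2 * l)) * (16 * level).
    by rewrite ler_wpM2l// ltW// !mulr_gt0// ltr0n.
  by rewrite expr2; move: (2 + 3 * c)%:R (s%:R : R) => u v; lra.
have s1 : 1 <= s%:R :> R by rewrite ler1n.
have : 0 <= (s%:R - 1) * (L * l) by rewrite mulr_ge0 ?subr_ge0// ltW// mulr_gt0.
move: le1 le2; set X1 := _ / _; set X2 := _ / (_ * _).
rewrite -!(mulrA s%:R L l) mulrBl mul1r; move: (s%:R * (L * l)) (L * l) => y z.
lra.
Qed.

End ExponentBound.

Section GoodEvent.
Context (disp : measure_display) (Om : measurableType disp) (R : realType).
Variable P : probability Om R.
Variables (N p T s : nat) (hN : (0 < N)%N).
Variables (Omega : 'M[R]_N) (K : 'I_p -> nat).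
Variable A : forall i : 'I_p, 'I_(K i) -> 'M[R]_N.
Variables (r eta : int -> Om -> 'cV[R]_N).
Variables (eps M tau rho Kmix : R) (lmix c : nat).
Hypothesis heps : 0 < eps <= 1.
Hypothesis M1 : 1 <= M.
Hypothesis model : bekk_arch P Omega A r eta.
Hypothesis stat : strictly_stationary P r.
Hypothesis moment : forall t j,
  ('E_P[(fun w => `|entry r t j w| `^ (4 + 4 * eps))%R] <= M%:E)%E.
Hypothesis rho0 : 0 < rho.
Hypothesis K1 : 1 <= Kmix.
Hypothesis mixing : forall l, (lmix <= l)%N ->
  alpha_mix P r l <= Kmix * expR (- (rho * l%:R)).
Hypothesis cP : (p + lmix <= c)%N /\ 2 + ln Kmix <= rho * (c - (p + lmix))%:R.
Local Notation d := (vech_dim N).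
Local Notation n := (1 + p * vech_dim N)%N.
Local Notation L := (log_dim R p N).
Local Notation l := (ln (T%:R : R)).
Hypothesis l1 : 1 <= l.
Hypothesis L0 : 0 < L.
Hypothesis LT : L <= T_eff R T.
Local Notation root := ((M * T_eff R T / L) `^ (4 + 4 * eps)^-1).
Hypothesis tau_ge : root <= tau.
Hypothesis tau_le : tau <= 2 * root.
Hypothesis s0 : (0 < s)%N.
Hypothesis p0 : (0 < p)%N.
Local Notation rt := (rate p N T eps M).

Let kap : R := 640 * (2 + 3 * c)%:R.
Let kap0 : 0 <= kap. Proof. exact: mulr_ge0 (ler0n _ _) (ler0n _ _). Qed.
Let mr : process r := bekk_r_process model.
Let l0 : 0 < l. Proof. exact: lt_le_trans l1. Qed.
Let tau1 : 1 <= tau. Proof. exact: le_trans (trunc_root_ge1 heps M1 L0 LT) tau_ge. Qed.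

Let Z (fs : seq (lag_entry N)) (i : nat) (w : Om) : R :=
  monomial (trunc_path tau (r^~ w)) i.+1%:Z fs.

Definition bad_event (fs : seq (lag_entry N)) : set Om :=
  [set w | kap * s%:R * (T%:R * rt) <=
     `|\sum_(i < T) (Z fs i w - \int[P]_w Z fs i w)| ].

Lemma measurable_bad_event fs : measurable (bad_event fs).
Proof.
have mS : measurable_fun setT
    (fun w => `|\sum_(i < T) (Z fs i w - \int[P]_w Z fs i w)|).
  apply: measurableT_comp => //; apply: measurable_sum => i.
  by apply: measurable_funB => //; exact: measurable_trunc_monomial_T.
have := mS measurableT `[kap * s%:R * (T%:R * rt), +oo[%classic (measurable_itv _).
rewrite setTI; congr measurable; apply/seteqP; split=> w /=;
  by rewrite in_itv/= andbT.
Qed.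

Lemma bad_event_le fs : size fs = 4%N -> all (lag_in 0 p) fs ->
  fine (P (bad_event fs)) <= 2 * expR (6 - 3 * (s%:R * L * l)).
Proof.
move=> fs4 fsp.
have x0 : 0 <= kap * s%:R * (T%:R * rt).
  apply: mulr_ge0; first exact: mulr_ge0 kap0 (ler0n _ _).
  exact: mulr_ge0 (ler0n _ _) (ltW (rate_gt0 heps M1 L0 LT)).
apply: le_trans (trunc_monomial_deviation mr heps M1 moment tau1 fs4 fsp
  rho0 K1 mixing cP l1 x0) _.
by rewrite ler_pM2l// ler_expR exponent_bound.
Qed.

(** The first family carries the Gram matrix, the second the cross moments that enter the score. *)
Definition moment_lists : seq (seq (lag_entry N)) :=
  [seq x_entries hN ab.1 ++ x_entries hN ab.2 | ab : 'I_n * 'I_n] ++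
  [seq y_entries hN 0 ja.1 ++ x_entries hN ja.2 | ja : 'I_d * 'I_n].

Definition good_event : set Om :=
  ~` \big[setU/set0]_(fs <- moment_lists) bad_event fs.

Lemma moment_listsP fs : fs \in moment_lists ->
  size fs = 4%N /\ all (lag_in 0 p) fs.
Proof.
rewrite mem_cat => /orP[] /mapP[[a b] _ ->] /=.
  rewrite size_cat !size_x_entries all_cat; split=> //.
  by rewrite !lag_in_weaken// lag_x_entries.
by rewrite size_x_entries; split=> //; rewrite lag_in_weaken// lag_x_entries.
Qed.

Lemma good_eventP : measurable good_event /\
  ((1 - 4 * expR 6 * expR (- (s%:R * l * L)))%:E <= P good_event)%E.
Proof.
have [mB PB] := @union_bound _ _ _ P _ moment_lists bad_event
  (2 * expR (6 - 3 * (s%:R * L * l))) (fun fs fsl => conj (measurable_bad_event fs)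
    (let: conj h1 h2 := moment_listsP fsl in bad_event_le h1 h2)).
split; first exact: measurableC.
rewrite probability_setC//.
set B := \big[setU/set0]_(_ <- _) _ in mB PB *.
rewrite -(fineK (fin_num_measure P _ mB)) -EFinB lee_fin lerD2l lerN2.
apply: (le_trans PB).
have nE : n%:R = expR L by rewrite /log_dim lnK ?posrE ?ltr0n.
(* With pd + 1 = exp L the union costs exp(2 L), which two of the three multiples of s L l absorb
   because s >= 1 and l >= 1. *)
have size_le : (size moment_lists)%:R <= 2 * expR (2 * L).
  rewrite size_cat !size_image !card_prod !card_ord.
  apply: (@le_trans _ _ (2 * (n * n)%:R)).
    rewrite -natrM ler_nat mul2n -addnn leq_add2l leq_mul2r.
    by rewrite (leq_trans _ (leq_addl _ _)) ?orbT// leq_pmull.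
  rewrite natrM nE -expRD ler_pM2l// (_ : 2 * L = L + L)//; ring.
apply: (@le_trans _ _ (2 * expR (2 * L) * (2 * expR (6 - 3 * (s%:R * L * l))))).
  by rewrite ler_wpM2r// mulr_ge0// expR_ge0.
rewrite (_ : _ * _ = 4 * (expR (2 * L) * expR (6 - 3 * (s%:R * L * l)))); last by ring.
rewrite -[leRHS]mulrA ler_pM2l// -!expRD ler_expR.
have s1 : 1 <= s%:R :> R by rewrite ler1n.
have h1 : 0 <= (s%:R - 1) * (L * l) by rewrite mulr_ge0 ?subr_ge0// ltW// mulr_gt0.
have h2 : 0 <= L * (l - 1) by rewrite mulr_ge0 ?subr_ge0// ltW.
move: h1 h2; rewrite mulrBl mul1r mulrBr mulr1.
rewrite [s%:R * l * L](_ : _ = s%:R * (L * l)); last by ring.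
rewrite -mulrA.
by move: (s%:R * (L * l)) (L * l) => y z; lra.
Qed.

Lemma good_event_deviation w fs m : good_event w -> fs \in moment_lists ->
  (forall i, \int[P]_w monomial (r^~ w) i.+1%:Z fs = m) ->
  `|\sum_(i < T) Z fs i w - T%:R * m| <= T%:R * ((kap + 4) * s%:R * rt).
Proof.
move=> gw fsl mE; have [fs4 fsp] := moment_listsP fsl.
have nb : `|\sum_(i < T) (Z fs i w - \int[P]_w Z fs i w)| <=
    kap * s%:R * (T%:R * rt).
  rewrite leNgt; apply/negP => lt; apply: gw; rewrite -bigcup_seq.
  by exists fs => //; exact: ltW.
(* The bias bound is decreasing in [tau], so the lower bound on [tau] reduces it to 4 M level^(-
   eps), which is 4 times the rate. *)
have bias (i : 'I_T) : `|\int[P]_w Z fs i w - m| <= 4 * rt.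
  rewrite -(mE i); apply: le_trans (trunc_monomial_bias mr heps M1 moment tau1 _ fs4) _.
  rewrite (rateE heps M1 L0 LT).
  have lev0 : 0 < trunc_level p N T eps M.
    exact: lt_le_trans ltr01 (trunc_level_ge1 heps M1 L0 LT).
  have tau0 : 0 < tau by exact: lt_le_trans tau1.
  have M0 : 0 < M by exact: lt_le_trans M1.
  rewrite mulrC -mulrA !ler_pM2l//.
  have B0 : 0 < tau ^+ 4 by exact: exprn_gt0.
  rewrite !powRN lef_pV2 ?posrE; [|exact: powR_gt0|exact: powR_gt0].
  apply: ge0_ler_powR; rewrite ?nnegrE ?(ltW lev0) ?(ltW B0)//.
    by apply: ltW; case/andP: heps.
  exact: (tau4_ge heps M1 L0 LT tau_ge).
have -> : \sum_(i < T) Z fs i w - T%:R * m =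
    \sum_(i < T) (Z fs i w - \int[P]_w Z fs i w) +
    \sum_(i < T) (\int[P]_w Z fs i w - m).
  rewrite -big_split /= -[T%:R * m](_ : \sum_(i < T) m = _); last first.
    by rewrite sumr_const card_ord mulr_natl.
  by rewrite -sumrB; apply: eq_bigr => i _; ring.
apply: le_trans (ler_normD _ _) _.
have le2 : `|\sum_(i < T) (\int[P]_w Z fs i w - m)| <= T%:R * (4 * rt).
  apply: le_trans (ler_norm_sum _ _ _) _.
  apply: (@le_trans _ _ (\sum_(i < T) 4 * rt)); first exact: ler_sum.
  by rewrite sumr_const card_ord [leRHS]mulr_natl.
have s1 : 1 <= s%:R :> R by rewrite ler1n.
have rt0 := rate_gt0 heps M1 L0 LT.
have le3 : T%:R * (4 * rt) <= T%:R * (4 * s%:R * rt).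
  by rewrite ler_wpM2l// ler_wpM2r ?(ltW rt0)// ler_peMr.
apply: le_trans (lerD nb (le_trans le2 le3)) _.
by rewrite le_eqVlt; apply/orP; left; apply/eqP; ring.
Qed.

Lemma Gamma_xE a b : Gamma_x P p r a b =
  \int[P]_w monomial (r^~ w) 0 (x_entries hN a ++ x_entries hN b).
Proof.
rewrite mxE unlock /Rintegral; congr fine; apply: eq_integral => w _.
by rewrite !(xvecE hN) monomial_cat.
Qed.

Lemma good_event_error (lam : R) (Bh : 'M[R]_(n, d)) w : good_event w ->
  is_estimator T tau lam (r^~ w) Bh -> col_sparse s (Theta Omega A) ->
  0 < lambda_min (Gamma_x P p r) -> 0 < lam ->
  2 * ((kap + 4) * s%:R * rt) * (1 + norm1inf (Theta Omega A)) <= lam ->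
  normF (Bh - Theta Omega A) <= Num.sqrt d%:R *
    (4 * Num.sqrt s%:R * (3 * lam + 4 * norm1inf (Theta Omega A) *
      ((kap + 4) * s%:R * rt)) / lambda_min (Gamma_x P p r)).
Proof.
move=> gw est sp Gpos lam0 lamd.
have T0 : (0 < T)%N.
  by rewrite lt0n; apply/eqP => T0; move: l1; rewrite T0 ln0//; lra.
have rt0 := rate_gt0 heps M1 L0 LT.
have symG : (Gamma_x P p r)^T = Gamma_x P p r.
  apply/matrixP => a b; rewrite !mxE; congr fine.
  by rewrite unlock; apply: eq_integral => w' _; rewrite mulrC.
have XZ (k : 'I_T) a : Xmx p T tau (r^~ w) k a =
    monomial (trunc_path tau (r^~ w)) k.+1%:Z (x_entries hN a).
  by rewrite mxE (xvecE hN).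
apply: (@lasso_frobenius _ _ _ T s tau lam _ (r^~ w)) => //.
- apply: mulr_ge0 (ltW rt0); apply: mulr_ge0 (ler0n _ _).
  exact: addr_ge0 kap0 (ler0n _ _).
- move=> a b.
  have -> : \sum_k Xmx p T tau (r^~ w) k a * Xmx p T tau (r^~ w) k b =
      \sum_(k < T) Z (x_entries hN a ++ x_entries hN b) k w.
    by apply: eq_bigr => k _; rewrite !XZ /Z monomial_cat.
  have fsl : x_entries hN a ++ x_entries hN b \in moment_lists.
    by rewrite mem_cat; apply/orP; left; apply/mapP; exists (a, b); rewrite ?mem_enum.
  have [fs4 fsp] := moment_listsP fsl.
  apply: good_event_deviation => // i; rewrite Gamma_xE.
  exact: (monomial_stationary mr heps M1 moment _ stat fs4 fsp).
- move=> a j.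
  have -> : \sum_k Ymx T tau (r^~ w) k j * Xmx p T tau (r^~ w) k a =
      \sum_(k < T) Z (y_entries hN 0 j ++ x_entries hN a) k w.
    by apply: eq_bigr => k _; rewrite XZ mxE (yvec0E hN) /Z monomial_cat.
  have fsl : y_entries hN 0 j ++ x_entries hN a \in moment_lists.
    by rewrite mem_cat; apply/orP; right; apply/mapP; exists (j, a); rewrite ?mem_enum.
  apply: good_event_deviation => // i.
  rewrite (moment_equation hN model heps M1 moment) ?size_x_entries ?lag_x_entries//.
  apply: eq_bigr => b _; rewrite Gamma_xE; congr (_ * _).
  have fsl' : x_entries hN b ++ x_entries hN a \in moment_lists.
    by rewrite mem_cat; apply/orP; left; apply/mapP; exists (b, a); rewrite ?mem_enum.
  have [fs4 fsp] := moment_listsP fsl'.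
  exact: (monomial_stationary mr heps M1 moment _ stat fs4 fsp).
Qed.

End GoodEvent.

(** * Choice of the constants and conclusion *)

Theorem theorem1 (R : realType) (p : nat) (hp : (0 < p)%N)
    (eps : R) (heps : 0 < eps <= 1)
    (zbar : R) (hzbar : 0 <= zbar < 1)
    (Kmix : R) (hKmix : 0 < Kmix) (lmix : nat)
    (theta0 : R) (htheta0 : 0 < theta0) :
  exists cT atau btau alam blam C1 C2 C3 : R,
    [/\ 0 < cT, 0 < atau < btau, 0 < alam < blam &
        [/\ 0 < C1, 0 < C2 & 0 < C3]] /\
    forall (N T s sA : nat) (hN : (0 < N)%N)
      (disp : measure_display) (Om : measurableType disp)
      (P : probability Om R)
      (Omega : 'M[R]_N) (K : 'I_p -> nat)
      (A : forall i : 'I_p, 'I_(K i) -> 'M[R]_N)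
      (r eta : int -> Om -> 'cV[R]_N)
      (M44 zeta tau lambda : R)
      (Thetahat : Om -> 'M[R]_(1 + p * vech_dim N, vech_dim N)),
    bekk_arch P Omega A r eta ->
    (forall (i : 'I_p) (k : 'I_(K i)), row_sparse sA (A i k)) ->
    col_sparse s (Theta Omega A) ->
    theta0 <= norm1inf (Theta Omega A) ->
    strictly_stationary P r ->
    (forall t j,
      ('E_P[(fun w => `|entry r t j w| `^ (4 + 4 * eps))%R] <= M44%:E)%E) ->
    0 <= zeta <= zbar ->
    (forall l, (lmix <= l)%N -> alpha_mix P r l <= Kmix * zeta ^+ l) ->
    0 < lambda_min (Gamma_x P p r) ->
    let M := Num.max M44 1 in
    cT * N%:R `^ (1 + eps^-1) * log_dim R p N <= T%:R ->
    (let tau0 := (M * T_eff R T / log_dim R p N) `^ (4 + 4 * eps)^-1 in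
     atau * tau0 <= tau <= btau * tau0) ->
    (let lam0 := s%:R * norm1inf (Theta Omega A) * rate p N T eps M in
     alam * lam0 <= lambda <= blam * lam0) ->
    (forall w, is_estimator T tau lambda (r^~ w) (Thetahat w)) ->
    exists E : set Om,
      [/\ measurable E,
          ((1 - C1 * expR (- (C2 * s%:R * ln T%:R * log_dim R p N)))%:E
             <= P E)%E &
          forall w, E w ->
            normF (Thetahat w - Theta Omega A) <=
              C3 * (s%:R `^ (3 / 2) * N%:R * norm1inf (Theta Omega A)
                    * (lambda_min (Gamma_x P p r))^-1 * rate p N T eps M)].
Proof.
have /andP[z0 z1] := hzbar.
(* The maximum with 1/2 keeps [ln zb] meaningful when [zbar] is zero; [rho] is then an exponential
   mixing rate valid for every [zeta <= zbar]. *)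
pose zb := Num.max zbar 2^-1.
have zb0 : 0 < zb by rewrite /zb lt_max; apply/orP; right; lra.
have zb1 : zb < 1 by rewrite /zb gt_max z1; lra.
pose rho := - ln zb.
have rho0 : 0 < rho by rewrite /rho oppr_gt0 ln_lt0// zb0.
pose Km := Num.max Kmix 1.
have Km1 : 1 <= Km by rewrite le_max lexx orbT.
pose c1 := (Num.truncn ((2 + ln Km) / rho)).+1.
pose c := (p + lmix + c1)%N.
have cP : (p + lmix <= c)%N /\ 2 + ln Km <= rho * (c - (p + lmix))%:R.
  split; first exact: leq_addr.
  rewrite /c addKn mulrC -ler_pdivrMr//; apply: ltW; exact: truncnS_gt.
pose kap : R := 640 * (2 + 3 * c)%:R.
have kap0 : 0 <= kap by exact: mulr_ge0 (ler0n _ _) (ler0n _ _).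
(* The factor 1 + 1 / theta0 turns 1 + |Theta*| into a multiple of |Theta*|; the summand 4 next to
   [kap] is the truncation bias. *)
pose alam := 2 * (kap + 4) * (1 + theta0^-1).
have alam0 : 0 < alam.
  by rewrite /alam mulr_gt0 ?addr_gt0 ?invr_gt0// mulr_gt0// ltr_wpDl.
pose C3 := 4 * (3 * (alam + 1) + 4 * (kap + 4)).
(* Only [p], [eps], [zbar], [Kmix], [lmix] and [theta0] are in scope here, so no constant depends on
   N or T. The window 1 to 2 for tau is where 16 = 2^4 comes from. *)
exists (2 * expR (24 * (1 + ln (2 * p)%:R))), 1, 2, alam, (alam + 1),
  (4 * expR 6), 1, C3.
split.
  split; [|by rewrite ltr01 ltr1n|by rewrite alam0 ltrDl ltr01|].
    by rewrite mulr_gt0 ?expR_gt0.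
  split=> //.
  by rewrite /C3; lra.
move=> N T s sA hN disp Om P Omega K A r eta M44 zeta tau lambda Thetahat.
move=> model _ sp th0 stat mom /andP[zeta0 zeta1] mix Gpos M hT.
move=> /andP[tau_ge tau_le] /andP[lam_ge lam_le] est.
have M1 : 1 <= M by rewrite le_max lexx orbT.
have moment t j : ('E_P[(fun w => `|entry r t j w| `^ (4 + 4 * eps))%R] <= M%:E)%E.
  by apply: le_trans (mom t j) _; rewrite lee_fin le_max lexx.
have mixing l : (lmix <= l)%N -> alpha_mix P r l <= Km * expR (- (rho * l%:R)).
  move=> /mix mixl; apply: (le_trans mixl).
  have -> : expR (- (rho * l%:R)) = zb ^+ l.
    by rewrite -mulNr opprK expRM_natr lnK.
  apply: ler_pM; rewrite ?exprn_ge0 ?(ltW hKmix)//; first by rewrite le_max lexx.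
  rewrite lerXn2r ?nnegrE ?(ltW zb0)//.
  by rewrite (le_trans zeta1)// le_max lexx.
have [l1 LT] := sample_size hp hN heps hT.
have L0 : 0 < log_dim R p N.
  by apply: lt_le_trans (log_dim_ge R hp hN); rewrite invr_gt0.
have l0 : 0 < ln (T%:R : R) by exact: lt_le_trans l1.
have rt0 := rate_gt0 heps M1 L0 LT.
set rt := rate p N T eps M in rt0 lam_ge lam_le *.
set th := norm1inf (Theta Omega A) in th0 lam_ge lam_le *.
have thp : 0 < th by exact: lt_le_trans th0.
have s0 : (0 < s)%N by exact: norm1inf_gt0_sparse sp.
have s0' : 0 < s%:R :> R by rewrite ltr0n.
have tau_ge' : (M * T_eff R T / log_dim R p N) `^ (4 + 4 * eps)^-1 <= tau.
  by move: tau_ge; rewrite mul1r.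
have lam0 : 0 < lambda.
  exact: lt_le_trans (mulr_gt0 alam0 (mulr_gt0 (mulr_gt0 s0' thp) rt0)) lam_ge.
have [mE PE] := good_eventP hN heps M1 model moment rho0 Km1 mixing cP l1 L0 LT
  tau_ge' tau_le s0 hp.
exists (good_event P p T s hN r eps M tau c); split=> //.
  by rewrite mul1r.
move=> w gw.
have lamd : 2 * ((kap + 4) * s%:R * rt) * (1 + th) <= lambda.
  apply: le_trans lam_ge; rewrite /alam.
  have : 1 <= theta0^-1 * th by rewrite -ler_pdivrMl ?invr_gt0// invrK mulr1.
  move=> tt.
  have : 0 <= 2 * (kap + 4) * (s%:R * rt) * (theta0^-1 * th - 1).
    apply: mulr_ge0; last by rewrite subr_ge0.
    apply: mulr_ge0 (ltW (mulr_gt0 s0' rt0)).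
    exact: mulr_ge0 (ler0n _ 2) (addr_ge0 kap0 (ler0n _ 4)).
  by move: (theta0^-1) => q; lra.
have err := good_event_error heps M1 model stat moment l1 L0 LT
  tau_ge' s0 gw (est w) sp Gpos lam0 lamd.
apply: (le_trans err).
rewrite -/kap -/rt -/th.
set lmin := lambda_min _ in Gpos *.
(* The d columns contribute a factor sqrt d, which becomes N through d <= N^2. *)
have dN : Num.sqrt (vech_dim N)%:R <= N%:R :> R.
  rewrite -[leRHS](ger0_norm (ler0n _ _)) -sqrtr_sqr ler_wsqrtr// -natrX ler_nat.
  by rewrite expnS expn1 vech_dim_le.
have s32 : s%:R `^ (3 / 2) = s%:R * Num.sqrt s%:R :> R.
  rewrite (_ : 3 / 2 = 1 + 2^-1); last by field.
  rewrite powRD; last by rewrite [s%:R == 0]gt_eqF// implybT.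
  by rewrite powRr1 ?ler0n// powR12_sqrt ?ler0n.
rewrite s32.
have bnd : 3 * lambda + 4 * th * ((kap + 4) * s%:R * rt) <=
    (3 * (alam + 1) + 4 * (kap + 4)) * (s%:R * th * rt).
  by move: lam_le; clear; lra.
have -> : C3 * (s%:R * Num.sqrt s%:R * N%:R * th / lmin * rt) =
    N%:R * (4 * Num.sqrt s%:R * ((3 * (alam + 1) + 4 * (kap + 4)) * (s%:R * th * rt)) / lmin).
  by rewrite /C3; ring.
apply: ler_pM => //.
- apply: divr_ge0 (ltW Gpos); apply: mulr_ge0.
    exact: mulr_ge0 (ler0n _ 4) (sqrtr_ge0 _).
  apply: addr_ge0; first exact: mulr_ge0 (ler0n _ 3) (ltW lam0).
  apply: mulr_ge0; first exact: mulr_ge0 (ler0n _ 4) (ltW thp).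
  apply: mulr_ge0 (ltW rt0); apply: mulr_ge0 (ler0n _ _).
  exact: addr_ge0 kap0 (ler0n _ 4).
- by rewrite ler_pM2r ?invr_gt0// ler_wpM2l ?mulr_ge0 ?sqrtr_ge0.
Qed.
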